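(* Let $F\in L^2(0,T;L^2(\mathbb{T}^d;\mathbb{R}^d))$, let $V_0\in L^2(\mathbb{T}^d;\mathbb{R}^d)$ have zero spatial mean and satisfy $\nabla\cdot V_0=0$, and let $\tilde V\in L^2(0,T;L^2(\mathbb{T}^d;\mathbb{R}^d))$ be a weak solution of the incompressible Euler equations on $(0,T)\times\mathbb{T}^d$ with forcing $F$ and initial data $V_0$. Consider the sup-inf problem with base state $\bar V=\tilde V$, $$\mathcal{J}_E[\bar V](V_0)=\sup_{(\lambda,\gamma)\in\mathcal{R}}\ \inf_{V}\Bigg(\int_0^T\!\!\int_{\mathbb{T}^d}\tfrac12 V^iV^j(\partial_j\lambda_i+\partial_i\lambda_j+a_V\delta_{ij})+V^i\big(\partial_t\lambda_i+\partial_i\gamma-a_V\bar V^i\big)\,dx\,dt$$ $$\qquad\qquad+\int_0^T\!\!\int_{\mathbb{T}^d}\Big(\tfrac12 a_V\bar V^i\bar V^i+F^i\lambda_i+\tfrac1T\lambda_i(0,x)V_0^i(x)\Big)\,dx\,dt\Bigg),$$ the infimum being over $V\in L^2(0,T;L^2(\mathbb{T}^d;\mathbb{R}^d))$. Then $(\lambda,\gamma)=(0,0)$ is a solution of this problem (the supremum over $\mathcal{R}$ is attained at $(0,0)$); hence $(0,0)$ is a variational dual solution of Euler, and the solution of Euler that corresponds to it through the dual-to-primal map is $V^{\mathcal{H}}=\tilde V$.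
   Context: Here $d\in\{2,3\}$, $\mathbb{T}^d=\mathbb{R}^d/\mathbb{Z}^d$, $T>0$ and $a_V>0$ are fixed, repeated indices are summed from $1$ to $d$, $\partial_i$, $\nabla$, $\mathrm{div}$ act in the space variable, and $X_T(Y)$ abbreviates $X(0,T;Y(\mathbb{T}^d))$. For a vector field $\lambda$, $\nabla^{sym}\lambda=\frac12(\nabla\lambda+(\nabla\lambda)^T)$. The Euler system is $\partial_tV^i+\partial_j(V^iV^j)+\partial_ip=F^i$, $\partial_iV^i=0$, $V(0,\cdot)=V_0$. A field $V\in L^2_T(L^2)$ is a weak solution if $$\int_0^T\!\!\int_{\mathbb{T}^d}\Big(V^i\partial_t\lambda_i+\tfrac12V^iV^j(\partial_j\lambda_i+\partial_i\lambda_j)+V^i\partial_i\gamma+F^i\lambda_i\Big)dx\,dt+\int_{\mathbb{T}^d}\lambda_i(0,x)V_0^i(x)\,dx=0$$ for all $\lambda\in C^\infty([0,T]\times\mathbb{T}^d;\mathbb{R}^d)$ with $\partial_i\lambda_i=0$ and $\lambda(T,\cdot)=0$, and all $\gamma\in C^\infty([0,T]\times\mathbb{T}^d)$. The class of dual variables is $$\mathcal{R}=\Big\{(\lambda,\gamma):\ \lambda\in H^1_T(L^2)\ (\mathbb{R}^d\text{-valued}),\ \nabla^{sym}\lambda\in L^\infty_T(L^\infty),\ \mathrm{div}\,\lambda=0,\ \lambda(T,x)=0\text{ for a.e. }x,\ \gamma\in L^2_T(H^1),\ \int_{\mathbb{T}^d}\gamma(t,x)\,dx=0\text{ for a.e.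 }t\Big\}.$$ A pair $(\lambda,\gamma)\in\mathcal{R}$ attaining the supremum in the sup-inf problem is called a variational dual solution of Euler (for the base state $\bar V$). The dual-to-primal map is $V^{i,\mathcal{H}}=(N^{-1})^{ij}(-\partial_j\gamma-\partial_t\lambda_j+a_V\bar V^j)$ with $N_{ij}=a_V\delta_{ij}+\partial_i\lambda_j+\partial_j\lambda_i$ (defined where $N$ is invertible; at $(\lambda,\gamma)=(0,0)$ one has $N=a_V\,\mathrm{Id}$). *)

(* Defs.v *)
From HB Require Import structures.
From mathcomp Require Import all_boot all_order all_algebra.
From mathcomp Require Import all_classical all_reals all_analysis.

Set Implicit Arguments.
Unset Strict Implicit.
Unset Printing Implicit Defensive.
Import Order.TTheory GRing.Theory Num.Theory.
Import numFieldNormedType.Exports.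

Local Open Scope classical_set_scope.
Local Open Scope ring_scope.

(* A function on the torus R^d / Z^d is a function on R^d (points are tuples)
   that is 1-periodic in each coordinate; a function on [0, T] x torus is a
   function of a pair (t, x), whose values at times t outside [0, T] are
   irrelevant.  measurableTypeR R is R with its Borel sigma-algebra. *)
Notation tpoint R d := (d.-tuple (measurableTypeR R)).
Notation spacetime R d := (measurableTypeR R * tpoint R d)%type.
Notation sfield R d := (spacetime R d -> R).
Notation vfield R d := ('I_d -> sfield R d).

Section measures.
Context (R : realType).

Definition cons_point (d : nat) (p : spacetime R d) : tpoint R d.+1 :=
  [tuple of p.1 :: p.2].

Lemma measurable_cons_point d : measurable_fun setT (@cons_point d).
Proof. exact: measurable_cons. Qed.

HB.instance Definition _ d :=
  isMeasurableFun.Build _ _ _ _ (@cons_point d) (@measurable_cons_point d).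

(* The d-fold product of Lebesgue measure on [0, 1]. *)
Fixpoint torus_measure (d : nat) : probability (tpoint R d) R :=
  match d with
  | 0 => [the probability _ R of dirac [tuple]]
  | d'.+1 => [the probability _ R of
      distribution (uniform_prob (@ltr01 R) \x torus_measure d')%E
                   (@cons_point d')]
  end.

Lemma lebesgue_time_lty (T : R) :
  (@lebesgue_measure R `]0%R, T[%classic < +oo)%E.
Proof.
by rewrite lebesgue_measure_itv; case: ifP => _ //; rewrite -EFinB ltry.
Qed.

Lemma measurable_time (T : R) :
  @measurable _ (measurableTypeR R) `]0%R, T[%classic.
Proof. exact: measurable_itv. Qed.

Definition time_measure (T : R) :
    {finite_measure set (measurableTypeR R) -> \bar R} :=
  mfrestr (measurable_time T) (lebesgue_time_lty T).

Definition spacetime_measure (T : R) (d : nat) :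
    {measure set (spacetime R d) -> \bar R} :=
  (time_measure T \x torus_measure d)%E.

End measures.

Section calculus.
Context (R : realType) (d : nat).
Implicit Types (x : tpoint R d) (f : sfield R d) (i : 'I_d).

Definition upd x i (s : R) : tpoint R d :=
  [tuple if j == i then s else tnth x j | j < d].

Definition periodic0 (g : tpoint R d -> R) : Prop :=
  forall x i, g (upd x i (tnth x i + 1)) = g x.

Definition periodic f : Prop := forall t, periodic0 (fun x => f (t, x)).

Definition dt f : sfield R d := fun p => derive1 (fun s => f (s, p.2)) p.1.

Definition dx i f : sfield R d :=
  fun p => derive1 (fun s => f (p.1, upd p.2 i s)) (tnth p.2 i).

Fixpoint Ck (k : nat) f : Prop :=
  continuous (fun p : R * 'rV[R]_d => f (p.1, [tuple p.2 ord0 i | i < d])) /\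
  match k with
  | 0 => True
  | k'.+1 =>
    [/\ forall p, derivable (fun s => f (s, p.2)) p.1 1,
        forall i p, derivable (fun s => f (p.1, upd p.2 i s)) (tnth p.2 i) 1,
        Ck k' (dt f)
      & forall i, Ck k' (dx i f)]
  end.

(* Elements of C^oo([0, T] x torus) are the restrictions to [0, T] of such
   functions. *)
Definition smooth f : Prop := (forall k, Ck k f) /\ periodic f.

Definition smooth0 (g : tpoint R d -> R) : Prop :=
  smooth (fun p : spacetime R d => g p.2).

Definition dx0 i (g : tpoint R d -> R) (x : tpoint R d) : R :=
  derive1 (fun s => g (upd x i s)) (tnth x i).

End calculus.

Section function_spaces.
Context (R : realType) (d : nat) (T : R).
Implicit Types (f g phi : sfield R d) (V lam : vfield R d) (i j : 'I_d).

Local Notation mu := (spacetime_measure T d).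
Local Notation nu := (torus_measure R d).

(* L^p(0, T; L^p(torus)), identified with L^p((0, T) x torus). *)
Definition Lp_field (p : \bar R) f : Prop := periodic f /\ f \in Lfun mu p.

Definition L2_vfield V : Prop := forall i, Lp_field 2%:E (V i).

Definition L2_torus (g : tpoint R d -> R) : Prop :=
  periodic0 g /\ g \in Lfun nu 2%:E.

(* C_c^oo((0, T) x torus), the test functions for distributional
   derivatives. *)
Definition test_function phi : Prop :=
  smooth phi /\
  exists a b : R, [/\ 0 < a, b < T &
    forall t x, ~~ (a <= t <= b) -> phi (t, x) = 0].

Definition is_weak_dt f g : Prop :=
  forall phi, test_function phi ->
    \int[mu]_p (f p * dt phi p) = - \int[mu]_p (g p * phi p).

Definition is_weak_dx i f g : Prop :=
  forall phi, test_function phi ->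
    \int[mu]_p (f p * dx i phi p) = - \int[mu]_p (g p * phi p).

(* g is the (i, j) entry of the distributional symmetric gradient of lam; the
   separate derivatives of the components need not be functions. *)
Definition is_weak_symgrad lam i j g : Prop :=
  forall phi, test_function phi ->
    \int[mu]_p (2^-1 * (lam j p * dx i phi p + lam i p * dx j phi p)) =
    - \int[mu]_p (g p * phi p).

(* The weak derivatives of f are chosen representatives (unique up to null
   sets), equal to 0 when there is none in the indicated space. *)
Definition weak_dt f : sfield R d :=
  xget (cst 0) [set g | Lp_field 2%:E g /\ is_weak_dt f g].

Definition weak_dx i f : sfield R d :=
  xget (cst 0) [set g | Lp_field 2%:E g /\ is_weak_dx i f g].

Definition weak_symgrad lam i j : sfield R d :=
  xget (cst 0) [set g | Lp_field +oo%E g /\ is_weak_symgrad lam i j g].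

Definition weak_divfree lam : Prop :=
  forall phi, test_function phi ->
    \int[mu]_p (\sum_i lam i p * dx i phi p) = 0.

Definition weak_divfree0 (W : 'I_d -> tpoint R d -> R) : Prop :=
  forall psi, smooth0 psi -> \int[nu]_x (\sum_i W i x * dx0 i psi x) = 0.

Definition continuous_L2 f : Prop :=
  (forall t, 0 <= t <= T -> L2_torus (fun x => f (t, x))) /\
  (forall s, 0 <= s <= T ->
    (fun t => \int[nu]_x ((f (t, x) - f (s, x)) ^+ 2))
      @ within `[0, T] (nbhs s) --> (0 : R)).

(* H^1(0, T; L^2(torus)). Its elements have a representative in
   C([0, T]; L^2(torus)); f is required to be that one, so that f (0, _) and
   f (T, _) are the traces. *)
Definition H1_L2 f : Prop :=
  [/\ Lp_field 2%:E f,
      exists g, Lp_field 2%:E g /\ is_weak_dt f g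
    & continuous_L2 f].

Definition L2_H1 f : Prop :=
  Lp_field 2%:E f /\
  forall i, exists g, Lp_field 2%:E g /\ is_weak_dx i f g.

End function_spaces.

Section euler.
Context (R : realType) (d : nat) (T : R).
Implicit Types (lam V : vfield R d) (gam : sfield R d).

Local Notation mu := (spacetime_measure T d).
Local Notation nu := (torus_measure R d).

Definition weak_solution (F : vfield R d) (V0 : 'I_d -> tpoint R d -> R) V :
    Prop :=
  L2_vfield T V /\
  forall lam gam,
    (forall i, smooth (lam i)) -> smooth gam ->
    (forall t x, 0 <= t <= T -> \sum_i dx i (lam i) (t, x) = 0) ->
    (forall i x, lam i (T, x) = 0) ->
    \int[mu]_p (\sum_i V i p * dt (lam i) p
                + 2^-1 * (\sum_i \sum_j V i p * V j p
                            * (dx j (lam i) p + dx i (lam j) p))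
                + \sum_i V i p * dx i gam p
                + \sum_i F i p * lam i p)
    + \int[nu]_x (\sum_i lam i (0, x) * V0 i x) = 0.

Definition dual_class : set (vfield R d * sfield R d) :=
  [set lg | [/\ (forall i, H1_L2 T (lg.1 i)),
     (forall i j, exists g, Lp_field T +oo%E g /\
                            is_weak_symgrad T lg.1 i j g),
     weak_divfree T lg.1
   & (forall i, {ae nu, forall x, lg.1 i (T, x) = 0})] /\
     (L2_H1 T lg.2 /\
     {ae time_measure T, forall t, \int[nu]_x lg.2 (t, x) = 0})].

Section dual_problem.
Variables (aV : R) (F : vfield R d) (V0 : 'I_d -> tpoint R d -> R).
Variable Vbar : vfield R d.
Implicit Types lg : vfield R d * sfield R d.

(* N_ij = aV delta_ij + d_i lam_j + d_j lam_i *)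
Definition Nmx lam (p : spacetime R d) : 'M[R]_d :=
  \matrix_(i, j) (aV *+ (i == j) + 2 * weak_symgrad T lam i j p).

Definition functional lg V : R :=
  \int[mu]_p
    (2^-1 * (\sum_i \sum_j V i p * V j p * Nmx lg.1 p i j)
     + \sum_i V i p * (weak_dt T (lg.1 i) p + weak_dx T i lg.2 p
                       - aV * Vbar i p))
  + \int[mu]_p
    (2^-1 * aV * (\sum_i Vbar i p * Vbar i p)
     + \sum_i F i p * lg.1 i p
     + T^-1 * (\sum_i lg.1 i (0, p.2) * V0 i p.2)).

Definition inner_inf lg : \bar R :=
  ereal_inf [set (functional lg V)%:E | V in [set V | L2_vfield T V]].

Definition sup_inf : \bar R :=
  ereal_sup [set inner_inf lg | lg in dual_class].

Definition variational_dual_solution lg : Prop :=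
  dual_class lg /\ inner_inf lg = sup_inf.

Definition dual_to_primal lg : vfield R d := fun i p =>
  \sum_j invmx (Nmx lg.1 p) i j *
    (- weak_dx T j lg.2 p - weak_dt T (lg.1 j) p + aV * Vbar j p).

End dual_problem.
End euler.

(* Main.v *)
Require Import Defs.
From HB Require Import structures.
From mathcomp Require Import all_boot all_order all_algebra.
From mathcomp Require Import all_classical all_reals all_analysis.
From mathcomp Require Import measurable_realfun ess_sup_inf ring lra.
Set Implicit Arguments.
Unset Strict Implicit.
Unset Printing Implicit Defensive.
Import Order.TTheory GRing.Theory Num.Theory.
Import numFieldNormedType.Exports.
Local Open Scope classical_set_scope.
Local Open Scope ring_scope.

(* Write S (lam, gam) V for the functional.  Taking V = Vt in the infimum bounds
   inner_inf (lam, gam) by S (lam, gam) Vt, in which the terms with aV cancel and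
   the rest is the weak formulation of Euler for Vt tested with (lam, gam), hence
   0.  At (0, 0) the functional is aV / 2 times the squared L^2 distance from V to
   Vt, so its infimum is 0: the supremum is 0 and is attained at (0, 0).

   The weak formulation only allows smooth test fields, so lam and gam are
   mollified by integration against the product of the periodic kernels
   cos (pi (x_i - y_i)) ^+ (2 N) and of the even time kernel
   cos (w (t - s)) ^+ M + cos (w (t + s)) ^+ M, w = pi / (2 T), M odd, suitably
   normalised.  The even time kernel vanishes at t = T, as test fields must; its
   t-derivative is minus the s-derivative of the odd kernel, which vanishes at
   s = 0, so that the mollification of lam has as time derivative the odd
   mollification of the weak derivative of lam, without boundary term.  Space
   derivatives commute with the mollification, which preserves the divergence
   constraint and turns the bounded symmetric gradient into one converging
   against the integrable products V_i V_j.  By Schur's test these kernels are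
   approximate identities for pairings L^2 x L^2 and L^1 x L^infinity.  The
   initial trace converges because lam (0, _) is minus the time integral of the
   weak derivative of lam. *)

(** Cosine powers replace the usual bump functions because the addition formula makes them finite
    sums of products of one-variable functions. A mollified field is then a finite sum of products
    of smooth functions, so its smoothness and its derivatives follow by linearity and no integral
    has to be differentiated. The price is that kernel sections, unlike test functions, lack compact
    support in time. The cutoffs [lcut] and [rcut], built from [exp (- 1 / u)], bridge this gap;
    their derivatives act as Dirac masses at the ends of the interval and produce the boundary
    terms. The weak formulation is linear in the dual variables once [Vt] is fixed, so only pairings
    with fixed factors have to converge. An approximate identity is therefore tested only on
    indicators of boxes, where the integrals are explicit; Dynkin's theorem and the Schur bounds
    give the rest. The frequency [pi / (2 T)] puts the first zero of the cosine at [T], and an odd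
    power changes sign under reflection about that zero. *)

Notation intg m f := (integrable m setT (EFin \o f)).

(** * Integration *)

Section integration.
Context d (X : measurableType d) (R : realType).
Variable m : {measure set X -> \bar R}.
Implicit Types (f g h : X -> R).

Lemma ae_imp (P Q : X -> Prop) : {ae m, forall x, P x} ->
  (forall x, P x -> Q x) -> {ae m, forall x, Q x}.
Proof. by move=> mP PQ; apply: filterS mP. Qed.

Lemma ae_imp2 (P P' Q : X -> Prop) : {ae m, forall x, P x} ->
  {ae m, forall x, P' x} -> (forall x, P x -> P' x -> Q x) ->
  {ae m, forall x, Q x}.
Proof. by move=> mP mP' PQ; apply: filterS2 mP mP'. Qed.

Lemma ae_imp3 (P P' P'' Q : X -> Prop) : {ae m, forall x, P x} ->
  {ae m, forall x, P' x} -> {ae m, forall x, P'' x} ->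
  (forall x, P x -> P' x -> P'' x -> Q x) -> {ae m, forall x, Q x}.
Proof. by move=> mP mP' mP'' PQ; apply: filterS3 mP mP' mP''. Qed.

Lemma intg_measurable f : intg m f -> measurable_fun setT f.
Proof. by move=> /integrableP[/measurable_EFinP]. Qed.

Lemma intgD f g : intg m f -> intg m g -> intg m (fun x => f x + g x).
Proof. by move=> If Ig; exact: (integrableD measurableT If Ig). Qed.

Lemma intgB f g : intg m f -> intg m g -> intg m (fun x => f x - g x).
Proof.
by move=> If Ig; exact: (integrableB measurableT If Ig).
Qed.

Lemma intgZ a f : intg m f -> intg m (fun x => a * f x).
Proof. by move=> If; exact: (integrableZl measurableT a If). Qed.

Lemma intgN f : intg m f -> intg m (fun x => - f x).
Proof. by move=> If; exact: (integrableN If). Qed.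

Lemma intg_abs f : intg m f -> intg m (fun x => `|f x|).
Proof. by move=> If; exact: (integrable_abse If). Qed.

Lemma intg_sum (I : Type) (r : seq I) (F : I -> X -> R) :
  (forall i, intg m (F i)) -> intg m (fun x => \sum_(i <- r) F i x).
Proof.
move=> IF; have := @integrable_sum _ _ _ m _ measurableT I r xpredT
  (fun i => EFin \o F i) (fun i _ => IF i).
by apply: eq_integrable => // x _; rewrite /= -sumEFin.
Qed.

Lemma intg_le f g : measurable_fun setT f -> intg m g ->
  {ae m, forall x, `|f x| <= g x} -> intg m f.
Proof.
move=> mf Ig fg; apply/integrableP; split; first exact/measurable_EFinP.
have /integrableP[mg] := Ig; apply: le_lt_trans.
apply: ae_ge0_le_integral => //.
- by apply: measurableT_comp => //; exact/measurable_EFinP.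
- by apply: measurableT_comp => //; exact/measurable_EFinP.
- apply: filterS fg => x fgx _ /=; rewrite lee_fin.
  by rewrite (le_trans fgx)// ler_norm.
Qed.

Lemma intg_bounded_mull M f g : measurable_fun setT f -> intg m g ->
  {ae m, forall x, `|f x| <= M} -> intg m (fun x => f x * g x).
Proof.
move=> mf Ig fM; apply: (@intg_le _ (fun x => M * `|g x|)).
- by apply: measurable_funM => //; exact: intg_measurable Ig.
- by apply: intgZ; exact: intg_abs.
- by apply: filterS fM => x fM; rewrite normrM ler_wpM2r.
Qed.

Import HBNNSimple.

(* Only simple functions below f matter, so no measurability is needed. *)
Let ge0_integral_le_of_ae_eq (f g : X -> \bar R) :
  (forall x, 0 <= f x)%E -> (forall x, 0 <= g x)%E ->
  {ae m, forall x, f x = g x} -> (\int[m]_x f x <= \int[m]_x g x)%E.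
Proof.
move=> f0 g0 [N [mN N0 fgN]].
rewrite !ge0_integralTE//; apply/ge_ereal_sup => /= _ [h hf <-].
apply: ereal_sup_ubound; exists (proj_nnsfun h (measurableC mN)).
  move=> x; rewrite /= mindicE; have [xN|xN] := boolP (x \in ~` N); last first.
    by rewrite mulr0.
  rewrite mulr1 (le_trans (hf x))// le_eqVlt; apply/orP; left; apply/eqP.
  apply: contrapT => fgx; move: xN; rewrite inE; apply; exact: fgN.
rewrite -!integralT_nnsfun; apply: ae_eq_integral => //.
- exact/measurable_EFinP.
- exact/measurable_EFinP.
exists N; split => // x /= xfg; apply: contrapT => Nx; apply: xfg => _.
by rewrite mindicE mem_set//= mulr1.
Qed.

(** Positive and negative parts reduce this to the nonnegative bound, applied in both directions. It
    serves integrands of unknown measurability, such as the arbitrary [f] of [Rint_time]. *)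
Lemma Rint_ae_eq f g : {ae m, forall x, f x = g x} ->
  \int[m]_x f x = \int[m]_x g x.
Proof.
move=> fg; rewrite /Rintegral; congr fine; rewrite integralE [RHS]integralE.
by congr (_ - _)%E; apply/eqP; rewrite eq_le !ge0_integral_le_of_ae_eq//;
  apply: filterS fg => x; rewrite ?funeposE ?funenegE => ->.
Qed.

Lemma Rint_le_ae f g : intg m f -> intg m g ->
  {ae m, forall x, f x <= g x} -> \int[m]_x f x <= \int[m]_x g x.
Proof.
move=> If Ig fg; rewrite -subr_ge0 -RintegralB//.
rewrite (@Rint_ae_eq _ (fun x => `|g x - f x|)); first exact: Rintegral_ge0.
by apply: filterS fg => x fg; rewrite ger0_norm// subr_ge0.
Qed.

Lemma Rint_sum (I : Type) (r : seq I) (F : I -> X -> R) :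
  (forall i, intg m (F i)) ->
  \int[m]_x (\sum_(i <- r) F i x) = \sum_(i <- r) \int[m]_x F i x.
Proof.
move=> IF; elim: r => [|i s IH].
  by under eq_Rintegral do rewrite big_nil; rewrite big_nil Rintegral_cst// mul0r.
under eq_Rintegral do rewrite big_cons; rewrite big_cons RintegralD ?IH//.
exact: intg_sum.
Qed.

Lemma Rint_dct (f_ : nat -> X -> R) f g : (forall n, measurable_fun setT (f_ n)) ->
  measurable_fun setT f -> intg m g ->
  {ae m, forall x, f_ n x @[n --> \oo] --> f x} ->
  (forall n, {ae m, forall x, `|f_ n x| <= g x}) ->
  \int[m]_x f_ n x @[n --> \oo] --> \int[m]_x f x.
Proof.
move=> mf_ mf Ig ff fg.
have [] := @dominated_convergence _ _ _ m setT measurableT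
   (fun n => EFin \o f_ n) (EFin \o f) (EFin \o g).
- by move=> n; exact/measurable_EFinP.
- exact/measurable_EFinP.
- apply: filterS ff => x ff _; exact: (cvg_comp _ _ ff).
- exact: Ig.
- move/ae_foralln : fg; apply: filterS => x fg n _ /=; rewrite lee_fin; exact: fg.
move=> If _ Hc; apply: fine_cvg; rewrite fineK; first exact: Hc.
exact: (integrable_fin_num measurableT If).
Qed.

End integration.

Section finite_integration.
Context d (X : measurableType d) (R : realType).
Variable m : {finite_measure set X -> \bar R}.
Implicit Types (f g h : X -> R).

Lemma intg_cst (c : R) : intg m (fun=> c).
Proof. exact: finite_measure_integrable_cst. Qed.

Lemma intg_bounded M f : measurable_fun setT f ->
  {ae m, forall x, `|f x| <= M} -> intg m f.
Proof. by move=> mf fM; apply: (intg_le mf (intg_cst M)). Qed.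

Lemma intg_mul f g : measurable_fun setT f -> measurable_fun setT g ->
  intg m (fun x => f x ^+ 2) -> intg m (fun x => g x ^+ 2) ->
  intg m (fun x => f x * g x).
Proof.
move=> mf mg If Ig; apply: (intg_le _ (intgD If Ig)).
  exact: measurable_funM.
apply: aeW => x; rewrite normrM -(real_normK (num_real (f x))).
rewrite -(real_normK (num_real (g x))).
set a := `|f x|; set b := `|g x|.
have : 0 <= (a - b) ^+ 2 by exact: sqr_ge0.
have : 0 <= (a + b) ^+ 2 by exact: sqr_ge0.
by nra.
Qed.

Lemma intg_of_sq f : measurable_fun setT f -> intg m (fun x => f x ^+ 2) ->
  intg m f.
Proof.
move=> mf If; have := @intg_mul f (fun=> 1) mf (measurable_cst _) If.
rewrite expr1n => /(_ (intg_cst 1)).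
by apply: eq_integrable => // x _; rewrite /= mulr1.
Qed.

Lemma Rint_sq_eq0 f : measurable_fun setT f -> intg m (fun x => f x ^+ 2) ->
  \int[m]_x (f x ^+ 2) = 0 -> {ae m, forall x, f x = 0}.
Proof.
move=> mf If f0; have mf2 : measurable_fun setT (EFin \o (fun x => f x ^+ 2)).
  by apply/measurable_EFinP; exact: measurable_funX.
have := (ae_eq_integral_abs m measurableT mf2).1.
have -> : (\int[m]_x `|(EFin \o (fun x => f x ^+ 2)%R) x| = 0)%E.
  transitivity (\int[m]_x (f x ^+ 2)%:E)%E.
    by apply: eq_integral => x _ /=; rewrite ger0_norm ?sqr_ge0.
  have := congr1 EFin f0; rewrite /Rintegral fineK//.
  exact: integrable_fin_num.
move=> /(_ erefl); apply: filterS => x /= /(_ I) [] /eqP.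
by rewrite sqrf_eq0 => /eqP.
Qed.

End finite_integration.

Section product_integration.
Context d1 d2 (X : measurableType d1) (Y : measurableType d2) (R : realType).
Variables (m1 : {finite_measure set X -> \bar R}).
Variables (m2 : {finite_measure set Y -> \bar R}).
Local Notation m := (m1 \x m2)%E.

(* The library declares a finite product only for probability measures. *)
Definition finite_product : set (X * Y) -> \bar R := m.

HB.instance Definition _ := Measure.on finite_product.

Lemma finite_product_fin : fin_num_fun finite_product.
Proof.
move=> A mA; rewrite ge0_fin_numE//.
rewrite (@le_lt_trans _ _ (finite_product setT))//.
  by apply: le_measure; rewrite ?inE.
rewrite /finite_product -setXTT product_measure1E//.
by rewrite lte_mul_pinfty ?fin_num_measure// ltey_eq fin_num_measure.
Qed.

HB.instance Definition _ :=
  Measure_isFinite.Build _ _ _ finite_product finite_product_fin.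

Definition finite_product_measure :
  {finite_measure set (X * Y)%type -> \bar R} := finite_product.

Lemma ae_fst (P : X -> Prop) : {ae m1, forall x, P x} ->
  {ae m, forall z, P z.1}.
Proof.
move=> [N [mN N0 PN]]; exists (N `*` setT); split.
- exact: measurableX.
- by rewrite [LHS]product_measure1E//= [X in (X * _)%E]N0 mul0e.
- by move=> z /= Pz; split => //; exact: PN.
Qed.

Lemma ae_snd (P : Y -> Prop) : {ae m2, forall x, P x} ->
  {ae m, forall z, P z.2}.
Proof.
move=> [N [mN N0 PN]]; exists (setT `*` N); split.
- exact: measurableX.
- by rewrite [LHS]product_measure1E//= [X in (_ * X)%E]N0 mule0.
- by move=> z /= Pz; split => //; exact: PN.
Qed.

(** The real inner integral is [fine] of the extended one; the two agree for almost every [x],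
    namely where the extended integral is finite. *)
Lemma Rint_fubini (f : X * Y -> R) : intg m f ->
  \int[m]_z f z = \int[m1]_x \int[m2]_y f (x, y).
Proof.
move=> If; rewrite {1}/Rintegral -(integral12_prod_meas1 If).
have mF := measurable_fubini_F If.
have := integrable_ae measurableT (integrable_fubini_F If).
move=> Ffin; congr fine; apply: ae_eq_integral => //.
  exact/measurable_EFinP/measurableT_comp.
by apply: filterS Ffin => x /(_ I) /fineK Fx _; rewrite /Rintegral Fx.
Qed.

Lemma Rint_fubini2 (f : X * Y -> R) : intg m f ->
  \int[m]_z f z = \int[m2]_y \int[m1]_x f (x, y).
Proof.
move=> If; rewrite {1}/Rintegral -(integral21_prod_meas1 If).
have mF := measurable_fubini_G If.
have := ae_integrable2 If.
move=> Ffin; congr fine; apply: ae_eq_integral => //.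
  exact/measurable_EFinP/measurableT_comp.
apply: filterS Ffin => x Ix _; rewrite /Rintegral fineK//.
exact: (integrable_fin_num measurableT Ix).
Qed.

End product_integration.

Section tensor_integration.
Context d1 d2 (X : measurableType d1) (Y : measurableType d2) (R : realType).
Variables (m1 : {finite_measure set X -> \bar R}).
Variables (m2 : {finite_measure set Y -> \bar R}).
Local Notation m := (m1 \x m2)%E.

Lemma measurable_prodM (f : X -> R) (g : Y -> R) :
  measurable_fun setT f -> measurable_fun setT g ->
  measurable_fun setT (fun z : X * Y => f z.1 * g z.2).
Proof.
move=> mf mg; apply: measurable_funM.
  exact: (measurableT_comp mf (@measurable_fst _ _ X Y)).
exact: (measurableT_comp mg (@measurable_snd _ _ X Y)).
Qed.

Lemma intg_prod (f : X -> R) (g : Y -> R) :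
  intg m1 f -> intg m2 g -> intg m (fun z => f z.1 * g z.2).
Proof.
move=> If Ig; apply/integrable12ltyP.
  apply/measurable_EFinP; apply: measurable_prodM.
    exact: intg_measurable If.
  exact: intg_measurable Ig.
under eq_integral do under eq_integral do rewrite /= normrM EFinM.
have mg : measurable_fun setT (fun y => `|g y|%:E).
  by apply/measurable_EFinP/measurableT_comp => //; exact: intg_measurable Ig.
have mf : measurable_fun setT (fun y => `|f y|%:E).
  by apply/measurable_EFinP/measurableT_comp => //; exact: intg_measurable If.
under eq_integral do rewrite ge0_integralZl//=.
rewrite ge0_integralZr//; last exact: integral_ge0.
move: If Ig => /integrableP[_ If] /integrableP[_ Ig].
rewrite lte_mul_pinfty//; first exact: integral_ge0.
by rewrite ge0_fin_numE//; exact: integral_ge0.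
Qed.

Lemma Rint_prod (f : X -> R) (g : Y -> R) :
  intg m1 f -> intg m2 g ->
  \int[m]_z (f z.1 * g z.2) = (\int[m1]_x f x) * (\int[m2]_y g y).
Proof.
move=> If Ig; rewrite Rint_fubini; last exact: intg_prod.
under eq_Rintegral do rewrite /= RintegralZl//.
by rewrite RintegralZr.
Qed.

Lemma intg_fst (f : X -> R) : intg m1 f -> intg m (fun z => f z.1).
Proof.
move=> If; have := intg_prod If (intg_cst m2 1).
by apply: eq_integrable => // z _; rewrite /= mulr1.
Qed.

Lemma intg_snd (g : Y -> R) : intg m2 g -> intg m (fun z => g z.2).
Proof.
move=> Ig; have := intg_prod (intg_cst m1 1) Ig.
by apply: eq_integrable => // z _; rewrite /= mul1r.
Qed.

Lemma intg_Rint1 (f : X * Y -> R) : intg m f ->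
  intg m1 (fun x => \int[m2]_y f (x, y)).
Proof.
move=> If; have IF := integrable_fubini_F If.
have Ffin := integrable_ae measurableT IF.
have mF := measurable_fubini_F If.
apply/integrableP; split; first exact/measurable_EFinP/measurableT_comp.
move: (IF) => /integrableP[_]; apply: le_lt_trans.
apply: ae_ge0_le_integral => //.
- by apply/measurableT_comp => //; exact/measurable_EFinP/measurableT_comp.
- exact: measurableT_comp.
apply: filterS Ffin => x /(_ I) Fx _.
have := lexx (`|fubini_F m2 (EFin \o f) x|)%E.
by rewrite -{1}(fineK Fx).
Qed.

Lemma intg_Rint2 (f : X * Y -> R) : intg m f ->
  intg m2 (fun y => \int[m1]_x f (x, y)).
Proof.
move=> If; have Ffin := ae_integrable2 If.
have mf : measurable_fun setT (EFin \o f) by case/integrableP : If.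
have mG := measurable_fubini_G If.
apply/integrableP; split; first exact/measurable_EFinP/measurableT_comp.
have /(integrable21ltyP m1 m2 mf) := If; apply: le_lt_trans.
apply: ae_ge0_le_integral => //.
- by apply/measurableT_comp => //; exact/measurable_EFinP/measurableT_comp.
- by move=> y _; exact: integral_ge0.
- apply: (measurable_fun_fubini_tonelli_G (abse \o (EFin \o f))) => //.
  exact: measurableT_comp.
  by move=> z; exact: abse_ge0.
apply: filterS Ffin => y Iy _.
have := le_abse_integral m1 measurableT (measurable_int _ Iy).
by rewrite -{1}(fineK (integrable_fin_num measurableT Iy)).
Qed.

End tensor_integration.

(** * Approximate identities *)

Section approximate_identity.
Context d (X : measurableType d) (R : realType).
Variable m : {finite_measure set X -> \bar R}.
Implicit Types (h g : X -> R) (K : X -> X -> R).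

Definition measurable_kernel K :=
  measurable_fun setT (fun z : X * X => K z.1 z.2).

Definition bounded_kernel K := exists M, forall x y, `|K x y| <= M.

(** A weak notion of approximate identity. The two Schur bounds control the kernels uniformly in
    [N], and convergence is asked only for the averages of indicators of a class [G]. When [G] is a
    pi-system that generates the sigma-algebra, this already forces convergence of all pairings. *)
Record approx_id (G : set (set X)) (K : nat -> X -> X -> R) (C : R) := {
  approx_id_meas : forall N, measurable_kernel (K N);
  approx_id_bnd : forall N, bounded_kernel (K N);
  approx_id_schur1 : forall N, {ae m, forall x, \int[m]_y `|K N x y| <= C};
  approx_id_schur2 : forall N, {ae m, forall y, \int[m]_x `|K N x y| <= C};
  approx_id_cvg : forall A, G A ->
    {ae m, forall y, \int[m]_x (K N x y * \1_A x) @[N --> \oo] --> (\1_A y : R)}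
}.

Definition pairing K h g : R := \int[(m \x m)%E]_z (K z.1 z.2 * (h z.1 * g z.2)).

Lemma kernel_section1 K x : measurable_kernel K -> measurable_fun setT (K x).
Proof. by move=> mK; exact: (measurableT_comp mK (pair1_measurable x)). Qed.

Lemma kernel_section2 K y : measurable_kernel K ->
  measurable_fun setT (fun x => K x y).
Proof. by move=> mK; exact: (measurableT_comp mK (pair2_measurable y)). Qed.

Section fixed_kernel.
Variables (K : X -> X -> R) (C : R).
Hypotheses (mK : measurable_kernel K) (bK : bounded_kernel K).
Hypothesis schur1 : {ae m, forall x, \int[m]_y `|K x y| <= C}.
Hypothesis schur2 : {ae m, forall y, \int[m]_x `|K x y| <= C}.

Lemma kernel_intg (f : X * X -> R) : intg (m \x m)%E f ->
  intg (m \x m)%E (fun z => K z.1 z.2 * f z).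
Proof.
by case: bK => M KM If; apply: (intg_bounded_mull (M := M)) => //; exact: aeW.
Qed.

Lemma kernel_intg1 x g : intg m g -> intg m (fun y => K x y * g y).
Proof.
case: bK => M KM Ig; apply: (intg_bounded_mull (M := M)) => //; last exact: aeW.
exact: kernel_section1.
Qed.

Lemma kernel_intg2 y g : intg m g -> intg m (fun x => K x y * g x).
Proof.
case: bK => M KM Ig; apply: (intg_bounded_mull (M := M)) => //; last exact: aeW.
exact: kernel_section2.
Qed.

Lemma pairing1 h g : intg m h -> intg m g ->
  pairing K h g = \int[m]_x (h x * \int[m]_y (K x y * g y)).
Proof.
move=> Ih Ig; rewrite /pairing Rint_fubini; last exact/kernel_intg/intg_prod.
apply: eq_Rintegral => x _ /=; rewrite -RintegralZl//; last exact: kernel_intg1.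
by apply: eq_Rintegral => y _; rewrite mulrCA.
Qed.

Lemma pairing2 h g : intg m h -> intg m g ->
  pairing K h g = \int[m]_y ((\int[m]_x (K x y * h x)) * g y).
Proof.
move=> Ih Ig; rewrite /pairing Rint_fubini2; last exact/kernel_intg/intg_prod.
apply: eq_Rintegral => y _ /=; rewrite -RintegralZr//; last exact: kernel_intg2.
by apply: eq_Rintegral => x _; rewrite mulrA.
Qed.

Lemma schur_fst f : intg m f -> (forall x, 0 <= f x) ->
  \int[(m \x m)%E]_z (`|K z.1 z.2| * f z.1) <= C * \int[m]_x f x.
Proof.
move=> If f0; have Iz : intg (m \x m)%E (fun z => `|K z.1 z.2| * f z.1).
  have := intg_abs (kernel_intg (intg_fst m If)).
  by apply: eq_integrable => // z _; rewrite /= normrM (ger0_norm (f0 _)).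
rewrite (Rint_fubini Iz) -RintegralZl//; apply: Rint_le_ae.
- exact: intg_Rint1 Iz.
- exact: intgZ.
apply: filterS schur1 => x Kx /=; rewrite RintegralZr//; first exact: ler_wpM2r.
have := intg_abs (kernel_intg1 x (intg_cst m 1)).
by apply: eq_integrable => // z _; rewrite /= mulr1.
Qed.

Lemma schur_snd f : intg m f -> (forall x, 0 <= f x) ->
  \int[(m \x m)%E]_z (`|K z.1 z.2| * f z.2) <= C * \int[m]_x f x.
Proof.
move=> If f0; have Iz : intg (m \x m)%E (fun z => `|K z.1 z.2| * f z.2).
  have := intg_abs (kernel_intg (intg_snd m If)).
  by apply: eq_integrable => // z _; rewrite /= normrM (ger0_norm (f0 _)).
rewrite (Rint_fubini2 Iz) -RintegralZl//; apply: Rint_le_ae.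
- exact: intg_Rint2 Iz.
- exact: intgZ.
apply: filterS schur2 => x Kx /=; rewrite RintegralZr//; first exact: ler_wpM2r.
have := intg_abs (kernel_intg2 x (intg_cst m 1)).
by apply: eq_integrable => // z _; rewrite /= mulr1.
Qed.

Lemma pairing_bound1 h g M : intg m h -> measurable_fun setT g ->
  {ae m, forall x, `|g x| <= M} -> 0 <= M ->
  `|pairing K h g| <= C * M * \int[m]_x `|h x|.
Proof.
move=> Ih mg gM M0; have Ig := intg_bounded mg gM.
have Iz := kernel_intg (intg_prod Ih Ig).
apply: (le_trans (le_normr_Rintegral measurableT Iz)).
rewrite -mulrA -RintegralZl//; last exact: intg_abs.
apply: le_trans (schur_fst _ _); last 2 first.
- by apply/intgZ/intg_abs.
- by move=> x; rewrite mulr_ge0.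
apply: Rint_le_ae; first exact: intg_abs.
- have := intg_abs (kernel_intg (intg_fst m (intgZ M (intg_abs Ih)))).
  apply: eq_integrable => // z _; rewrite /= normrM (@ger0_norm _ (_ * _))//.
  by rewrite mulr_ge0.
apply: filterS (ae_snd m gM) => z gz; rewrite normrM ler_wpM2l// normrM mulrC.
exact: ler_wpM2r.
Qed.

(** Schur's test, with a weighted Young inequality in place of Cauchy-Schwarz. The free weight [e]
    makes the share of [h] as small as desired, at the cost of a factor on the share of [g]. *)
Lemma pairing_bound2 h g e : measurable_fun setT h -> measurable_fun setT g ->
  intg m (fun x => h x ^+ 2) -> intg m (fun x => g x ^+ 2) -> 0 < e ->
  `|pairing K h g| <=
    C * (e * \int[m]_x (h x ^+ 2) + e^-1 * \int[m]_x (g x ^+ 2)).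
Proof.
move=> mh mg Ih Ig e0.
have Iz := kernel_intg (intg_prod (intg_of_sq mh Ih) (intg_of_sq mg Ig)).
apply: (le_trans (le_normr_Rintegral measurableT Iz)).
rewrite -(RintegralZl e measurableT Ih) -(RintegralZl e^-1 measurableT Ig) mulrDr.
have H1 := schur_fst (intgZ e Ih) (fun x => mulr_ge0 (ltW e0) (sqr_ge0 (h x))).
have ei0 : 0 <= e^-1 by rewrite invr_ge0 ltW.
have H2 := schur_snd (intgZ e^-1 Ig) (fun x => mulr_ge0 ei0 (sqr_ge0 (g x))).
apply: le_trans (lerD H1 H2).
have I1 : intg (m \x m)%E (fun z => `|K z.1 z.2| * (e * h z.1 ^+ 2)).
  have := intg_abs (kernel_intg (intg_fst m (intgZ e Ih))).
  apply: eq_integrable => // z _; rewrite /= normrM (@ger0_norm _ (_ * _))//.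
  by rewrite mulr_ge0 ?sqr_ge0 ?ltW.
have I2 : intg (m \x m)%E (fun z => `|K z.1 z.2| * (e^-1 * g z.2 ^+ 2)).
  have := intg_abs (kernel_intg (intg_snd m (intgZ e^-1 Ig))).
  apply: eq_integrable => // z _; rewrite /= normrM (@ger0_norm _ (_ * _))//.
  by rewrite mulr_ge0 ?sqr_ge0.
rewrite -RintegralD//; apply: Rint_le_ae; [exact: intg_abs|exact: intgD|].
apply: aeW => z; rewrite normrM -mulrDr ler_wpM2l//.
rewrite normrM -(real_normK (num_real (h z.1))).
rewrite -(real_normK (num_real (g z.2))).
set a := `|h _|; set b := `|g _|.
have -> : e * a ^+ 2 + e^-1 * b ^+ 2 = (a * b) * 2 + e^-1 * (e * a - b) ^+ 2.
  by field; rewrite gt_eqF.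
have ab : 0 <= a * b by rewrite /a /b mulr_ge0.
have : 0 <= e^-1 * (e * a - b) ^+ 2 by rewrite mulr_ge0 ?sqr_ge0.
by lra.
Qed.

End fixed_kernel.

Section convergence.
Variables (G : set (set X)) (K : nat -> X -> X -> R) (C : R).
Hypotheses (GI : setI_closed G) (GT : G setT).
Hypothesis GE : @measurable _ X = <<s G >>.
Hypothesis KP : approx_id G K C.

Let mK := approx_id_meas KP.
Let bK := approx_id_bnd KP.
Let s1 := approx_id_schur1 KP.
Let s2 := approx_id_schur2 KP.

Section bounded.
Variables (g : X -> R) (M : R).
Hypotheses (mg : measurable_fun setT g) (gM : {ae m, forall x, `|g x| <= M}).
Hypothesis M0 : 0 <= M.

Let Ig : intg m g := intg_bounded mg gM.

Let converges h := pairing (K N) h g @[N --> \oo] --> \int[m]_x (h x * g x).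

Let Ihg h : intg m h -> intg m (fun x => h x * g x).
Proof.
move=> Ih; have := intg_bounded_mull mg Ih gM.
by apply: eq_integrable => // x _; rewrite /= mulrC.
Qed.

Let Iind A : measurable A -> intg m (\1_A : X -> R).
Proof.
move=> mA; apply: (@intg_bounded _ _ _ _ 1); first exact: measurable_indic.
by apply: aeW => x; rewrite indicE; case: (_ \in _); rewrite ?normr0 ?normr1.
Qed.

Let pairingD a h h' N : intg m h -> intg m h' ->
  pairing (K N) (fun x => a * h x + h' x) g =
  a * pairing (K N) h g + pairing (K N) h' g.
Proof.
move=> Ih Ih'; rewrite /pairing -RintegralZl//; last exact/kernel_intg/intg_prod.
rewrite -RintegralD//; last 2 first.
- exact/intgZ/kernel_intg/intg_prod.
- exact/kernel_intg/intg_prod.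
by apply: eq_Rintegral => z _; ring.
Qed.

Let convergesD a h h' : intg m h -> intg m h' ->
  converges h -> converges h' -> converges (fun x => a * h x + h' x).
Proof.
move=> Ih Ih' ch ch'; rewrite /converges.
under eq_fun do rewrite pairingD//.
under eq_Rintegral do rewrite mulrDl -mulrA.
rewrite RintegralD//; [|exact/intgZ/Ihg|exact: Ihg].
rewrite RintegralZl//; last exact: Ihg.
by apply: cvgD => //; apply: cvgMr.
Qed.

(* Uniform boundedness in N makes the set of good h closed in L^1. *)
Let converges_closed (h_ : nat -> X -> R) h :
  (forall n, intg m (h_ n)) -> intg m h ->
  (\int[m]_x `|h x - h_ n x| @[n --> \oo] --> 0) ->
  (forall n, converges (h_ n)) -> converges h.
Proof.
move=> Ih_ Ih hh ch; apply/cvgrPdist_le => e e0.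
(* Total cost of replacing [h] by [h_ n]: [M] for the limit integral and [|C| * M] for the pairing.
   The last summand keeps [D] positive, and the absolute value is there because the sign of [C] is
   not given. *)
pose D := `|C| * M + M + 1.
have D0 : 0 < D by rewrite /D ltr_wpDl// addr_ge0// mulr_ge0.
have [n hn] : exists n, \int[m]_x `|h x - h_ n x| <= e / 2 / D.
  have /cvgrPdist_le /(_ (e / 2 / D)) := hh.
  rewrite !divr_gt0// => /(_ isT) [n _ /(_ n (leqnn n))] /=.
  by rewrite sub0r normrN ger0_norm; [exists n|exact: Rintegral_ge0].
have /cvgrPdist_le /(_ (e / 2)) := ch n.
rewrite divr_gt0// => /(_ isT); apply: filterS => N /= HN.
have Id : intg m (fun x => h x - h_ n x) by exact: intgB.
have -> : \int[m]_x (h x * g x) - pairing (K N) h g =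
   \int[m]_x ((h x - h_ n x) * g x) - pairing (K N) (fun x => h x - h_ n x) g +
   (\int[m]_x (h_ n x * g x) - pairing (K N) (h_ n) g).
  rewrite [X in _ = X - _ + _](_ : _ = \int[m]_x (h x * g x) - \int[m]_x (h_ n x * g x)).
    have -> : pairing (K N) (fun x => h x - h_ n x) g =
       pairing (K N) h g - pairing (K N) (h_ n) g.
      have := pairingD (-1) N (Ih_ n) Ih.
      rewrite mulN1r addrC => <-; congr (pairing _ _ _).
      by apply/funext => x; ring.
    by ring.
  rewrite -RintegralB//; [|exact: Ihg|exact: Ihg].
  by apply: eq_Rintegral => x _; ring.
have step1 : `|\int[m]_x ((h x - h_ n x) * g x)| <= M * (e / 2 / D).
  apply: (le_trans (le_normr_Rintegral measurableT (Ihg Id))).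
  apply: le_trans (ler_wpM2l M0 hn); rewrite -RintegralZl//; last exact: intg_abs.
  apply: Rint_le_ae; [exact/intg_abs/Ihg|exact/intgZ/intg_abs|].
  by apply: filterS gM => x gx; rewrite normrM mulrC ler_wpM2r.
have step2 : `|pairing (K N) (fun x => h x - h_ n x) g| <= `|C| * M * (e / 2 / D).
  apply: (le_trans (pairing_bound1 (mK N) (bK N) (s1 N) Id mg gM M0)).
  apply: le_trans (ler_wpM2l _ hn); last by rewrite mulr_ge0.
  rewrite ler_wpM2r//; first exact: Rintegral_ge0.
  by rewrite ler_wpM2r// ler_norm.
have step3 : D * (e / 2 / D) = e / 2 by rewrite mulrC divfK// gt_eqF.
have pos : 0 <= e / 2 / D by rewrite !divr_ge0// ltW.
apply: (le_trans (ler_normD _ _)).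
apply: (le_trans (lerD (ler_normB _ _) HN)).
have : M * (e / 2 / D) + `|C| * M * (e / 2 / D) <= e / 2.
  by rewrite -[leRHS]step3 /D; nra.
lra.
Qed.

(** Integrating in the first variable leaves the averages of [\1_A], which converge almost
    everywhere and are bounded by [C] by the second Schur bound; dominated convergence with majorant
    [C * |g|] concludes. *)
Let converges_generator A : measurable A -> G A -> converges \1_A.
Proof.
move=> mA GA; rewrite /converges.
have -> : (fun N => pairing (K N) \1_A g) =
    (fun N => \int[m]_y ((\int[m]_x (K N x y * \1_A x)) * g y)).
  by apply/funext => N; rewrite pairing2//; exact: Iind.
apply: (@Rint_dct _ _ _ _ _ _ (fun y => C * `|g y|)).
- move=> N; apply: measurable_funM => //.
  apply: (@intg_measurable _ _ _ m).
  apply: (intg_Rint2 (f := fun z => K N z.1 z.2 * \1_A z.1)).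
  by apply: kernel_intg => //; apply: intg_fst; exact: Iind.
- by apply: measurable_funM => //; exact: measurable_indic.
- by apply/intgZ/intg_abs.
- apply: filterS (approx_id_cvg KP GA) => y hy; exact: cvgMl.
move=> N; apply: filterS (s2 N) => y hy; rewrite normrM ler_wpM2r//.
apply: le_trans hy; apply: (le_trans (le_normr_Rintegral measurableT _)).
  by apply: kernel_intg2 => //; exact: Iind.
apply: le_Rintegral => //.
- by apply: intg_abs; apply: kernel_intg2 => //; exact: Iind.
- have := intg_abs (kernel_intg2 (mK N) (bK N) y (intg_cst m 1)).
  by apply: eq_integrable => // z _; rewrite /= mulr1.
move=> x _; rewrite normrM ler_piMr// indicE.
by case: (_ \in _); rewrite ?normr0 ?normr1.
Qed.

(** Dynkin's pi-lambda theorem. Complements follow by linearity, since [G] contains the whole space;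
    a countable disjoint union is the limit in L^1 of its finite partial unions, so
    [converges_closed] applies. *)
Let converges_indic A : measurable A -> converges \1_A.
Proof.
move=> mA; have := mA; rewrite GE; move: A mA.
suff H : forall A, <<s G >> A -> converges \1_A by move=> A _; exact: H.
have mG A : G A -> measurable A by rewrite GE; exact: sub_gen_smallest.
apply: (dynkin_induction GE GI).
- by apply: converges_generator => //; exact: mG.
- by move=> A GA; apply: converges_generator => //; exact: mG.
- move=> A mA cA.
  rewrite (_ : \1_(~` A) = (fun x => -1 * \1_A x + (\1_setT : X -> R) x)).
    apply: convergesD => //; [exact: Iind|exact: Iind|].
    exact: converges_generator.
  apply/funext => x; rewrite !indicE in_setT in_setC.
  by case: (x \in A) => /=; ring.
- move=> F mF tF cF.
  pose S n := \big[setU/set0]_(k < n) F k.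
  have mS n : measurable (S n) by exact: bigsetU_measurable.
  have mU : measurable (\bigcup_k F k) by exact: bigcup_measurable.
  apply: (@converges_closed (fun n => \1_(S n))).
  - by move=> n; exact: Iind.
  - exact: Iind.
  - have -> : (0 : R) = \int[m]_x (0 : R) by rewrite Rintegral_cst// mul0r.
    apply: (@Rint_dct _ _ _ _ _ _ (fun=> 1)).
    + move=> n; apply: measurableT_comp => //.
      by apply: measurable_funB; exact: measurable_indic.
    + exact: measurable_cst.
    + exact: intg_cst.
    + apply: aeW => x; apply: cvg_near_cst.
      have [[k _ Fkx]|nUx] := pselect ((\bigcup_k F k) x).
        exists k.+1 => // n /= kn; rewrite !indicE (mem_set (_ : (\bigcup_k F k) x)); last first.
          by exists k.
        rewrite (mem_set (_ : S n x)) ?subrr ?normr0//.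
        by rewrite /S -bigcup_mkord; exists k.
      apply: nearW => n; rewrite !indicE (memNset nUx) memNset ?subrr ?normr0//.
      by rewrite /S -bigcup_mkord => -[k _ Fkx]; apply: nUx; exists k.
    + move=> n; apply: aeW => x; rewrite !indicE normr_id.
      by do 2 case: (_ \in _); rewrite ?subrr ?subr0 ?sub0r ?normrN ?normr0 ?normr1.
  elim=> [|n IH].
    rewrite (_ : \1_(S 0%N) = fun=> 0); last first.
      by rewrite /S big_ord0; apply/funext => x; rewrite indic0.
    rewrite /converges /pairing; apply: cvg_near_cst; apply: nearW => N.
    under eq_Rintegral do rewrite mul0r mulr0.
    under [RHS]eq_Rintegral do rewrite mul0r.
    by rewrite !Rintegral_cst// !mul0r.
  rewrite (_ : \1_(S n.+1) = (fun x => 1 * (\1_(S n) : X -> R) x + (\1_(F n) : X -> R) x)).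
    by apply: convergesD => //; exact: Iind.
  apply/funext => x; rewrite mul1r /S big_ord_recr /= !indicE.
  have [xF|xF] := boolP (x \in F n); last first.
    by rewrite in_setU (negbTE xF) orbF addr0.
  rewrite in_setU xF orbT (_ : x \in _ = false) ?add0r//.
  apply/negbTE; rewrite notin_setE -bigcup_mkord => -[k /= kn Fkx].
  have kE : k = n.
    by apply: (tF k n I I); exists x; split => //; exact: set_mem.
  by move: kn; rewrite kE ltnn.
Qed.

Import HBSimple.

(** Linearity passes from indicators to simple functions, and their density in L^1 passes to every
    integrable [h]. *)
Lemma pairing_cvg_bounded h : intg m h ->
  pairing (K N) h g @[N --> \oo] --> \int[m]_x (h x * g x).
Proof.
move=> Ih; have [h_ [Ih_ hh h1]] := approximation_sfun_integrable measurableT Ih.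
apply: (@converges_closed (fun n => h_ n)) => //.
  exact: (fine_cvg h1).
move=> n; have mpre r : measurable (h_ n @^-1` [set r]) by exact: measurable_sfunP.
suff H s : converges (fun x => \sum_(r <- s) r * (\1_(h_ n @^-1` [set r]) : X -> R) x).
  have := H (finmap.enum_fset (fset_set (range (h_ n)))).
  congr converges; apply/funext => x; rewrite [RHS]fimfunE fsbig_finite//.
elim: s => [|r s IH].
  under eq_fun do rewrite big_nil.
  rewrite /converges /pairing; apply: cvg_near_cst; apply: nearW => N.
  under eq_Rintegral do rewrite mul0r mulr0.
  under [RHS]eq_Rintegral do rewrite mul0r.
  by rewrite !Rintegral_cst// !mul0r.
under eq_fun do rewrite big_cons.
apply: convergesD => //; [exact: Iind| |exact: converges_indic].
by apply: intg_sum => i; apply: intgZ; exact: Iind.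
Qed.

End bounded.

Section square_integrable.
Variables (h g : X -> R).
Hypotheses (mh : measurable_fun setT h) (mg : measurable_fun setT g).
Hypotheses (Ih : intg m (fun x => h x ^+ 2)) (Ig : intg m (fun x => g x ^+ 2)).

Let trunc (n : nat) x := if `|g x| <= n%:R then g x else 0.

Let measurable_trunc n : measurable_fun setT (trunc n).
Proof.
apply: measurable_fun_ifT => //; apply: measurable_fun_ler => //.
exact: measurableT_comp.
Qed.

Let trunc_bounded n : {ae m, forall x, `|trunc n x| <= n%:R}.
Proof. by apply: aeW => x; rewrite /trunc; case: ifP => //; rewrite normr0. Qed.

Let trunc_diff n x : (g x - trunc n x) ^+ 2 <= g x ^+ 2.
Proof.
rewrite /trunc; case: ifP => _; last by rewrite subr0.
by rewrite subrr expr0n /= sqr_ge0.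
Qed.

Let intg_trunc_diff n : intg m (fun x => (g x - trunc n x) ^+ 2).
Proof.
apply: intg_le Ig _; first by apply: measurable_funX; exact: measurable_funB.
by apply: aeW => x; rewrite ger0_norm ?sqr_ge0.
Qed.

Let trunc_cvg : \int[m]_x ((g x - trunc n x) ^+ 2) @[n --> \oo] --> 0.
Proof.
have -> : (0 : R) = \int[m]_x (0 : R) by rewrite Rintegral_cst// mul0r.
apply: (Rint_dct _ _ Ig).
- by move=> n; apply: measurable_funX; exact: measurable_funB.
- exact: measurable_cst.
- apply: aeW => x; apply: cvg_near_cst.
  have [n _ Hn] := nbhs_infty_ger (`|g x|).
  by exists n => // k /Hn gk; rewrite /trunc gk subrr expr0n.
- by move=> n; apply: aeW => x; rewrite ger0_norm ?sqr_ge0.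
Qed.

(** Truncating [g] gives the bounded case; [pairing_bound2] controls the discarded part uniformly in
    [N]. *)
Lemma pairing_cvg_sq :
  pairing (K N) h g @[N --> \oo] --> \int[m]_x (h x * g x).
Proof.
have Ih1 := intg_of_sq mh Ih.
apply/cvgrPdist_le => e e0; pose D := `|C| + 1.
have D0 : 0 < D by rewrite /D ltr_wpDl.
pose I0 := \int[m]_x (h x ^+ 2).
have I00 : 0 <= I0 by apply: Rintegral_ge0 => x _; exact: sqr_ge0.
(* The weight is fixed first, so that the share of [h] satisfies [D * (r * I0) <= e / 4]. The
   truncation level is chosen afterwards so that [D * (r^-1 * J) <= e / 4] as well. The [+ 1] covers
   [I0 = 0]. *)
pose r := e / 4 / D / (I0 + 1).
have I1 : 0 < I0 + 1 by rewrite ltr_wpDl.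
have r0 : 0 < r by rewrite !divr_gt0.
have [n] : exists n, \int[m]_x ((g x - trunc n x) ^+ 2) <= r * (e / 4 / D).
  have /cvgrPdist_le /(_ (r * (e / 4 / D))) := trunc_cvg.
  rewrite mulr_gt0 ?divr_gt0// => /(_ isT) [n _ /(_ n (leqnn n))] /=.
  rewrite sub0r normrN ger0_norm; first by exists n.
  by apply: Rintegral_ge0 => x _; exact: sqr_ge0.
set J := \int[m]_x _ => Jn.
have mt := measurable_trunc n; have tb := trunc_bounded n.
have mB : measurable_fun setT (fun x => g x - trunc n x) by exact: measurable_funB.
have := pairing_cvg_bounded mt tb (ler0n _ n) Ih1.
move=> /cvgrPdist_le /(_ (e / 2)); rewrite divr_gt0// => /(_ isT).
apply: filterS => N /= HN.
have It := intg_bounded mt tb.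
have Id := intg_trunc_diff n.
have Id1 := intg_of_sq mB Id.
have step2 := pairing_bound2 (mK N) (bK N) (s1 N) (s2 N) mh mB Ih Id r0.
have step1 : `|\int[m]_x (h x * (g x - trunc n x))| <= r * I0 + r^-1 * J.
  have Ip := intg_mul mh mB Ih Id.
  apply: (le_trans (le_normr_Rintegral measurableT Ip)).
  rewrite -(RintegralZl r measurableT Ih) -(RintegralZl r^-1 measurableT Id).
  rewrite -RintegralD; [|by []|exact: intgZ|exact: intgZ].
  apply: Rint_le_ae; [exact: intg_abs|by apply: intgD; exact: intgZ|].
  apply: aeW => x; rewrite normrM -(real_normK (num_real (h x))).
  rewrite -(real_normK (num_real (g x - trunc n x))).
  set a := `|h _|; set b := `|_ - _|.
  have -> : r * a ^+ 2 + r^-1 * b ^+ 2 = (a * b) * 2 + r^-1 * (r * a - b) ^+ 2.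
    by field; rewrite gt_eqF.
  have ab : 0 <= a * b by rewrite /a /b mulr_ge0.
  have : 0 <= r^-1 * (r * a - b) ^+ 2.
    by rewrite mulr_ge0 ?sqr_ge0// invr_ge0 ltW.
  by lra.
have -> : \int[m]_x (h x * g x) - pairing (K N) h g =
    \int[m]_x (h x * (g x - trunc n x)) -
    pairing (K N) h (fun x => g x - trunc n x) +
    (\int[m]_x (h x * trunc n x) - pairing (K N) h (trunc n)).
  have Iht : intg m (fun x => h x * trunc n x).
    have := intg_bounded_mull mt Ih1 tb.
    by apply: eq_integrable => // x _; rewrite /= mulrC.
  have -> : \int[m]_x (h x * (g x - trunc n x)) =
      \int[m]_x (h x * g x) - \int[m]_x (h x * trunc n x).
    rewrite -RintegralB//; last exact: intg_mul.
    by apply: eq_Rintegral => x _; rewrite mulrBr.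
  have -> : pairing (K N) h (fun x => g x - trunc n x) =
     pairing (K N) h g - pairing (K N) h (trunc n).
    rewrite /pairing -RintegralB//.
    - by apply: eq_Rintegral => x _; rewrite !mulrBr.
    - by apply: kernel_intg => //; apply: intg_prod => //; exact: intg_of_sq.
    - by apply: kernel_intg => //; exact: intg_prod.
  by ring.
apply: (le_trans (ler_normD _ _)).
apply: (le_trans (lerD (ler_normB _ _) HN)).
have S0 : 0 <= r * I0 + r^-1 * J by exact: le_trans (normr_ge0 _) step1.
have {}step2 : `|pairing (K N) h (fun x => g x - trunc n x)| <=
    `|C| * (r * I0 + r^-1 * J).
  by apply: (le_trans step2); rewrite ler_wpM2r// ler_norm.
have B1 : D * (r * I0) <= e / 4.
  have -> : e / 4 = D * (r * (I0 + 1)).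
    by rewrite /r; field; rewrite !gt_eqF.
  by do 2 (apply: ler_wpM2l; first exact: ltW); rewrite lerDl.
have B2 : D * (r^-1 * J) <= e / 4.
  have -> : e / 4 = D * (r^-1 * (r * (e / 4 / D))).
    by field; rewrite !gt_eqF.
  by apply: ler_wpM2l; [exact: ltW|apply: ler_wpM2l; rewrite // invr_ge0 ltW].
have : D * (r * I0) + D * (r^-1 * J) =
  `|C| * (r * I0 + r^-1 * J) + (r * I0 + r^-1 * J) by rewrite /D; ring.
lra.
Qed.

End square_integrable.

(** Pairing [h] with itself gives zero for every [N], while these pairings converge to the integral
    of [h ^+ 2]. *)
Lemma approx_id_eq0 h : measurable_fun setT h -> intg m (fun x => h x ^+ 2) ->
  (forall N x, \int[m]_y (K N x y * h y) = 0) -> {ae m, forall x, h x = 0}.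
Proof.
move=> mh Ih h0; have Ih1 := intg_of_sq mh Ih.
apply: Rint_sq_eq0 => //.
have := pairing_cvg_sq mh mh Ih Ih.
rewrite (_ : (fun N => _) = fun=> 0); last first.
  apply/funext => N; rewrite pairing1//.
  by under eq_Rintegral do rewrite h0 mulr0; rewrite Rintegral_cst// mul0r.
move=> /(cvg_unique _ (cvg_cst _)) H.
by under eq_Rintegral do rewrite expr2; rewrite -H.
Qed.

End convergence.

End approximate_identity.

(** * Products of approximate identities *)

Section product_approximate_identity.
Context d1 d2 (X : measurableType d1) (Y : measurableType d2) (R : realType).
Variables (m1 : {finite_measure set X -> \bar R}).
Variables (m2 : {finite_measure set Y -> \bar R}).

Definition rectangles (G1 : set (set X)) (G2 : set (set Y)) : set (set (X * Y)) :=
  [set A `*` B | A in G1 & B in G2].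

Lemma rectangles_setI G1 G2 : setI_closed G1 -> setI_closed G2 ->
  setI_closed (rectangles G1 G2).
Proof.
move=> I1 I2 _ _ [A GA [B GB <-]] [A' GA' [B' GB' <-]].
by rewrite -setXI; exists (A `&` A'); [exact: I1|exists (B `&` B'); [exact: I2|]].
Qed.

Lemma rectangles_setT G1 G2 : G1 setT -> G2 setT -> rectangles G1 G2 setT.
Proof. by move=> T1 T2; exists setT => //; exists setT => //; rewrite setXTT. Qed.

Lemma rectangles_generate G1 G2 : G1 setT -> G2 setT ->
  @measurable _ X = <<s G1 >> -> @measurable _ Y = <<s G2 >> ->
  @measurable _ (X * Y)%type = <<s rectangles G1 G2 >>.
Proof.
move=> T1 T2 E1 E2; apply/seteqP; split; last first.
  apply: smallest_sub; first exact: sigma_algebra_measurable.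
  move=> _ [A GA [B GB <-]]; apply: measurableX.
    by rewrite E1; exact: sub_gen_smallest.
  by rewrite E2; exact: sub_gen_smallest.
apply: smallest_sub; first exact: smallest_sigma_algebra.
have sg G (T : pointedType) (f : X * Y -> T) (GT : set (set T)) :
    (forall A, GT A -> G (f @^-1` A)) ->
    preimage_set_system setT f <<s GT >> `<=` <<s G >>.
  move=> HG; have -> : preimage_set_system setT f <<s GT >> =
    <<s preimage_set_system setT f GT >> by rewrite g_sigma_preimageE.
  apply: smallest_sub; first exact: smallest_sigma_algebra.
  by move=> _ [A GA <-]; apply: sub_gen_smallest; rewrite setTI; exact: HG.
rewrite subUset E1 E2; split; apply: sg => A GA.
  by exists A => //; exists setT => //; apply/seteqP; split => z //= [].
by exists setT => //; exists A => //; apply/seteqP; split => z //= [].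
Qed.

(** For a product kernel the Schur integrals and the averages over rectangles factorise by Fubini,
    so the constants multiply and the limits are products of limits. *)
Lemma approx_id_prod G1 G2 K1 K2 C1 C2 :
  G1 `<=` measurable -> G2 `<=` measurable ->
  approx_id m1 G1 K1 C1 -> approx_id m2 G2 K2 C2 ->
  approx_id (finite_product_measure m1 m2) (rectangles G1 G2)
    (fun N z w => K1 N z.1 w.1 * K2 N z.2 w.2) (C1 * C2).
Proof.
move=> mG1 mG2 P1 P2.
have i1 N x : intg m1 (fun y => K1 N x y).
  have [M KM] := approx_id_bnd P1 N; apply: (@intg_bounded _ _ _ _ M).
    exact: kernel_section1 (approx_id_meas P1 N).
  exact: aeW.
have i1' N y : intg m1 (fun x => K1 N x y).
  have [M KM] := approx_id_bnd P1 N; apply: (@intg_bounded _ _ _ _ M).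
    exact: kernel_section2 (approx_id_meas P1 N).
  exact: aeW.
have i2 N x : intg m2 (fun y => K2 N x y).
  have [M KM] := approx_id_bnd P2 N; apply: (@intg_bounded _ _ _ _ M).
    exact: kernel_section1 (approx_id_meas P2 N).
  exact: aeW.
have i2' N y : intg m2 (fun x => K2 N x y).
  have [M KM] := approx_id_bnd P2 N; apply: (@intg_bounded _ _ _ _ M).
    exact: kernel_section2 (approx_id_meas P2 N).
  exact: aeW.
split.
- move=> N; apply: measurable_funM.
    apply: (@measurableT_comp _ _ _ _ _ _ (fun z : X * X => K1 N z.1 z.2) _
      (fun z : (X * Y) * (X * Y) => (z.1.1, z.2.1))).
      exact: approx_id_meas P1 N.
    apply/measurable_fun_pairP; split => /=.
      exact: (measurableT_comp measurable_fst measurable_fst).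
    exact: (measurableT_comp measurable_fst measurable_snd).
  apply: (@measurableT_comp _ _ _ _ _ _ (fun z : Y * Y => K2 N z.1 z.2) _
    (fun z : (X * Y) * (X * Y) => (z.1.2, z.2.2))).
    exact: approx_id_meas P2 N.
  apply/measurable_fun_pairP; split => /=.
    exact: (measurableT_comp measurable_snd measurable_fst).
  exact: (measurableT_comp measurable_snd measurable_snd).
- move=> N; have [M1 KM1] := approx_id_bnd P1 N.
  have [M2 KM2] := approx_id_bnd P2 N.
  by exists (M1 * M2) => x y; rewrite normrM ler_pM.
- move=> N; have := ae_fst m2 (approx_id_schur1 P1 N).
  have := ae_snd m1 (approx_id_schur1 P2 N).
  apply: filterS2 => z h2 h1; under eq_Rintegral do rewrite normrM.
  rewrite (Rint_prod (intg_abs (i1 N z.1)) (intg_abs (i2 N z.2))).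
  by rewrite ler_pM//; exact: Rintegral_ge0.
- move=> N; have := ae_fst m2 (approx_id_schur2 P1 N).
  have := ae_snd m1 (approx_id_schur2 P2 N).
  apply: filterS2 => z h2 h1; under eq_Rintegral do rewrite normrM.
  rewrite (Rint_prod (intg_abs (i1' N z.1)) (intg_abs (i2' N z.2))).
  by rewrite ler_pM//; exact: Rintegral_ge0.
move=> _ [A GA [B GB <-]].
have := ae_fst m2 (approx_id_cvg P1 GA).
have := ae_snd m1 (approx_id_cvg P2 GB).
apply: filterS2 => z c2 c1.
have mA := mG1 _ GA; have mB := mG2 _ GB.
have -> : (\1_(A `*` B) z : R) = \1_A z.1 * \1_B z.2.
  by rewrite !indicE in_setX -natrM mulnb.
rewrite (_ : (fun N => _) = (fun N => (\int[m1]_x (K1 N x z.1 * \1_A x)) *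
    (\int[m2]_y (K2 N y z.2 * \1_B y)))); first exact: cvgM.
apply/funext => N; rewrite -Rint_prod.
- apply: eq_Rintegral => w _.
  by rewrite !indicE in_setX -mulnb natrM mulrACA.
- apply: (kernel_intg2 (approx_id_meas P1 N) (approx_id_bnd P1 N)).
  apply: (@intg_bounded _ _ _ _ 1); first exact: measurable_indic.
  by apply: aeW => x; rewrite indicE; case: (_ \in _); rewrite ?normr0 ?normr1.
- apply: (kernel_intg2 (approx_id_meas P2 N) (approx_id_bnd P2 N)).
  apply: (@intg_bounded _ _ _ _ 1); first exact: measurable_indic.
  by apply: aeW => x; rewrite indicE; case: (_ \in _); rewrite ?normr0 ?normr1.
Qed.

End product_approximate_identity.

(** * Powers of the cosine *)

Section cosine_powers.
Context (R : realType).
Implicit Types (w u : R) (M : nat).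

(* An antiderivative of cos (w u) ^+ M, by the usual reduction formula. *)
Fixpoint cos_int w M u : R :=
  match M with
  | 0 => u
  | 1 => w^-1 * sin (w * u)
  | M'.+2 => (w * M'.+2%:R)^-1 * (cos (w * u) ^+ M'.+1 * sin (w * u)) +
             M'.+1%:R / M'.+2%:R * cos_int w M' u
  end.

Lemma is_derive_scale w u : is_derive u 1 (fun v => w * v) w.
Proof.
have -> : (fun v => w * v) = (w *: (id : R -> R)) by [].
by apply: is_derive_eq; rewrite /GRing.scale /= mulr1.
Qed.

Lemma is_derive_cosZ w u : is_derive u 1 (fun v => cos (w * v)) (- (w * sin (w * u))).
Proof.
have H := is_derive_scale w u.
have := @is_derive1_comp _ cos (fun v => w * v) u _ _ (is_derive_cos _) H.
by rewrite mulNr mulrC.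
Qed.

Lemma is_derive_sinZ w u : is_derive u 1 (fun v => sin (w * v)) (w * cos (w * u)).
Proof.
have H := is_derive_scale w u.
have := @is_derive1_comp _ sin (fun v => w * v) u _ _ (is_derive_sin _) H.
by rewrite mulrC.
Qed.

Lemma cos_int_ind (P : nat -> Prop) : P 0%N -> P 1%N ->
  (forall M, P M -> P M.+2) -> forall M, P M.
Proof.
move=> P0 P1 PS M; suff: P M /\ P M.+1 by case.
by elim: M => [|M [IH1 IH2]]; split => //; exact: PS.
Qed.

Lemma is_derive_cos_int w M u : w != 0 ->
  is_derive u 1 (cos_int w M) (cos (w * u) ^+ M).
Proof.
move=> w0; elim/cos_int_ind: M => [||M IH].
- by rewrite expr0; exact: is_derive_id.
- have H := is_derive_sinZ w u.
  have -> : cos_int w 1 = w^-1 *: (fun v => sin (w * v)) by [].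
  by apply: is_derive_eq; rewrite /GRing.scale /= mulKf.
have Hs := is_derive_sinZ w u; have Hc := is_derive_cosZ w u.
have -> : cos_int w M.+2 =
   (w * M.+2%:R)^-1 *: ((fun v => cos (w * v)) ^+ M.+1 * (fun v => sin (w * v)))
   + (M.+1%:R / M.+2%:R) *: cos_int w M.
  by apply/funext => v; rewrite /= !fctE.
have H := is_deriveD (is_deriveZ (w * M.+2%:R)^-1 (is_deriveM (is_deriveX M.+1 Hc) Hs))
  (is_deriveZ (M.+1%:R / M.+2%:R) IH).
apply: is_derive_eq H _; rewrite /GRing.scale /=.
have M2 : (M%:R + 2 : R) != 0 by rewrite -natrD addn2 pnatr_eq0.
have cs := cos2Dsin2 (w * u).
set c := cos _ in cs *; set s := sin _ in cs *.
rewrite fctE -/c -[M.+2]addn2 -[M.+1]addn1 !natrD /=.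
have s2 : s ^+ 2 = 1 - c ^+ 2 by rewrite -cs; ring.
(* Inside the bracket, [c ^+ 2 - (M + 1) * s ^+ 2] comes from differentiating the product and the
   last [M + 1] from the recursive term; [s ^+ 2 = 1 - c ^+ 2] turns their sum into
   [(M + 2) * c ^+ 2]. *)
transitivity ((M%:R + 2)^-1 * c ^+ M *
    (c ^+ 2 - (M%:R + 1) * s ^+ 2 + (M%:R + 1))).
  by rewrite exprD expr1; field; rewrite w0 M2.
by rewrite s2 exprD; field.
Qed.

Section normalised.
Variable w : R.
Hypothesis w0 : 0 < w.
Let wn0 : w != 0. Proof. by rewrite gt_eqF. Qed.

(** The first positive zero of [cos (w * u)]. It equals [2^-1] for the torus frequency [pi] and [T]
    for the time frequency [pi / (2 * T)]. *)
Definition quarter : R := pi / 2 / w.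
Local Notation h := quarter.

Lemma quarter_gt0 : 0 < h. Proof. by rewrite !divr_gt0// pi_gt0. Qed.

Let wh : w * h = pi / 2. Proof. by rewrite /h mulrC divfK. Qed.

Lemma cos_int_continuous M : continuous (cos_int w M).
Proof.
move=> u; apply: differentiable_continuous; apply/derivable1_diffP.
by have := is_derive_cos_int M u wn0; case.
Qed.

Lemma cos_gt0_quarter u : 0 <= u < h -> 0 < cos (w * u).
Proof.
move=> /andP[u0 uh]; apply: cos_gt0_pihalf; rewrite -wh ltr_pM2l// uh andbT.
rewrite (@lt_le_trans _ _ 0)// ?mulr_ge0// ?ltW// oppr_lt0 mulr_gt0//.
exact: quarter_gt0.
Qed.

Lemma cos_ge0_quarter u : `|u| <= h -> 0 <= cos (w * u).
Proof.
rewrite ler_norml => /andP[u0 uh]; apply: cos_ge0_pihalf; rewrite -wh.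
by rewrite -mulrN !ler_pM2l// u0.
Qed.

Lemma quarter_in_pi u : 0 <= u -> u <= h -> w * u \in `[0, pi].
Proof.
move=> u0 uh; rewrite in_itv /= mulr_ge0//; last exact: ltW.
rewrite (@le_trans _ _ (w * h))// ?ler_pM2l// wh.
by have := pi_gt0 R; lra.
Qed.

Lemma cos_int0 M : cos_int w M 0 = 0.
Proof.
by elim/cos_int_ind: M => [||M /= ->] //=; rewrite ?mulr0 sin0 ?mulr0 ?addr0.
Qed.

Lemma cos_intN M u : cos_int w M (- u) = - cos_int w M u.
Proof.
elim/cos_int_ind: M => [||M /= ->] //=; first by rewrite mulrN sinN mulrN.
by rewrite mulrN sinN cosN; ring.
Qed.

Lemma cos_int_MVT M a b : a <= b -> exists2 c, c \in `[a, b]%R &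
  cos_int w M b - cos_int w M a = cos (w * c) ^+ M * (b - a).
Proof.
move=> ab; apply: (@MVT_segment _ (cos_int w M) (fun c => cos (w * c) ^+ M)) => //.
  by move=> x _; exact: is_derive_cos_int.
by apply: continuous_subspaceT; exact: cos_int_continuous.
Qed.

Lemma cos_int_quarter_gt0 M : 0 < cos_int w M h.
Proof.
have [||c cI] := @MVT _ (cos_int w M) (fun c => cos (w * c) ^+ M) 0 h quarter_gt0.
- by move=> x _; exact: is_derive_cos_int.
- by apply: continuous_subspaceT; exact: cos_int_continuous.
rewrite cos_int0 !subr0 => ->; rewrite mulr_gt0 ?quarter_gt0// exprn_gt0//.
by apply: cos_gt0_quarter; move: cI; rewrite in_itv /= => /andP[/ltW -> ->].
Qed.

(** Normalised to have integral 1 over [[- h, h]]; the antiderivative [ckernel_int] is odd and rises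
    from [- 2^-1] to [2^-1] on that interval. *)
Definition ckernel M u : R := cos (w * u) ^+ M / (2 * cos_int w M h).
Definition ckernel_int M u : R := cos_int w M u / (2 * cos_int w M h).
Local Notation F := ckernel_int.

Let Zgt0 M : 0 < 2 * cos_int w M h.
Proof. by rewrite mulr_gt0// cos_int_quarter_gt0. Qed.

Lemma is_derive_ckernel_int M u : is_derive u 1 (F M) (ckernel M u).
Proof.
have H := is_derive_cos_int M u wn0.
have -> : F M = (2 * cos_int w M h)^-1 *: cos_int w M.
  by apply/funext => v; rewrite /F !fctE mulrC.
by apply: is_derive_eq; rewrite /GRing.scale /= mulrC.
Qed.

Lemma ckernel_intN M u : F M (- u) = - F M u.
Proof. by rewrite /F cos_intN mulNr. Qed.

Lemma ckernelN M u : ckernel M (- u) = ckernel M u.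
Proof. by rewrite /ckernel mulrN cosN. Qed.

Lemma ckernel_int0 M : F M 0 = 0.
Proof. by rewrite /F cos_int0 mul0r. Qed.

Lemma ckernel_int_quarter M : F M h = 2^-1.
Proof.
have := cos_int_quarter_gt0 M => /gt_eqF /negbT; rewrite /F.
by set z := cos_int _ _ _ => z0; field.
Qed.

Lemma ckernel_ge0 M u : `|u| <= h -> 0 <= ckernel M u.
Proof.
move=> uh; rewrite divr_ge0//; last exact: ltW.
by rewrite exprn_ge0// cos_ge0_quarter.
Qed.

Lemma ckernel_ge0_even M u : ~~ odd M -> 0 <= ckernel M u.
Proof.
by move=> oM; rewrite divr_ge0 ?exprn_even_ge0//; exact: ltW.
Qed.

Lemma ckernel_int_mono M a b : 0 <= a -> a <= b -> b <= h -> F M a <= F M b.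
Proof.
move=> a0 ab bh; rewrite ler_pM2r ?invr_gt0// -subr_ge0.
have [c + ->] := cos_int_MVT M ab; rewrite in_itv /= => /andP[ac cb].
rewrite mulr_ge0 ?subr_ge0// exprn_ge0// cos_ge0_quarter//.
by rewrite ger0_norm ?(le_trans cb)// (le_trans a0).
Qed.

Lemma ckernel_refl M u : ckernel M (2 * h - u) = (-1) ^+ M * ckernel M u.
Proof.
rewrite /ckernel; have -> : w * (2 * h - u) = - (w * u) + pi.
  by rewrite mulrBr mulrCA wh; field.
by rewrite cosDpi cosN -mulN1r exprMn mulrA.
Qed.

(** By [ckernel_refl], the function [D] below has zero derivative, so it keeps its value at the
    fixed point [h] of the reflection. *)
Lemma ckernel_int_refl M u :
  F M (2 * h - u) = if odd M then F M u else 1 - F M u.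
Proof.
pose D v := F M (2 * h - v) + (-1) ^+ M * F M v.
have dD (v : R) : is_derive v 1 D 0.
  have H1 : is_derive v 1 (fun v : R => 2 * h - v) (-1).
    have -> : (fun v : R => 2 * h - v) = cst (2 * h) - (id : R -> R) by [].
    by apply: is_derive_eq; rewrite sub0r.
  have H2 := @is_derive1_comp _ (F M) _ v _ _
    (is_derive_ckernel_int M (2 * h - v)) H1.
  have H3 := is_derive_ckernel_int M v.
  have -> : D = ((F M \o (fun v : R => 2 * h - v)) : R -> R) + (-1) ^+ M *: F M by [].
  have H := is_deriveD H2 (is_deriveZ ((-1) ^+ M) H3).
  by apply: is_derive_eq H _; rewrite /GRing.scale /= ckernel_refl; ring.
have := @is_derive_0_is_cst _ D u h dD; rewrite /D.
have -> : 2 * h - h = h by ring.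
rewrite ckernel_int_quarter -signr_odd; case: (odd M) => /=.
  by rewrite expr1 !mulN1r subrr => /eqP; rewrite subr_eq0 => /eqP.
by rewrite expr0 !mul1r; lra.
Qed.

Lemma ckernel_int_bound M u : 0 <= u -> u <= 2 * h ->
  0 <= F M u <= 1.
Proof.
move=> u0 uh.
have H v : 0 <= v -> v <= h -> 0 <= F M v <= 2^-1.
  move=> v0 vh; rewrite -(ckernel_int0 M) -(ckernel_int_quarter M).
  by rewrite !ckernel_int_mono.
have [uq|uq] := leP u h.
  by have /andP[-> /le_trans ->] := H _ u0 uq => //=; lra.
have /andP[] : 0 <= F M (2 * h - u) <= 2^-1 by apply: H; lra.
by rewrite ckernel_int_refl; case: ifP => _; lra.
Qed.

(** Concentration at 0, from comparing the heights at [u] and [u / 2]. Since the kernel decreases on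
    [[0, h]], the mass beyond [u] is at most [h * ckernel M u], while [ckernel M (u / 2)] is at most
    [1 / u] because half of the mass lies on that side. The ratio of the two heights is [r ^+ M]
    with [r < 1], and the normalising constant cancels in it. *)
Let cvg_small u : 0 < u -> u <= h -> F M u @[M --> \oo] --> (2^-1 : R).
Proof.
move=> u0 uh; pose r := cos (w * u) / cos (w * (u / 2)).
have u2 : 0 < cos (w * (u / 2)) by apply: cos_gt0_quarter; lra.
have r0 : 0 <= r.
  by apply: divr_ge0; [rewrite cos_ge0_quarter// gtr0_norm|exact: ltW].
have r1 : r < 1.
  rewrite ltr_pdivrMr// mul1r ltr_cos.
  - by rewrite ltr_pM2l//; lra.
  - by apply: quarter_in_pi; lra.
  - by apply: quarter_in_pi; lra.
have B M : 2^-1 - F M u <= h / u * r ^+ M /\ 0 <= 2^-1 - F M u.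
  split; last first.
    by rewrite subr_ge0 -(ckernel_int_quarter M) ckernel_int_mono// ltW.
  have [c cI E] := cos_int_MVT M uh.
  have [e eI E'] := @cos_int_MVT M 0 (u / 2) ltac:(lra).
  have step1 : 2^-1 - F M u <= h * ckernel M u.
    rewrite -(ckernel_int_quarter M) /F /ckernel -mulrBl E mulrA.
    rewrite ler_pM2r ?invr_gt0// mulrC.
    move: cI; rewrite in_itv /= => /andP[uc ch].
    apply: ler_pM; [by rewrite subr_ge0|rewrite exprn_ge0//|by rewrite gerBl ltW|].
      by apply: cos_ge0_quarter; rewrite ger0_norm// (le_trans _ uc)// ltW.
    apply: lerXn2r; rewrite ?nnegrE.
    - by apply: cos_ge0_quarter; rewrite ger0_norm// (le_trans _ uc)// ltW.
    - by apply: cos_ge0_quarter; rewrite gtr0_norm.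
    rewrite leNgt ltr_cos -?leNgt.
    - by rewrite ler_pM2l.
    - by apply: quarter_in_pi; lra.
    - by apply: quarter_in_pi; lra.
  have step2 : ckernel M (u / 2) * (u / 2) <= 2^-1.
    apply: (@le_trans _ _ (F M (u / 2))); last first.
      by rewrite -[leRHS](ckernel_int_quarter M) ckernel_int_mono//; lra.
    move: E'; rewrite cos_int0 !subr0 /F /ckernel => ->.
    rewrite mulrAC ler_pM2r ?invr_gt0// ler_pM2r; last by lra.
    move: eI; rewrite in_itv /= => /andP[e0 eu].
    apply: lerXn2r; rewrite ?nnegrE ?(ltW u2)//.
      by apply: cos_ge0_quarter; rewrite ger0_norm//; lra.
    rewrite leNgt ltr_cos -?leNgt.
    - by rewrite ler_pM2l.
    - by apply: quarter_in_pi; lra.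
    - by apply: quarter_in_pi; lra.
  apply: (le_trans step1); rewrite -mulrA ler_pM2l ?quarter_gt0//.
  have -> : ckernel M u = ckernel M (u / 2) * r ^+ M.
    by rewrite /ckernel /r expr_div_n; field; rewrite !gt_eqF ?exprn_gt0 ?cos_int_quarter_gt0.
  rewrite ler_wpM2r ?exprn_ge0//.
  by rewrite -ler_pdivlMr// in step2; [rewrite (le_trans step2)// -invfM mulrC divfK//; lra|lra].
apply/cvgrPdist_le => e e0.
have /cvgrPdist_le /(_ e e0) : h / u * r ^+ M @[M --> \oo] --> 0.
  rewrite -(mulr0 (h / u)); apply: cvgMr.
  by apply: cvg_expr; rewrite ger0_norm.
apply: filterS => M /=; have [B1 B2] := B M.
rewrite sub0r normrN (ger0_norm B2) => H; apply: (le_trans B1).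
by apply: le_trans H; exact: ler_norm.
Qed.

Lemma ckernel_int_cvg u : 0 < u -> u < 2 * h -> F M u @[M --> \oo] --> (2^-1 : R).
Proof.
move=> u0 uh; have [uq|uq] := leP u h; first exact: cvg_small.
have /cvgrPdist_le H : F M (2 * h - u) @[M --> \oo] --> (2^-1 : R).
  by apply: cvg_small; lra.
apply/cvgrPdist_le => e /H; apply: filterS => M /=.
rewrite ckernel_int_refl; case: ifP => // _.
by rewrite -normrN; congr (`|_| <= _); lra.
Qed.

End normalised.

End cosine_powers.

(** * Reflected cosine kernels on an interval *)

Section time_integration.
Context (R : realType).
Implicit Types (T a b : R) (f F : R -> R).

Lemma time_measureE T A :
  time_measure T A = lebesgue_measure (A `&` `]0, T[%classic).
Proof. by []. Qed.

Lemma ae_time T : {ae time_measure T, forall t, 0 < t < T}.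
Proof.
exists (~` `]0, T[%classic); split.
- by apply: measurableC; exact: measurable_time.
- by rewrite time_measureE setICl measure0.
- by move=> t /= tT; rewrite in_itv.
Qed.

Lemma ae_time_neq T a : {ae time_measure T, forall t, t != a}.
Proof.
exists [set a]; split; first exact: measurable_set1.
- apply/eqP; rewrite eq_le measure_ge0 andbT.
  rewrite -(lebesgue_measure_set1 a) time_measureE.
  by apply: le_measure; rewrite ?inE//; apply: measurableI => //; exact: measurable_time.
- by move=> t /= /negP; rewrite negbK => /eqP.
Qed.

Lemma Rint_time T f :
  \int[time_measure T]_t f t = \int[lebesgue_measure]_(t in `]0, T[) f t.
Proof.
transitivity (\int[time_measure T]_t ((f \_ `]0, T[%classic) t)).
  apply: Rint_ae_eq; apply: (ae_imp (ae_time T)) => t tT.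
  by rewrite patchE mem_set//= in_itv.
rewrite -Rintegral_mkcond /Rintegral; congr fine.
apply: eq_measure_integral => A mA AT.
by rewrite -[in RHS](setIidl AT).
Qed.

Lemma Rint_time_itv T f F a b : continuous f ->
  (forall t : R, is_derive t 1 F (f t)) -> 0 <= a -> a <= b -> b <= T ->
  \int[time_measure T]_t (f t * \1_(`]a, b[%classic) t) = F b - F a.
Proof.
move=> cf dF a0 ab bT; rewrite Rint_time.
have -> : \int[lebesgue_measure]_(t in `]0, T[) (f t * \1_(`]a, b[%classic) t) =
    \int[lebesgue_measure]_(t in `]a, b[) f t.
  rewrite Rintegral_mkcond [RHS]Rintegral_mkcond; apply: eq_Rintegral => t _.
  rewrite !patchE indicE; case: ifPn => tT; case: ifPn => tab;
    rewrite ?(mulr1, mulr0)//.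
  move: tab; rewrite inE /= in_itv /= => /andP[at_ tb].
  move: tT; rewrite notin_setE /= in_itv /= => /negP; rewrite negb_and.
  by rewrite (le_lt_trans a0 at_) (lt_le_trans tb bT).
move: ab; rewrite le_eqVlt => /predU1P[->|ab].
  by rewrite set_itvoo0// Rintegral_set0 subrr.
have cF : continuous F.
  move=> u; apply: differentiable_continuous; apply/derivable1_diffP.
  by case: (dF u).
have Iab : lebesgue_measure.-integrable `[a, b] (EFin \o f).
  by apply: continuous_compact_integrable; [exact: segment_compact|exact: continuous_subspaceT].
rewrite Rintegral_itv_obnd_cbnd; last first.
  by apply: integrableS Iab => //; apply: subset_itv; rewrite bnd_simp.
rewrite Rintegral_itv_bndo_bndc; last first.
  by apply: integrableS Iab => //; apply: subset_itv; rewrite bnd_simp.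
rewrite /Rintegral (@continuous_FTC2 _ f F)//.
- exact: continuous_subspaceT.
- split.
  + by move=> x _; case: (dF x).
  + by apply: cvg_at_right_filter; exact: cF.
  + by apply: cvg_at_left_filter; exact: cF.
- by move=> x _; rewrite derive1E; case: (dF x).
Qed.

(** The whole line is included so that products of such classes contain the cylinders and Dynkin's
    argument can take complements. *)
Definition rays : set (set (measurableTypeR R)) :=
  [set A | A = setT \/ exists b, A = `]-oo, b[%classic].

Lemma rays_setI : setI_closed rays.
Proof.
move=> A B [->|[a ->]] [->|[b ->]]; rewrite ?setTI ?setIT; [by left|right..].
- by exists b.
- by exists a.
exists (Num.min a b); apply/seteqP; split => x /=; rewrite !in_itv /=.
  by move=> [xa xb]; rewrite lt_min xa.
by rewrite lt_min => /andP.
Qed.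

Lemma rays_generate : @measurable _ (measurableTypeR R) = <<s rays >>.
Proof.
apply/seteqP; split; last first.
  apply: smallest_sub; first exact: sigma_algebra_measurable.
  by move=> _ [->|[b ->]]; [exact: measurableT|exact: measurable_itv].
rewrite (RGenInftyO.measurableE R); apply: smallest_sub.
  exact: smallest_sigma_algebra.
by move=> _ [b ->]; apply: sub_gen_smallest; right; exists b.
Qed.

Lemma rays_measurable : rays `<=` measurable.
Proof. by move=> A GA; rewrite rays_generate; exact: sub_gen_smallest. Qed.

(** Up to null sets of the time measure, a ray is an initial interval, over which the fundamental
    theorem of calculus evaluates the averages. *)
Lemma rays_trunc T A : 0 < T -> rays A -> exists b,
  [/\ 0 <= b, b <= T & {ae time_measure T, forall t,
      \1_A t = \1_(`]0, b[%classic) t :> R}].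
Proof.
move=> T0 [->|[b ->]].
  exists T; split; [exact: ltW|by []|].
  apply: (ae_imp (ae_time T)) => t tT.
  by rewrite !indicE !mem_set//= in_itv.
exists (Num.max 0 (Num.min b T)); split.
- by rewrite le_max lexx.
- by rewrite ge_max (ltW T0)/= ge_min lexx orbT.
apply: (ae_imp (ae_time T)) => t /andP[t0 tT]; rewrite !indicE; congr (_%:R).
congr (nat_of_bool _); apply/idP/idP; rewrite !inE /= !in_itv /=.
  by move=> tb; rewrite t0/= lt_max lt_min tb tT orbT.
by rewrite t0 /= lt_max lt_min ltNge (ltW t0)/= => /andP[].
Qed.

(* The kernel of the even (sgn = 1) or odd (sgn = -1) extension in t to the
   whole line; for w = pi / (2 T) and M odd, ckernel w M changes sign under
   u |-> 2 T - u, so that the even kernel vanishes at t = T. *)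
Definition ekernel (w sgn : R) (M : nat) (t s : R) : R :=
  ckernel w M (t - s) + sgn * ckernel w M (t + s).

Section ekernel.
Variables (T w sgn : R) (Ms : nat -> nat).
Hypotheses (T0 : 0 < T) (w0 : 0 < w) (sgn1 : `|sgn| <= 1).
Hypothesis Ms_ge : forall N, (N <= Ms N)%N.
Local Notation h := (quarter w).
Local Notation F := (ckernel_int w).
(** Both situations in use. The torus kernel has no reflected term and even powers, hence is
    nonnegative on the whole line, with period [2 * h = 1 = T]. The time kernel has odd powers, with
    [T] the first zero of the cosine. *)
Hypothesis cases :
  (sgn = 0 /\ (forall N, ~~ odd (Ms N)) /\ T <= 2 * h) \/
  (T = h /\ forall N, odd (Ms N)).

Lemma ckernel_continuous M : continuous (ckernel w M).
Proof.
move=> u; rewrite /ckernel; apply: cvgMl.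
apply: (@cvg_comp _ _ _ (fun v => cos (w * v)) (fun x => x ^+ M)); last first.
  exact: exprn_continuous.
apply: (@cvg_comp _ _ _ (fun v => w * v) cos); last exact: continuous_cos.
by apply: cvgMr; exact: cvg_id.
Qed.

Lemma ekernel_continuous M s : continuous (ekernel w sgn M ^~ s).
Proof.
move=> t; apply: cvgD.
  apply: (@cvg_comp _ _ _ (fun v => v - s) (ckernel w M)); last exact: ckernel_continuous.
  by apply: cvgB; [exact: cvg_id|exact: cvg_cst].
apply: cvgMr; apply: (@cvg_comp _ _ _ (fun v => v + s) (ckernel w M)).
  by apply: cvgD; [exact: cvg_id|exact: cvg_cst].
exact: ckernel_continuous.
Qed.

Lemma is_derive_shift (f df : R -> R) s (t : R) :
  (forall t : R, is_derive t 1 f (df t)) ->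
  is_derive t 1 (fun t => f (t + s)) (df (t + s)).
Proof.
move=> H.
have H1 : is_derive t 1 (fun v : R => v + s) 1.
  have -> : (fun v : R => v + s) = (id : R -> R) + cst s by [].
  by apply: is_derive_eq; rewrite addr0.
have := @is_derive1_comp _ f _ t _ _ (H (t + s)) H1.
by rewrite mulr1.
Qed.

Lemma is_derive_ekernel_int M s (t : R) :
  is_derive t 1 (fun t => F M (t - s) + sgn * F M (t + s)) (ekernel w sgn M t s).
Proof.
have H1 := is_derive_shift (- s) t (is_derive_ckernel_int w0 M).
have H2 := is_derive_shift s t (is_derive_ckernel_int w0 M).
have -> : (fun t => F M (t - s) + sgn * F M (t + s)) =
  (fun t => F M (t - s)) + sgn *: (fun t => F M (t + s)) by [].
exact: is_deriveD H1 (is_deriveZ sgn H2).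
Qed.

Lemma ekernel_sym M t s : ekernel w sgn M t s = ekernel w sgn M s t.
Proof. by rewrite /ekernel -ckernelN opprB (addrC t s). Qed.

Lemma ckernel_bound M : exists C, forall u, `|ckernel w M u| <= C.
Proof.
exists (`|(2 * cos_int w M h)^-1|) => u; rewrite /ckernel normrM ler_piMl//.
by rewrite normrX exprn_ile1// cos_max.
Qed.

Lemma ekernel_bounded M : bounded_kernel (ekernel w sgn M).
Proof.
have [C HC] := ckernel_bound M; exists (C + C) => t s.
apply: (le_trans (ler_normD _ _)); rewrite lerD// (normrM sgn).
by apply: le_trans (HC (t + s)); rewrite ler_piMl.
Qed.

Lemma ekernel_measurable M : measurable_kernel (ekernel w sgn M : measurableTypeR R -> measurableTypeR R -> R).
Proof.
have mK := continuous_measurable_fun (@ckernel_continuous M).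
have m1 : measurable_fun setT (@fst (measurableTypeR R) (measurableTypeR R)).
  exact: measurable_fst.
have m2 : measurable_fun setT (@snd (measurableTypeR R) (measurableTypeR R)).
  exact: measurable_snd.
apply: measurable_funD.
  apply: (measurableT_comp mK); exact: measurable_funB.
apply: measurable_funM => //.
apply: (measurableT_comp mK); exact: measurable_funD.
Qed.

Let integral_itv M s b : 0 <= b -> b <= T ->
  \int[time_measure T]_t (ekernel w sgn M t s * \1_(`]0, b[%classic) t) =
  F M (b - s) + F M s + sgn * (F M (b + s) - F M s).
Proof.
move=> b0 bT.
have dK := fun t : R => is_derive_ekernel_int M s t.
rewrite (Rint_time_itv (@ekernel_continuous M s) dK (lexx 0) b0 bT).
by rewrite !add0r ckernel_intN; ring.
Qed.

Lemma ckernel_le0 M u : odd M -> h <= u -> u <= 3 * h -> ckernel w M u <= 0.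
Proof.
move=> oM hu uh; have := ckernel_refl w0 M u.
rewrite -signr_odd oM expr1 mulN1r => /eqP; rewrite -subr_eq0 opprK addrC => /eqP.
move/eqP; rewrite addr_eq0 => /eqP ->; rewrite oppr_le0.
by apply: ckernel_ge0 => //; rewrite ler_norml; lra.
Qed.

(** The constant is 2 for each of the two terms of the kernel. The direct term integrates to
    [F (T - s) + F s]. With an odd power the reflected term is nonnegative up to [t = T - s] and
    nonpositive after it, so its absolute value integrates to [2 * F T - F s - F (T + s)]. All
    values of [F] involved lie between 0 and 1. *)
Let schur N : {ae time_measure T, forall s,
    \int[time_measure T]_t `|ekernel w sgn (Ms N) t s| <= 4}.
Proof.
apply: (ae_imp (ae_time T)) => s /andP[s0 sT].
have h0 := quarter_gt0 w0.
have T2h : T <= 2 * h by case: cases => [[_ []]//|[-> _]]; lra.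
set M := Ms N.
have cK (c : R) : continuous (fun t => ckernel w M (t + c)).
  move=> t; apply: (@cvg_comp _ _ _ (fun v => v + c) (ckernel w M)).
    by apply: cvgD; [exact: cvg_id|exact: cvg_cst].
  exact: ckernel_continuous.
have dK (c : R) (t : R) : is_derive t 1 (fun t => F M (t + c)) (ckernel w M (t + c)).
  exact: is_derive_shift (is_derive_ckernel_int w0 M).
have [C HC] := ckernel_bound M.
have IK (c : R) (A : set (measurableTypeR R)) : measurable A ->
    intg (time_measure T) (fun t => ckernel w M (t + c) * \1_A t).
  move=> mA; apply: (@intg_bounded _ _ _ _ C).
    by apply: measurable_funM; [exact: continuous_measurable_fun|exact: measurable_indic].
  apply: aeW => t; rewrite normrM indicE.
  by case: (_ \in _); rewrite ?normr1 ?normr0 ?mulr1 ?mulr0// (le_trans _ (HC 0)).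
(* The absolute value of the reflected term is written with indicators on the two sides of its sign
   change [t = T - s]; the point itself is discarded as a null set. *)
have main : {ae time_measure T, forall t, `|ekernel w sgn M t s| <=
    ckernel w M (t + - s) * \1_(`]0, T[%classic) t +
    `|sgn| * (ckernel w M (t + s) * \1_(`]0, T - s[%classic) t -
     ckernel w M (t + s) * \1_(`]T - s, T[%classic) t)}.
  apply: (ae_imp2 (ae_time T) (ae_time_neq T (T - s))) => t /andP[t0 tT] ts.
  apply: (le_trans (ler_normD _ _)); rewrite (normrM sgn); apply: lerD.
    rewrite indicE mem_set ?mulr1/= ?in_itv/= ?t0//.
    rewrite (@ger0_norm _ (ckernel w M (t - s)))//.
    case: cases => [[_ [oM _]]|[Th oM]].
      by apply: ckernel_ge0_even => //; exact: oM.
    by apply: ckernel_ge0 => //; rewrite ler_norml; lra.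
  case: cases => [[-> _]|[Th oM]]; first by rewrite normr0 !mul0r.
  rewrite ler_wpM2l// !indicE.
  have [tl|tr] := ltP t (T - s).
    rewrite mem_set/= ?in_itv/= ?t0// memNset/= ?in_itv/=; last first.
      by move=> /andP[]; rewrite ltNge (ltW tl).
    rewrite mulr1 mulr0 subr0 (@ger0_norm _ (ckernel w M (t + s)))//.
    by apply: ckernel_ge0 => //; rewrite ler_norml; lra.
  have {}tr : T - s < t by rewrite lt_neqAle eq_sym ts.
  rewrite memNset/= ?in_itv/= ?t0//=; last first.
    by move=> /= tl; rewrite ltNge (ltW tr) in tl.
  rewrite mem_set/= ?in_itv/= ?tr ?tT// mulr1 mulr0 sub0r.
  rewrite (@ler0_norm _ (ckernel w M (t + s)))//.
  by apply: ckernel_le0; [exact: oM|lra|lra].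
have Ir : intg (time_measure T) (fun t => ckernel w M (t + - s) * \1_(`]0, T[%classic) t +
    `|sgn| * (ckernel w M (t + s) * \1_(`]0, T - s[%classic) t -
     ckernel w M (t + s) * \1_(`]T - s, T[%classic) t)).
  by apply: intgD; [exact: IK|apply: intgZ; apply: intgB; exact: IK].
have Il : intg (time_measure T) (fun t => `|ekernel w sgn M t s|).
  have [D HD] := ekernel_bounded M.
  apply/intg_abs/(@intg_bounded _ _ _ _ D); last exact: aeW.
  exact: kernel_section2 (ekernel_measurable M).
apply: (le_trans (Rint_le_ae Il Ir main)).
rewrite RintegralD//; [|exact: IK|by apply: intgZ; apply: intgB; exact: IK].
rewrite RintegralZl//; last by apply: intgB; exact: IK.
rewrite RintegralB//; [|exact: IK|exact: IK].
have [Ts1 Ts2] : 0 <= T - s /\ T - s <= T by split; lra.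
rewrite (Rint_time_itv (cK (- s)) (dK (- s)) (lexx 0) (ltW T0) (lexx T)).
rewrite (Rint_time_itv (cK s) (dK s) (lexx 0) Ts1 Ts2).
rewrite (Rint_time_itv (cK s) (dK s) Ts1 Ts2 (lexx T)).
rewrite !add0r ckernel_intN subrK.
have /andP[a1 b1] : 0 <= F M (T - s) <= 1 by apply: ckernel_int_bound => //; lra.
have /andP[a2 b2] : 0 <= F M s <= 1 by apply: ckernel_int_bound => //; lra.
case: cases => [[-> _]|[Th oM]].
  by rewrite normr0 mul0r; lra.
have /andP[a3 b3] : 0 <= F M T <= 1 by apply: ckernel_int_bound => //; lra.
have /andP[a4 b4] : 0 <= F M (T + s) <= 1 by apply: ckernel_int_bound => //; lra.
have H : F M T - F M s - (F M (T + s) - F M T) <= 2 by lra.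
have : `|sgn| * (F M T - F M s - (F M (T + s) - F M T)) <= 2.
  have [H0|H0] := leP 0 (F M T - F M s - (F M (T + s) - F M T)).
    by apply: le_trans H; rewrite ler_piMl.
  apply: (@le_trans _ _ 0) => //.
  by rewrite mulr_ge0_le0// ltW.
lra.
Qed.

Let cvgF u : 0 < u -> u < 2 * h -> F (Ms N) u @[N --> \oo] --> (2^-1 : R).
Proof.
move=> u0 uh; have /cvgrPdist_le H := ckernel_int_cvg w0 u0 uh.
apply/cvgrPdist_le => e /H [n _ Hn]; exists n => // N /= nN.
by apply: Hn; exact: leq_trans nN (Ms_ge N).
Qed.

(** Symmetry of the kernel turns one Schur bound into the other. The average over []0, b[] is [F (b
    - s) + F s + sgn * (F (b + s) - F s)]. Here [F] tends to plus or minus [2^-1] according to the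
    sign of its argument, so the direct part tends to 1 or 0 as [s < b] or [s > b], and the
    reflected part vanishes in the limit. *)
Lemma approx_id_ekernel : approx_id (time_measure T) rays
  (fun N => ekernel w sgn (Ms N)) 4.
Proof.
split.
- by move=> N; exact: ekernel_measurable.
- by move=> N; exact: ekernel_bounded.
- move=> N; apply: (ae_imp (schur N)) => s.
  by under eq_Rintegral do rewrite ekernel_sym.
- exact: schur.
move=> A /(rays_trunc T0)[b [b0 bT bA]].
apply: (ae_imp3 bA (ae_time T) (ae_time_neq T b)) => s bAs /andP[s0 sT] sb.
have T2h : T <= 2 * h.
  by have := quarter_gt0 w0; case: cases => [[_ []]//|[-> _]]; lra.
rewrite bAs (_ : (fun N => _) = (fun N =>
    F (Ms N) (b - s) + F (Ms N) s + sgn * (F (Ms N) (b + s) - F (Ms N) s))).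
  have -> : (\1_(`]0, b[%classic) s : R) =
      (if s < b then 2^-1 else - 2^-1) + 2^-1 + sgn * 0.
    rewrite indicE; case: ltP => sb'.
      by rewrite mem_set/= ?in_itv/= ?s0// mulr0; lra.
    rewrite memNset/= ?in_itv/= ?mulr0; first by ring.
    by move=> /andP[_]; rewrite ltNge sb'.
  apply: cvgD.
    apply: cvgD; last by apply: cvgF; lra.
    case: ltP => sb'; first by apply: cvgF; lra.
    rewrite (_ : (fun N => _) = (fun N => - F (Ms N) (s - b))); last first.
      by apply/funext => N; rewrite -ckernel_intN opprB.
    apply: cvgN; apply: cvgF; last by lra.
    by rewrite subr_gt0 lt_neqAle eq_sym sb.
  case: cases => [[-> _]|[Th oM]].
    by rewrite mul0r; apply: cvg_near_cst; apply: nearW => N; rewrite mul0r.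
  apply: cvgMr; rewrite -(subrr (2^-1)); apply: cvgB; apply: cvgF; lra.
apply/funext => N; rewrite -(integral_itv _ _ b0 bT).
apply: Rint_ae_eq; apply: (ae_imp bA) => t -> //.
Qed.

End ekernel.

End time_integration.

(** * Transport along measurable bijections *)

Section transport.
Context d1 d2 (Z : measurableType d1) (X : measurableType d2) (R : realType).
Variables (mZ : {finite_measure set Z -> \bar R}).
Variables (m : {finite_measure set X -> \bar R}).
Variables (phi : Z -> X) (psi : X -> Z).
Hypotheses (mphi : measurable_fun setT phi) (mpsi : measurable_fun setT psi).
Hypotheses (phiK : cancel phi psi) (psiK : cancel psi phi).
Hypothesis mE : forall A, measurable A -> m A = mZ (phi @^-1` A).

Lemma ge0_integral_transport (f : X -> \bar R) : measurable_fun setT f ->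
  (forall x, 0 <= f x)%E -> (\int[m]_x f x = \int[mZ]_z f (phi z))%E.
Proof.
move=> mf f0.
transitivity (\int[pushforward mZ phi]_x f x)%E.
  by apply: eq_measure_integral => A mA _; exact: mE.
by rewrite ge0_integral_pushforward// preimage_setT.
Qed.

Lemma Rint_transport (f : X -> R) : measurable_fun setT f ->
  \int[m]_x f x = \int[mZ]_z f (phi z).
Proof.
move=> /measurable_EFinP mf; rewrite /Rintegral; congr fine.
rewrite integralE [RHS]integralE; congr (_ - _)%E.
  rewrite ge0_integral_transport//; last exact: measurable_funepos.
  by apply: eq_integral => z _; rewrite !funeposE.
rewrite ge0_integral_transport//; last exact: measurable_funeneg.
by apply: eq_integral => z _; rewrite !funenegE.
Qed.

Lemma ae_transport (P : Z -> Prop) : {ae mZ, forall z, P z} ->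
  {ae m, forall x, P (psi x)}.
Proof.
move=> [N [mN N0 PN]]; exists (psi @^-1` N); split.
- by rewrite -[_ @^-1` _]setTI; exact: mpsi.
- rewrite mE; last by rewrite -[_ @^-1` _]setTI; exact: mpsi.
  rewrite (_ : _ @^-1` _ = N)//; apply/seteqP.
  by split => z /=; rewrite phiK.
- by move=> x /= nP; apply: PN.
Qed.

Definition transport_sets (G : set (set Z)) : set (set X) :=
  [set psi @^-1` A | A in G].

Lemma transport_setI G : setI_closed G -> setI_closed (transport_sets G).
Proof.
by move=> GI _ _ [A GA <-] [B GB <-]; exists (A `&` B) => //; exact: GI.
Qed.

Lemma transport_setT G : G setT -> transport_sets G setT.
Proof. by move=> GT; exists setT. Qed.

Lemma transport_generate G : @measurable _ Z = <<s G >> ->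
  @measurable _ X = <<s transport_sets G >>.
Proof.
move=> GE.
have -> : transport_sets G = preimage_set_system setT psi G.
  by apply/seteqP; split => _ [A GA <-]; exists A; rewrite ?setTI.
rewrite g_sigma_preimageE.
have -> : (G.-sigma.-measurable : set (set Z)) = @measurable _ Z by rewrite GE.
apply/seteqP; split => A mA.
  exists (phi @^-1` A); first by rewrite -[_ @^-1` _]setTI; exact: mphi.
  by apply/seteqP; split => x /=; rewrite psiK; [case|].
by case: mA => B mB <-; exact: mpsi.
Qed.

Lemma approx_id_transport G K C : G `<=` measurable -> approx_id mZ G K C ->
  approx_id m (transport_sets G) (fun N x y => K N (psi x) (psi y)) C.
Proof.
move=> mG P.
have mK N : measurable_kernel (fun x y => K N (psi x) (psi y)).
  apply: (@measurableT_comp _ _ _ _ _ _ (fun z : Z * Z => K N z.1 z.2) _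
    (fun z : X * X => (psi z.1, psi z.2))); first exact: approx_id_meas P N.
  apply: measurable_fun_pair.
    exact: (measurableT_comp mpsi measurable_fst).
  exact: (measurableT_comp mpsi measurable_snd).
have bK N : bounded_kernel (fun x y => K N (psi x) (psi y)).
  by have [M HM] := approx_id_bnd P N; exists M.
split => //.
- move=> N; have [M HM] := bK N.
  apply: (ae_imp (ae_transport (approx_id_schur1 P N))) => x Hx.
  rewrite Rint_transport; first by under eq_Rintegral do rewrite phiK.
  by apply: measurableT_comp => //; exact: kernel_section1 (mK N).
- move=> N; have [M HM] := bK N.
  apply: (ae_imp (ae_transport (approx_id_schur2 P N))) => x Hx.
  rewrite Rint_transport; first by under eq_Rintegral do rewrite phiK.
  by apply: measurableT_comp => //; exact: kernel_section2 (mK N).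
move=> _ [A GA <-]; have mA := mG _ GA.
have mpA : measurable (psi @^-1` A).
  by rewrite -[_ @^-1` _]setTI; exact: mpsi.
apply: (ae_imp (ae_transport (approx_id_cvg P GA))) => x.
rewrite (_ : (fun N => \int[mZ]_z _) =
  (fun N => \int[m]_y (K N (psi y) (psi x) * \1_(psi @^-1` A) y)))//.
apply/funext => N; rewrite Rint_transport.
  apply: eq_Rintegral => z _; rewrite phiK; congr (_ * _).
  rewrite !indicE (_ : (phi z \in psi @^-1` A) = (z \in A))//.
  by apply/idP/idP => /set_mem H; apply/mem_set; move: H; rewrite /preimage /= phiK.
by apply: measurable_funM; [exact: kernel_section2 (mK N)|exact: measurable_indic].
Qed.

End transport.

(** * Kernels on the torus *)

Section torus.
Context (R : realType).
Implicit Types d : nat.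

(** The uniform law is carried by the closed unit interval and the time measure by the open one; the
    two endpoints are null. *)
Lemma uniform_time (A : set (measurableTypeR R)) : measurable A ->
  uniform_prob (@ltr01 R) A = time_measure 1 A.
Proof.
move=> mA; rewrite time_measureE /uniform_prob integral_uniform_pdf.
rewrite (eq_integral (fun=> 1%E)); last first.
  by move=> x; rewrite inE /= /uniform_pdf in_itv /= => -[_ ->]; rewrite subr0 invr1.
have m01 : measurable (`[0, 1]%classic : set (measurableTypeR R)) by exact: measurable_itv.
rewrite integral_cst//=; last exact: measurableI.
rewrite mul1e; apply/eqP; rewrite eq_le; apply/andP; split; last first.
  apply: le_measure; rewrite ?inE; [|exact: measurableI|].
    by apply: measurableI => //; exact: measurable_time.
  by apply: setIS => x /=; rewrite !in_itv /= => /andP[/ltW -> /ltW ->].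
have mB : measurable (A `&` `]0, 1[%classic).
  by apply: measurableI => //; exact: measurable_time.
have m2 : measurable ([set 0] `|` [set 1] : set (measurableTypeR R)) by exact: measurableU.
apply: (@le_trans _ _ (lebesgue_measure ((A `&` `]0, 1[) `|` ([set 0] `|` [set 1])))).
  apply: le_measure; rewrite ?inE; first exact: measurableI.
    exact: measurableU.
  move=> x [Ax] /=; rewrite !in_itv /= => /andP[].
  rewrite !le_eqVlt => /predU1P[<- _|x0 /predU1P[->|x1]]; [by right; left|by right; right|].
  by left; split => //; rewrite x0.
apply: (le_trans (measureU2 _ mB m2)).
rewrite -[leRHS]adde0 leeD2l//.
apply: (le_trans (measureU2 _ _ _)) => //.
by rewrite [X in (X + _)%E](lebesgue_measure_set1 0) [X in (_ + X)%E](lebesgue_measure_set1 1) adde0.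
Qed.

Definition uniform_measure : {finite_measure set (measurableTypeR R) -> \bar R} :=
  uniform_prob (@ltr01 R).

Lemma approx_id_eq_measure dX (X : measurableType dX)
    (m m' : {finite_measure set X -> \bar R}) G K C :
  (forall A, measurable A -> m' A = m A) -> G `<=` measurable ->
  approx_id m G K C -> approx_id m' G K C.
Proof.
move=> mm mG P.
have := @approx_id_transport _ _ X X R m m' id id (@measurable_id _ X setT)
  (@measurable_id _ X setT) (fun x => erefl) mm G K C mG P.
by congr approx_id; apply/seteqP; split => A; [move=> [B GB <-]|exists A].
Qed.

(** With [sgn = 0] only the difference of the arguments matters, and the even power makes the kernel
    1-periodic although [cos (pi * u)] is only antiperiodic. *)
Definition circle_kernel N : R -> R -> R := ekernel pi 0 N.*2.

Lemma approx_id_circle : approx_id uniform_measure (@rays R) circle_kernel 4.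
Proof.
apply: (approx_id_eq_measure uniform_time (@rays_measurable R)).
apply: approx_id_ekernel; rewrite ?normr0 ?pi_gt0//.
  by move=> N; rewrite -addnn leq_addr.
left; split => //; split; first by move=> N; rewrite odd_double.
have pi0 := pi_gt0 R.
have H (p : R) : 0 < p -> 2 * (p / 2 / p) = 1 by move=> p0; field; rewrite gt_eqF.
rewrite /quarter H//.
Qed.

Definition torus_kernel d N (x y : tpoint R d) : R :=
  \prod_(i < d) circle_kernel N (tnth x i) (tnth y i).

Definition torus_finite d : {finite_measure set (tpoint R d) -> \bar R} :=
  torus_measure R d.

Definition uncons_point d (x : tpoint R d.+1) : spacetime R d :=
  (thead x, [tuple of behead x]).

Lemma cons_pointK d : cancel (@cons_point R d) (@uncons_point d).
Proof. by move=> [t x]; rewrite /uncons_point /cons_point /= theadE; congr (_, _); exact: val_inj. Qed.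

Lemma uncons_pointK d : cancel (@uncons_point d) (@cons_point R d).
Proof. by move=> x; rewrite /cons_point /= [RHS]tuple_eta. Qed.

Lemma measurable_uncons_point d : measurable_fun setT (@uncons_point d).
Proof.
apply: measurable_fun_pair; first exact: measurable_tnth.
exact: measurable_behead.
Qed.

Lemma torus_measureS d (A : set (tpoint R d.+1)) : measurable A ->
  torus_finite d.+1 A =
  finite_product_measure uniform_measure (torus_finite d) (@cons_point R d @^-1` A).
Proof. by []. Qed.

(** Built by recursion along [uncons_point], to follow the recursive definition of
    [torus_measure]. *)
Fixpoint boxes d : set (set (tpoint R d)) :=
  match d with
  | 0 => [set setT]
  | d'.+1 => transport_sets (@uncons_point d') (rectangles (@rays R) (@boxes d'))
  end.

Lemma boxes_setI d : setI_closed (@boxes d).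
Proof.
elim: d => [|d IH] /=; first by move=> A B -> ->; rewrite setIT.
by apply: transport_setI; apply: rectangles_setI => //; exact: rays_setI.
Qed.

Lemma boxes_setT d : @boxes d setT.
Proof.
elim: d => [|d IH] //=.
by apply: transport_setT; apply: rectangles_setT => //; left.
Qed.

Lemma boxes_generate d : @measurable _ (tpoint R d) = <<s @boxes d >>.
Proof.
elim: d => [|d IH] /=.
  apply/seteqP; split => [A _|]; last first.
    apply: smallest_sub; first exact: sigma_algebra_measurable.
    by move=> _ ->.
  have [->|/set0P[x Ax]] := eqVneq A set0; first exact: sigma_algebra0.
  apply: sub_gen_smallest; apply/seteqP; split => // y _.
  by rewrite (tuple0 y) -(tuple0 x).
apply: transport_generate => //.
- exact: measurable_cons_point.
- exact: measurable_uncons_point.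
- exact: uncons_pointK.
apply: rectangles_generate => //; [by left|exact: boxes_setT|].
exact: rays_generate.
Qed.

Lemma boxes_measurable d : @boxes d `<=` measurable.
Proof. by move=> A GA; rewrite boxes_generate; exact: sub_gen_smallest. Qed.

Lemma torus_kernelS d N (x y : tpoint R d.+1) : torus_kernel N x y =
  circle_kernel N (uncons_point x).1 (uncons_point y).1 *
  torus_kernel N (uncons_point x).2 (uncons_point y).2.
Proof.
rewrite /torus_kernel big_ord_recl /uncons_point /=; congr (_ * _).
apply: eq_bigr => i _.
by rewrite {1}(tuple_eta x) {1}(tuple_eta y) !tnthS.
Qed.

Lemma approx_id_torus d : approx_id (torus_finite d) (@boxes d)
  (@torus_kernel d) (4 ^+ d).
Proof.
elim: d => [|d IH].
  have K1 : @torus_kernel 0 = fun _ _ _ => 1.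
    by apply/funext => N; apply/funext => x; apply/funext => y; rewrite /torus_kernel big_ord0.
  have I1 : \int[torus_finite 0]_x (1 : R) = 1.
    have T1 : torus_finite 0 setT = 1%E := probability_setT (torus_measure R 0).
    by rewrite Rintegral_cst// mul1r [X in fine X]T1.
  rewrite K1; split.
  - by move=> N; exact: measurable_cst.
  - by move=> N; exists 1 => x y; rewrite normr1.
  - by move=> N; apply: aeW => x; under eq_Rintegral do rewrite normr1; rewrite I1 expr0.
  - by move=> N; apply: aeW => x; under eq_Rintegral do rewrite normr1; rewrite I1 expr0.
  - move=> _ ->; apply: aeW => x; rewrite indicE in_setT; apply: cvg_near_cst.
    apply: nearW => N; rewrite -[RHS]I1; apply: eq_Rintegral => y _.
    by rewrite mul1r indicE in_setT.
rewrite exprS.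
rewrite (_ : @torus_kernel d.+1 = fun N x y =>
  circle_kernel N (uncons_point x).1 (uncons_point y).1 *
  torus_kernel N (uncons_point x).2 (uncons_point y).2); last first.
  by apply/funext => N; apply/funext => x; apply/funext => y; exact: torus_kernelS.
apply: (approx_id_transport (mZ := finite_product_measure uniform_measure (torus_finite d))
  (@measurable_cons_point R d) (@measurable_uncons_point d)
  (@cons_pointK d) (@torus_measureS d)
  (G := rectangles (@rays R) (@boxes d)) (K := fun N z w => circle_kernel N z.1 w.1 * torus_kernel N z.2 w.2)).
  move=> _ [A GA [B GB <-]]; apply: measurableX; first exact: rays_measurable.
  exact: boxes_measurable.
apply: approx_id_prod IH; [exact: rays_measurable|exact: boxes_measurable|].
exact: approx_id_circle.
Qed.

End torus.

(** * Smooth functions *)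

Section bounded_smooth.
Context (R : realType).
Implicit Types (f g : R -> R) (n : nat).

Definition bounded_fct f := exists M, forall x, `|f x| <= M.

(** Boundedness is part of the notion at every order: it makes products of kernel sections with
    integrable fields integrable, and it is stable under sums, products and derivatives. *)
Fixpoint bdiff n f : Prop := bounded_fct f /\
  match n with
  | 0 => True
  | n'.+1 => (forall x, derivable f x 1) /\ bdiff n' (derive1 f)
  end.

Definition bsmooth f := forall n, bdiff n f.

Lemma bounded_fctD f g : bounded_fct f -> bounded_fct g ->
  bounded_fct (fun x => f x + g x).
Proof.
move=> [M HM] [L HL]; exists (M + L) => x.
by rewrite (le_trans (ler_normD _ _))// lerD.
Qed.

Lemma bounded_fctM f g : bounded_fct f -> bounded_fct g ->
  bounded_fct (fun x => f x * g x).
Proof. by move=> [M HM] [L HL]; exists (M * L) => x; rewrite normrM ler_pM. Qed.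

Lemma bdiffS n f : bdiff n.+1 f -> bdiff n f.
Proof. by elim: n f => [|n IH] f [bf [df Hf]] //; split => //; split => //; exact: IH. Qed.

Lemma bdiffD n f g : bdiff n f -> bdiff n g -> bdiff n (fun x => f x + g x).
Proof.
elim: n f g => [|n IH] f g [bf Hf] [bg Hg]; split; try exact: bounded_fctD.
  by [].
move: Hf Hg => [df Hf] [dg Hg]; split.
  by move=> x; exact: (derivableD (df x) (dg x)).
have -> : derive1 (fun x => f x + g x) = (fun x => (derive1 f) x + (derive1 g) x).
  by apply/funext => x; rewrite !derive1E -deriveD.
exact: IH.
Qed.

Lemma bdiffM n f g : bdiff n f -> bdiff n g -> bdiff n (fun x => f x * g x).
Proof.
elim: n f g => [|n IH] f g bf bg.
  by case: bf bg => bf _ [bg _]; split => //; exact: bounded_fctM.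
have bf' := bdiffS bf; have bg' := bdiffS bg.
move: bf bg => [bf [df Hf]] [bg [dg Hg]]; split; first exact: bounded_fctM.
split; first by move=> x; exact: (derivableM (df x) (dg x)).
have -> : derive1 (fun x => f x * g x) = (fun x => f x * (derive1 g) x + g x * (derive1 f) x).
  apply/funext => x; rewrite !derive1E.
  by have := deriveM (df x) (dg x); rewrite /GRing.scale /=.
by apply: bdiffD; exact: IH.
Qed.

Lemma bdiff_cst n (c : R) : bdiff n (fun=> c).
Proof.
elim: n c => [|n IH] c; split => //; try by exists `|c|.
split; first by move=> x; exact: derivable_cst.
have -> : derive1 (fun=> c) = (fun=> 0) :> (R -> R).
  by apply/funext => x; rewrite derive1_cst.
exact: IH.
Qed.

Lemma is_derive_affine (c e x : R) : is_derive x 1 (fun u : R => c * u + e) c.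
Proof.
have -> : (fun u : R => c * u + e) = c *: (id : R -> R) + cst e by [].
by apply: is_derive_eq; rewrite /GRing.scale /= mulr1 addr0.
Qed.

Lemma bdiff_affine n f (c e : R) : bdiff n f -> bdiff n (fun x => f (c * x + e)).
Proof.
elim: n f => [|n IH] f [[M HM] Hf]; split; try by exists M.
  by [].
move: Hf => [df Hf].
have D (x : R) : is_derive x 1 (fun x => f (c * x + e)) ((derive1 f) (c * x + e) * c).
  have H1 : is_derive (c * x + e : R) 1 f ((derive1 f) (c * x + e)).
    by rewrite derive1E; apply: DeriveDef.
  exact: (is_derive1_comp _ (is_derive_affine c e x)).
split; first by move=> x; case: (D x).
have -> : derive1 (fun x => f (c * x + e)) = (fun x => (derive1 f) (c * x + e) * c).
  by apply/funext => x; rewrite derive1E; case: (D x).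
by apply: bdiffM; [exact: IH|exact: bdiff_cst].
Qed.

Lemma bdiff_trig n (w : R) :
  bdiff n (fun x => cos (w * x)) /\ bdiff n (fun x => sin (w * x)).
Proof.
have bc : bounded_fct (fun x => cos (w * x)) by exists 1 => x; exact: cos_max.
have bs : bounded_fct (fun x => sin (w * x)) by exists 1 => x; exact: sin_max.
elim: n => [|n [IHc IHs]]; first by [].
split; split => //.
  split; first by move=> x; case: (is_derive_cosZ w x).
  have -> : derive1 (fun x => cos (w * x)) = (fun x => - w * sin (w * x)).
    by apply/funext => x; rewrite derive1E mulNr; case: (is_derive_cosZ w x).
  by apply: bdiffM => //; exact: bdiff_cst.
split; first by move=> x; case: (is_derive_sinZ w x).
have -> : derive1 (fun x => sin (w * x)) = (fun x => w * cos (w * x)).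
  by apply/funext => x; rewrite derive1E; case: (is_derive_sinZ w x).
by apply: bdiffM => //; exact: bdiff_cst.
Qed.

Lemma bsmooth_derivable f x : bsmooth f -> derivable f x 1.
Proof. by move=> /(_ 1%N) [_ [+ _]]; exact. Qed.

Lemma bsmooth_is_derive f (x : R) : bsmooth f -> is_derive x 1 f ((derive1 f) x).
Proof.
by move=> bf; rewrite derive1E; apply: DeriveDef => //; exact: bsmooth_derivable.
Qed.

Lemma bsmooth_derive f : bsmooth f -> bsmooth (derive1 f).
Proof. by move=> bf n; have [_ []] := bf n.+1. Qed.

Lemma bsmooth_bounded f : bsmooth f -> bounded_fct f.
Proof. by case/(_ 0%N). Qed.

Lemma bsmooth_continuous f : bsmooth f -> continuous f.
Proof.
move=> bf x; apply: differentiable_continuous; apply/derivable1_diffP.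
exact: bsmooth_derivable.
Qed.

Lemma bsmooth_measurable f : bsmooth f ->
  measurable_fun setT (f : measurableTypeR R -> R).
Proof. by move=> /bsmooth_continuous; exact: continuous_measurable_fun. Qed.

Lemma bsmoothD f g : bsmooth f -> bsmooth g -> bsmooth (fun x => f x + g x).
Proof. by move=> bf bg n; exact: bdiffD. Qed.

Lemma bsmoothM f g : bsmooth f -> bsmooth g -> bsmooth (fun x => f x * g x).
Proof. by move=> bf bg n; exact: bdiffM. Qed.

Lemma bsmooth_cst (c : R) : bsmooth (fun=> c).
Proof. by move=> n; exact: bdiff_cst. Qed.

Lemma bsmooth_affine f (c e : R) : bsmooth f -> bsmooth (fun x => f (c * x + e)).
Proof. by move=> bf n; exact: bdiff_affine. Qed.

Lemma bsmooth_cos (w : R) : bsmooth (fun x => cos (w * x)).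
Proof. by move=> n; case: (bdiff_trig n w). Qed.

Lemma bsmooth_sin (w : R) : bsmooth (fun x => sin (w * x)).
Proof. by move=> n; case: (bdiff_trig n w). Qed.

(** * The flat exponential *)

Section flat_exponential.

(** The functions [u ^- k * expR (- u^-1)] form a family stable under differentiation: the
    derivative of [g k] is [g k.+2 - k * g k.+1]. Treating all [k] together makes smoothness an
    induction on the order. *)
Let g (k : nat) (u : R) : R := if 0 < u then u ^- k * expR (- u^-1) else 0.

Let pow_expRN k (v : R) : 0 <= v -> v ^+ k * expR (- v) <= k`!%:R.
Proof.
move=> v0; rewrite expRN ler_pdivrMr ?expR_gt0//.
case: k => [|k].
  by rewrite expr0 mul1r -expR0 ler_expR.
have k0 : 0 < k.+1`!%:R :> R by rewrite ltr0n fact_gt0.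
rewrite mulrC -ler_pdivrMr//; apply: le_trans (expR_ge1Dxn k v0).
by rewrite lerDr.
Qed.

Let g_bounded k : bounded_fct (g k).
Proof.
exists (k`!%:R) => u; rewrite /g; case: ifPn => [u0|_]; last by rewrite normr0.
rewrite -exprVn ger0_norm; first by apply: pow_expRN; rewrite invr_ge0 ltW.
by rewrite mulr_ge0 ?expR_ge0// exprn_ge0// invr_ge0 ltW.
Qed.

(** A quadratic bound, from [g k u = g k.+2 u * u ^+ 2] and the boundedness of [g k.+2]. It makes
    the difference quotient at 0 tend to 0, the only delicate point of [is_derive_g]. *)
Let g_decay k u : `|g k u| <= (k.+2)`!%:R * u ^+ 2.
Proof.
have [M0|] := leP u 0.
  by rewrite /g ltNge M0 /= normr0 mulr_ge0 ?sqr_ge0.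
move=> u0; have -> : g k u = g k.+2 u * u ^+ 2.
  rewrite /g u0 -!exprVn mulrAC; congr (_ * _).
  by rewrite -[k.+2]addn2 exprD -mulrA -exprMn mulVf ?gt_eqF// expr1n mulr1.
rewrite normrM (@ger0_norm _ (u ^+ 2)) ?sqr_ge0// ler_wpM2r ?sqr_ge0//.
rewrite /g u0 -exprVn ger0_norm; first by apply: pow_expRN; rewrite invr_ge0 ltW.
by rewrite mulr_ge0 ?expR_ge0// exprn_ge0// invr_ge0 ltW.
Qed.

Let is_derive_g k (u : R) : is_derive u 1 (g k) (g k.+2 u - k%:R * g k.+1 u).
Proof.
have [u0|u0|->] := ltgtP u 0.
- apply: (@near_eq_is_derive _ _ _ (cst 0)); last first.
    by apply: is_derive_eq; rewrite /g !ltNge !(ltW u0)/= mulr0 subrr.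
  have : \near u, u < 0 by exact: lt_nbhsl.
  by apply: filterS => v v0; rewrite /g ltNge (ltW v0).
- pose f (v : R) := (v^-1) ^+ k * expR (- v^-1).
  apply: (@near_eq_is_derive _ _ _ f).
    have : \near u, 0 < u by exact: lt_nbhsr.
    by apply: filterS => v v0; rewrite /g /f v0 exprVn.
  have dV : is_derive u 1 (fun v : R => v^-1) (- u ^- 2).
    have un0 : u != 0 by rewrite gt_eqF.
    apply: DeriveDef; first exact: derivableV.
    by rewrite deriveV// /GRing.scale /= derive_id mulr1.
  have dN : is_derive u 1 (fun v : R => - v^-1) (u ^- 2).
    by have := is_deriveN dV; rewrite opprK.
  have dE : is_derive u 1 (fun v : R => expR (- v^-1)) (expR (- u^-1) * u ^- 2).
    exact: (is_derive1_comp _ dN).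
  have dX := is_deriveX k dV.
  have := is_deriveM dX dE.
  have -> : ((fun v : R => v^-1) ^+ k * (fun v : R => expR (- v^-1))) = f.
    by apply/funext => v; rewrite /f !fctE.
  move=> H; apply: is_derive_eq H _; rewrite /GRing.scale /= /g u0 fctE.
  have un0 : u != 0 by rewrite gt_eqF.
  rewrite -!exprVn; set v := u^-1; set E := expR _.
  case: k {f dX} => [|k] /=; first by rewrite expr0 expr2 !mul0r subr0 mulr0 addr0 mul1r mulrC.
  by rewrite !exprS expr0; ring.
have g0 n : g n 0 = 0 by rewrite /g ltxx.
rewrite !g0 mulr0 subrr.
have H : h^-1 *: (g k (h *: 1 + 0) - g k 0) @[h --> (0 : R)^'] --> (0 : R).
  apply/cvgrPdist_le => e e0; near=> h.
  rewrite g0 addr0 subr0 /GRing.scale /= mulr1 sub0r normrN normrM normfV.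
  have h0 : h != 0 by near: h; exact: nbhs_dnbhs_neq.
  rewrite ler_pdivrMl ?normr_gt0//.
  apply: (le_trans (g_decay k h)); rewrite -(real_normK (num_real h)) expr2 mulrA mulrC.
  rewrite ler_wpM2l//.
  have k0 : 0 < (k.+2)`!%:R :> R by rewrite ltr0n fact_gt0.
  rewrite mulrC -ler_pdivlMr//.
  near: h; apply: dnbhs0_le; exact: divr_gt0.
apply: DeriveDef; first by apply/cvg_ex; exists 0.
by apply/cvg_lim.
Unshelve. all: by end_near.
Qed.

Let bsmooth_g k : bsmooth (g k).
Proof.
move=> n; elim: n k => [|n IH] k; split => //.
split; first by move=> u; case: (is_derive_g k u).
have -> : derive1 (g k) = (fun u => g k.+2 u + (- k%:R) * g k.+1 u).
  apply/funext => u; rewrite derive1E mulNr; case: (is_derive_g k u) => _ ->.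
  by [].
by apply: bdiffD => //; apply: bdiffM => //; exact: bdiff_cst.
Qed.

Definition flat_exp (u : R) : R := if 0 < u then expR (- u^-1) else 0.

Let flat_expE : flat_exp = g 0.
Proof. by apply/funext => u; rewrite /g /flat_exp expr0 invr1 mul1r. Qed.

Lemma bsmooth_flat_exp : bsmooth flat_exp.
Proof. by rewrite flat_expE; exact: bsmooth_g. Qed.

Lemma flat_exp_derive u : derive1 flat_exp u = if 0 < u then u ^- 2 * expR (- u^-1) else 0.
Proof.
rewrite flat_expE derive1E; case: (is_derive_g 0 u) => _ ->.
by rewrite mul0r subr0 /g.
Qed.

Lemma flat_exp_ge0 u : 0 <= flat_exp u.
Proof. by rewrite /flat_exp; case: ifP => // _; exact: expR_ge0. Qed.

Lemma flat_exp_le1 u : flat_exp u <= 1.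
Proof.
rewrite /flat_exp; case: ifP => // u0.
by rewrite -expR0 ler_expR oppr_le0 invr_ge0 ltW.
Qed.

End flat_exponential.

End bounded_smooth.

(** * Products of one-variable functions *)

Section tensors.
Context (R : realType) (d : nat).
Implicit Types (a : R -> R) (b : 'I_d -> R -> R) (f g : sfield R d).

(** Sections of the mollifying kernels have this form, and every partial derivative acts on a single
    factor, so calculus on space-time reduces to one variable. *)
Definition tens a b : sfield R d := fun p => a p.1 * \prod_i b i (tnth p.2 i).

Definition dupd b i : 'I_d -> R -> R :=
  fun j => if j == i then derive1 (b i) else b j.

Lemma tnth_upd (x : tpoint R d) i j s :
  tnth (upd x i s) j = if j == i then s else tnth x j.
Proof. by rewrite tnth_mktuple. Qed.

Lemma prod_upd b (x : tpoint R d) i s :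
  \prod_j b j (tnth (upd x i s) j) = b i s * \prod_(j | j != i) b j (tnth x j).
Proof.
rewrite (bigD1 i)//= tnth_upd eqxx; congr (_ * _).
by apply: eq_bigr => j /negbTE ji; rewrite tnth_upd ji.
Qed.

Lemma is_derive_tens_dt a b p : bsmooth a ->
  is_derive (p.1 : R) 1 (fun s => tens a b (s, p.2)) (tens (derive1 a) b p).
Proof.
move=> ba; rewrite /tens /=; set c := \prod_i _.
have -> : (fun s => a s * c) = c \*: a.
  by apply/funext => s; rewrite mulrC.
apply: (is_derive_eq (is_deriveZ c (bsmooth_is_derive p.1 ba))).
by rewrite mulrC.
Qed.

Lemma is_derive_tens_dx a b i p : bsmooth (b i) ->
  is_derive (tnth p.2 i : R) 1 (fun s => tens a b (p.1, upd p.2 i s))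
    (tens a (dupd b i) p).
Proof.
move=> bb; rewrite /tens /=.
set c := a p.1 * \prod_(j | j != i) b j (tnth p.2 j).
have -> : (fun s => a p.1 * \prod_j b j (tnth (upd p.2 i s) j)) = c \*: b i.
  by apply/funext => s; rewrite prod_upd mulrCA mulrC.
apply: (is_derive_eq (is_deriveZ c (bsmooth_is_derive (tnth p.2 i) bb))).
rewrite /GRing.scale /= [in RHS](bigD1 i)//= {1}/dupd eqxx /c mulrAC -mulrA.
congr (_ * (_ * _)); by apply: eq_bigr => j /negbTE; rewrite /dupd => ->.
Qed.

Lemma dt_tens a b : bsmooth a -> dt (tens a b) = tens (derive1 a) b.
Proof.
move=> ba; apply/funext => p; rewrite /dt derive1E.
by case: (is_derive_tens_dt b p ba).
Qed.

Lemma dx_tens a b i : bsmooth (b i) -> dx i (tens a b) = tens a (dupd b i).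
Proof.
move=> bb; apply/funext => p; rewrite /dx derive1E.
by case: (is_derive_tens_dx a p bb).
Qed.

Lemma bsmooth_dupd b i : (forall j, bsmooth (b j)) -> forall j, bsmooth (dupd b i j).
Proof. by move=> bb j; rewrite /dupd; case: eqP => // _; exact: bsmooth_derive. Qed.

Lemma tens_continuous a b : bsmooth a -> (forall i, bsmooth (b i)) ->
  continuous (fun p : R * 'rV[R]_d => tens a b (p.1, [tuple p.2 ord0 i | i < d])).
Proof.
move=> ba bb.
have -> : (fun p : R * 'rV[R]_d => tens a b (p.1, [tuple p.2 ord0 i | i < d])) =
    (fun p => a p.1 * \prod_i b i (p.2 ord0 i)).
  apply/funext => p; rewrite /tens /=; congr (_ * _).
  by apply: eq_bigr => i _; rewrite tnth_mktuple.
suff H r : continuous (fun q : R * 'rV[R]_d => \prod_(i <- r) b i (q.2 ord0 i)).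
  move=> p; apply: cvgM; last exact: H.
  apply: (@cvg_comp _ _ _ fst a); first exact: cvg_fst.
  exact: bsmooth_continuous.
elim: r => [|i r IH] p.
  by under eq_fun do rewrite big_nil; rewrite ?big_nil; exact: cvg_cst.
under eq_fun do rewrite big_cons; rewrite ?big_cons; apply: cvgM; last exact: IH.
apply: (@cvg_comp _ _ _ (fun q : R * 'rV[R]_d => q.2 ord0 i) (b i)); last first.
  exact: bsmooth_continuous.
apply: (@cvg_comp _ _ _ snd (fun v : 'rV[R]_d => v ord0 i)); first exact: cvg_snd.
exact: coord_continuous.
Qed.

Lemma Ck_tens k a b : bsmooth a -> (forall i, bsmooth (b i)) -> Ck k (tens a b).
Proof.
elim: k a b => [|k IH] a b ba bb; split; try exact: tens_continuous.
  by [].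
split.
- by move=> p; case: (is_derive_tens_dt b p ba).
- by move=> i p; case: (is_derive_tens_dx a p (bb i)).
- by rewrite dt_tens//; apply: IH => //; exact: bsmooth_derive.
- by move=> i; rewrite dx_tens//; apply: IH => //; exact: bsmooth_dupd.
Qed.

Lemma Ck0 k : Ck k ((fun=> 0) : sfield R d).
Proof.
elim: k => [|k IH]; split=> //; try exact: cst_continuous.
split.
- by move=> p; exact: derivable_cst.
- by move=> i p; exact: derivable_cst.
- by rewrite (_ : dt _ = fun=> 0)//; apply/funext => p; rewrite /dt derive1_cst.
- by move=> i; rewrite (_ : dx i _ = fun=> 0)//; apply/funext => p; rewrite /dx derive1_cst.
Qed.

Lemma dtD f g : Ck 1 f -> Ck 1 g -> dt (fun p => f p + g p) = (fun p => dt f p + dt g p).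
Proof.
move=> [_ [df _ _ _]] [_ [dg _ _ _]]; apply/funext => p.
by rewrite /dt !derive1E; exact: (deriveD (df p) (dg p)).
Qed.

Lemma dxD i f g : Ck 1 f -> Ck 1 g ->
  dx i (fun p => f p + g p) = (fun p => dx i f p + dx i g p).
Proof.
move=> [_ [_ df _ _]] [_ [_ dg _ _]]; apply/funext => p.
by rewrite /dx !derive1E; exact: (deriveD (df i p) (dg i p)).
Qed.

Lemma Ck_le k f : Ck k.+1 f -> Ck k f.
Proof.
elim: k f => [|k IH] f [cf [dtf dxf Hf Hg]]; split => //; split => //.
  exact: IH Hf.
by move=> i; exact: IH (Hg i).
Qed.

Lemma Ck_ge1 k f : Ck k.+1 f -> Ck 1 f.
Proof. by elim: k f => // k IH f /Ck_le; exact: IH. Qed.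

Lemma CkD k f g : Ck k f -> Ck k g -> Ck k (fun p => f p + g p).
Proof.
elim: k f g => [|k IH] f g Hf Hg; split.
- by move=> p; apply: cvgD; [exact: Hf.1|exact: Hg.1].
- by [].
- by move=> p; apply: cvgD; [exact: Hf.1|exact: Hg.1].
have f1 := Ck_ge1 Hf; have g1 := Ck_ge1 Hg.
move: Hf Hg => [_ [dtf dxf Hf Hf']] [_ [dtg dxg Hg Hg']]; split.
- by move=> p; exact: (derivableD (dtf p) (dtg p)).
- by move=> i p; exact: (derivableD (dxf i p) (dxg i p)).
- by rewrite dtD//; exact: IH.
- by move=> i; rewrite dxD//; apply: IH; [exact: Hf'|exact: Hg']. 
Qed.

Lemma Ck_sum k (I : Type) (r : seq I) (F : I -> sfield R d) :
  (forall j, Ck k (F j)) -> Ck k (fun p => \sum_(j <- r) F j p).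
Proof.
move=> CF; elim: r => [|j r IH].
  by under eq_fun do rewrite big_nil; exact: Ck0.
by under eq_fun do rewrite big_cons; exact: CkD.
Qed.

Lemma dt_sum (I : Type) (r : seq I) (F : I -> sfield R d) : (forall j, Ck 1 (F j)) ->
  dt (fun p => \sum_(j <- r) F j p) = (fun p => \sum_(j <- r) dt (F j) p).
Proof.
move=> CF; elim: r => [|j r IH].
  under eq_fun do rewrite big_nil; under [RHS]eq_fun do rewrite big_nil.
  by apply/funext => p; rewrite /dt derive1_cst.
under eq_fun do rewrite big_cons; under [RHS]eq_fun do rewrite big_cons.
by rewrite dtD//; [rewrite IH|exact: Ck_sum].
Qed.

Lemma dx_sum i (I : Type) (r : seq I) (F : I -> sfield R d) : (forall j, Ck 1 (F j)) ->
  dx i (fun p => \sum_(j <- r) F j p) = (fun p => \sum_(j <- r) dx i (F j) p).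
Proof.
move=> CF; elim: r => [|j r IH].
  under eq_fun do rewrite big_nil; under [RHS]eq_fun do rewrite big_nil.
  by apply/funext => p; rewrite /dx derive1_cst.
under eq_fun do rewrite big_cons; under [RHS]eq_fun do rewrite big_cons.
by rewrite dxD//; [rewrite IH|exact: Ck_sum].
Qed.

Definition periodic1 (f : R -> R) := forall x, f (x + 1) = f x.

Lemma periodic_tens a b : (forall i, periodic1 (b i)) -> Defs.periodic (tens a b).
Proof.
move=> pb t x i; rewrite /tens /= prod_upd pb; congr (_ * _).
by rewrite [RHS](bigD1 i).
Qed.

Lemma smooth_tens a b : bsmooth a -> (forall i, bsmooth (b i)) ->
  (forall i, periodic1 (b i)) -> smooth (tens a b).
Proof. by move=> ba bb pb; split; [move=> k; exact: Ck_tens|exact: periodic_tens]. Qed.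

Lemma smooth_sum (I : Type) (r : seq I) (F : I -> sfield R d) :
  (forall j, smooth (F j)) -> smooth (fun p => \sum_(j <- r) F j p).
Proof.
move=> sF; split; first by move=> k; apply: Ck_sum => j; case: (sF j).
by move=> t x i; apply: eq_bigr => j _; case: (sF j) => _; exact.
Qed.

Lemma bounded_tens a b : bsmooth a -> (forall i, bsmooth (b i)) ->
  exists M, forall p, `|tens a b p| <= M.
Proof.
move=> /bsmooth_bounded[M HM] bb.
have [C HC] := @choice _ _ (fun i C => forall x, `|b i x| <= C)
  (fun i => bsmooth_bounded (bb i)).
exists (M * \prod_i C i) => p; rewrite normrM ler_pM// normr_prod.
by apply: ler_prod => i _; rewrite normr_ge0 HC.
Qed.

Lemma measurable_tens a b : bsmooth a -> (forall i, bsmooth (b i)) ->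
  measurable_fun setT (tens a b).
Proof.
move=> ba bb.
apply: (@measurable_prodM _ _ _ _ _ a (fun x => \prod_i b i (tnth x i))).
  exact: bsmooth_measurable.
apply: measurable_prod => i _.
apply: (measurableT_comp (bsmooth_measurable (bb i))).
exact: measurable_tnth.
Qed.

End tensors.

(** * Separable kernels and convolution *)

Section separable_kernels.
Context (R : realType).
Implicit Types (K L : R -> R -> R) (Q : (R -> R) -> Prop).

Definition closed_class Q := [/\ forall c, Q (fun=> c),
  forall f g, Q f -> Q g -> Q (fun x => f x + g x) &
  forall f g, Q f -> Q g -> Q (fun x => f x * g x)].

(** Finite rank: integration against such a kernel gives a finite combination of the functions
    [e r], whose regularity is inherited. *)
Definition separable Q K := exists (I : finType) (e f : I -> R -> R),
  [/\ forall r, Q (e r), forall r, Q (f r) &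
      forall x y, K x y = \sum_r e r x * f r y].

Variable Q : (R -> R) -> Prop.
Hypothesis QC : closed_class Q.

Lemma closed_class_sum (I : Type) (r : seq I) (F : I -> R -> R) :
  (forall i, Q (F i)) -> Q (fun x => \sum_(i <- r) F i x).
Proof.
case: QC => Qc QD _ QF; elim: r => [|i r IH].
  by under eq_fun do rewrite big_nil.
by under eq_fun do rewrite big_cons; exact: QD.
Qed.

Lemma separable_slice1 K x : separable Q K -> Q (K x).
Proof.
move=> [I [e [f [Qe Qf KE]]]].
rewrite (_ : K x = fun y => \sum_r e r x * f r y); last exact/funext/KE.
by case: QC => Qc _ QM; apply: closed_class_sum => r; exact: QM.
Qed.

Lemma separable_slice2 K y : separable Q K -> Q (K ^~ y).
Proof.
move=> [I [e [f [Qe Qf KE]]]].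
rewrite (_ : (K ^~ y) = fun x => \sum_r e r x * f r y); last first.
  by apply/funext => x; exact: KE.
by case: QC => Qc _ QM; apply: closed_class_sum => r; apply: QM.
Qed.

Lemma separable1 (f g : R -> R) : Q f -> Q g -> separable Q (fun x y => f x * g y).
Proof.
move=> Qf Qg; exists unit, (fun=> f), (fun=> g); split => // x y.
by rewrite (big_pred1 tt)//; case.
Qed.

Lemma separableD K L : separable Q K -> separable Q L ->
  separable Q (fun x y => K x y + L x y).
Proof.
move=> [I [e [f [Qe Qf KE]]]] [J [e' [f' [Qe' Qf' LE]]]].
exists (I + J)%type, (fun r => match r with inl i => e i | inr j => e' j end).
exists (fun r => match r with inl i => f i | inr j => f' j end).
by split => [[r|r]|[r|r]|x y] //; rewrite big_sumType /= KE LE.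
Qed.

Lemma separableM K L : separable Q K -> separable Q L ->
  separable Q (fun x y => K x y * L x y).
Proof.
case: QC => _ _ QM.
move=> [I [e [f [Qe Qf KE]]]] [J [e' [f' [Qe' Qf' LE]]]].
exists (I * J)%type, (fun r x => e r.1 x * e' r.2 x), (fun r x => f r.1 x * f' r.2 x).
split => [[i j]|[i j]|x y]; [exact: QM|exact: QM|].
rewrite KE LE big_distrlr /= pair_big /=.
by apply: eq_bigr => -[i j] _ /=; rewrite mulrACA.
Qed.

Lemma separable_cst c : separable Q (fun _ _ => c).
Proof.
case: QC => Qc _ _; have := @separable1 (fun=> c) (fun=> 1) (Qc _) (Qc _).
by under eq_fun do under eq_fun do rewrite mulr1.
Qed.

Lemma separableX K n : separable Q K -> separable Q (fun x y => K x y ^+ n).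
Proof.
move=> sK; elim: n => [|n IH]; first exact: separable_cst.
under eq_fun do under eq_fun do rewrite exprS.
exact: separableM.
Qed.

End separable_kernels.

Section trigonometric_kernels.
Context (R : realType).

Definition pbsmooth (f : R -> R) := bsmooth f /\ periodic1 f.

Lemma bsmooth_closed : closed_class (@bsmooth R).
Proof. by split; [exact: bsmooth_cst|exact: bsmoothD|exact: bsmoothM]. Qed.

Lemma pbsmooth_closed : closed_class pbsmooth.
Proof.
split=> [c|f g [bf pf] [bg pg]|f g [bf pf] [bg pg]].
- by split; [exact: bsmooth_cst|].
- by split; [exact: bsmoothD|move=> x; rewrite pf pg].
- by split; [exact: bsmoothM|move=> x; rewrite pf pg].
Qed.

(** The addition formula gives the cosine of a difference rank two, and powers of separable kernels
    stay separable. *)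
Lemma separable_ckernelB (w : R) M :
  separable (@bsmooth R) (fun t s => ckernel w M (t - s)).
Proof.
rewrite /ckernel; apply: (separableM bsmooth_closed); last first.
  exact: separable_cst bsmooth_closed _.
apply: (separableX bsmooth_closed).
under eq_fun do under eq_fun do rewrite mulrBr cosB.
apply: separableD; apply: separable1;
  by [exact: bsmooth_cos|exact: bsmooth_sin].
Qed.

Lemma separable_ckernelD (w : R) M :
  separable (@bsmooth R) (fun t s => ckernel w M (t + s)).
Proof.
rewrite /ckernel; apply: (separableM bsmooth_closed); last first.
  exact: separable_cst bsmooth_closed _.
apply: (separableX bsmooth_closed).
under eq_fun do under eq_fun do rewrite mulrDr cosD -mulNr.
apply: separableD; apply: separable1;
  try by [exact: bsmooth_cos|exact: bsmooth_sin].
have := bsmoothM (bsmooth_cst (-1)) (bsmooth_sin w).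
by under eq_fun do rewrite mulN1r.
Qed.

Lemma separable_ekernel (w sgn : R) M : separable (@bsmooth R) (ekernel w sgn M).
Proof.
apply: separableD; first exact: separable_ckernelB.
apply: (separableM bsmooth_closed); last exact: separable_ckernelD.
exact: separable_cst bsmooth_closed _.
Qed.

(** Expanding [cos (pi * (x - y))] directly would give factors that change sign under [x + 1]. The
    double-angle formula rewrites its square with [cos (2 * pi * (x - y))], whose expansion has
    1-periodic factors. *)
Lemma separable_circle_kernel N : separable pbsmooth (@circle_kernel R N).
Proof.
have -> : @circle_kernel R N = fun x y =>
    (2^-1 * (1 + (cos (2 * pi * x) * cos (2 * pi * y) +
     sin (2 * pi * x) * sin (2 * pi * y)))) ^+ N / (2 * cos_int pi N.*2 (quarter pi)).
  apply/funext => x; apply/funext => y.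
  rewrite /circle_kernel /ekernel mul0r addr0 /ckernel -cosB; congr (_ / _).
  rewrite -muln2 mulnC exprM; congr (_ ^+ _).
  have H (p : R) : 2 * p * x - 2 * p * y = (p * (x - y)) *+ 2 by rewrite mulr2n; ring.
  rewrite H cos_mulr2n; move: (cos _) => c; rewrite mulr2n. by field.
apply: (separableM pbsmooth_closed); last exact: separable_cst pbsmooth_closed _.
apply: (separableX pbsmooth_closed).
apply: (separableM pbsmooth_closed); first exact: separable_cst pbsmooth_closed _.
apply: separableD; first exact: separable_cst pbsmooth_closed _.
have pc : pbsmooth (fun x => cos (2 * pi * x)).
  split; first exact: bsmooth_cos.
  by move=> x; rewrite mulrDr mulr1 mulr_natl cosD2pi.
have ps : pbsmooth (fun x => sin (2 * pi * x)).
  split; first exact: bsmooth_sin.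
  by move=> x; rewrite mulrDr mulr1 mulr_natl sinD2pi.
by apply: separableD; exact: separable1.
Qed.

End trigonometric_kernels.

Section convolution.
Context (R : realType) (d : nat).
Implicit Types (A B : R -> R -> R).

Definition tensk A B (p q : spacetime R d) : R :=
  A p.1 q.1 * \prod_i B (tnth p.2 i) (tnth q.2 i).

Variable m : {finite_measure set (spacetime R d) -> \bar R}.
Variables (A B : R -> R -> R) (h : sfield R d).
Hypotheses (sA : separable (@bsmooth R) A) (sB : separable (@pbsmooth R) B).
Hypothesis Ih : intg m h.

(** Distributing the product over coordinates of the sums for [B] creates one term for each choice
    function from coordinates to summands, hence the index type [{ffun 'I_d -> J}]. *)
Let tensk_sum : exists (I : finType) (a1 a2 : I -> R -> R) (b1 b2 : I -> 'I_d -> R -> R),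
  [/\ forall r, bsmooth (a1 r), forall r, bsmooth (a2 r),
      forall r i, pbsmooth (b1 r i), forall r i, pbsmooth (b2 r i) &
   forall p q, tensk A B p q = \sum_r tens (a1 r) (b1 r) p * tens (a2 r) (b2 r) q].
Proof.
case: sA => I [e [f [be bf AE]]]; case: sB => J [e' [f' [be' bf' BE]]].
exists (I * {ffun 'I_d -> J})%type, (fun r => e r.1), (fun r => f r.1),
  (fun r i => e' ((r.2 : {ffun 'I_d -> J}) i)),
  (fun r i => f' ((r.2 : {ffun 'I_d -> J}) i)).
split=> // p q; rewrite /tensk AE; under eq_bigr do rewrite BE.
rewrite bigA_distr_bigA big_distrlr /= pair_big /=.
by apply: eq_bigr => -[r g] _ /=; rewrite /tens big_split /= mulrACA.
Qed.

Definition conv p : R := \int[m]_q (tensk A B p q * h q).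

Lemma conv_smooth : [/\ smooth conv,
  measurable_fun setT conv /\ (exists M, forall p, `|conv p| <= M),
  forall x, bsmooth (fun t => conv (t, x)),
  forall p, dt conv p = \int[m]_q (dt (fun p => tensk A B p q) p * h q) &
  forall i p, dx i conv p = \int[m]_q (dx i (fun p => tensk A B p q) p * h q)].
Proof.
have [I [a1 [a2 [b1 [b2 [ba1 ba2 bb1 bb2 KE]]]]]] := tensk_sum.
have Ir r : intg m (fun q => tens (a2 r) (b2 r) q * h q).
  have [M HM] := bounded_tens (ba2 r) (fun i => (bb2 r i).1).
  apply: (intg_bounded_mull (M := M)) => //; last exact: aeW.
  by apply: measurable_tens => // i; case: (bb2 r i).
pose c r := \int[m]_q (tens (a2 r) (b2 r) q * h q).
have lin (F : I -> R) : \int[m]_q ((\sum_r F r * tens (a2 r) (b2 r) q) * h q) =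
    \sum_r F r * c r.
  under eq_Rintegral do rewrite mulr_suml.
  rewrite Rint_sum; last first.
    by move=> r; under eq_fun do rewrite -mulrA; exact: intgZ.
  apply: eq_bigr => r _; rewrite -RintegralZl//.
  by apply: eq_Rintegral => q _; rewrite mulrA.
(* The coefficient is placed in the time factor, so that a scaled product keeps the form [tens]. *)
have sm (w : I -> R) r : smooth (tens (fun t => w r * a1 r t) (b1 r)).
  apply: smooth_tens; [|by move=> i; case: (bb1 r i)|by move=> i; case: (bb1 r i)].
  by apply: bsmoothM => //; exact: bsmooth_cst.
have scale (w : I -> R) p r : tens (fun t => w r * a1 r t) (b1 r) p =
    tens (a1 r) (b1 r) p * w r by rewrite /tens; ring.
have convE : conv = fun p => \sum_r tens (fun t => c r * a1 r t) (b1 r) p.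
  apply/funext => p; rewrite /conv; under eq_Rintegral do rewrite KE.
  by rewrite lin; apply: eq_bigr => r _; rewrite scale.
have dtS (w : I -> R) p : dt (fun p => \sum_r tens (fun t => w r * a1 r t) (b1 r) p) p =
    \sum_r dt (tens (a1 r) (b1 r)) p * w r.
  rewrite dt_sum; last by move=> r; case: (sm w r) => /(_ 1%N).
  apply: eq_bigr => r _.
  have H := is_derive_tens_dt (b1 r) p (ba1 r).
  have -> : tens (fun t => w r * a1 r t) (b1 r) = fun p => w r * tens (a1 r) (b1 r) p.
    by apply/funext => q; rewrite scale mulrC.
  have H2 := is_deriveZ (w r) H.
  rewrite dt_tens// mulrC /dt derive1E.
  exact: (@derive_val _ _ _ _ _ _ _ H2).
have dxS i (w : I -> R) p : dx i (fun p => \sum_r tens (fun t => w r * a1 r t) (b1 r) p) p =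
    \sum_r dx i (tens (a1 r) (b1 r)) p * w r.
  rewrite dx_sum; last by move=> r; case: (sm w r) => /(_ 1%N).
  apply: eq_bigr => r _.
  have H := is_derive_tens_dx (a1 r) p (bb1 r i).1.
  have -> : tens (fun t => w r * a1 r t) (b1 r) = fun p => w r * tens (a1 r) (b1 r) p.
    by apply/funext => q; rewrite scale mulrC.
  have H2 := is_deriveZ (w r) H.
  rewrite dx_tens; last by case: (bb1 r i).
  rewrite mulrC /dx derive1E.
  exact: (@derive_val _ _ _ _ _ _ _ H2).
(* For fixed [q] the kernel itself is a sum of the same shape, with coefficients depending on [q];
   [dtS] and [dxS] therefore also differentiate the integrands on the right-hand sides. *)
have KE2 q : (fun p => tensk A B p q) =
    fun p => \sum_r tens (fun t => tens (a2 r) (b2 r) q * a1 r t) (b1 r) p.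
  by apply/funext => p; rewrite KE; apply: eq_bigr => r _; rewrite (scale (fun r => tens (a2 r) (b2 r) q)).
split.
- by rewrite convE; apply: smooth_sum => r; exact: sm.
- have bt r : bsmooth (fun t => c r * a1 r t).
    by apply: bsmoothM => //; exact: bsmooth_cst.
  have bb r i : bsmooth (b1 r i) by case: (bb1 r i).
  rewrite convE; split.
    by apply: measurable_sum => r; exact: measurable_tens.
  have [C HC] := @choice _ _ (fun r C => forall p,
    `|tens (fun t => c r * a1 r t) (b1 r) p| <= C)
    (fun r => bounded_tens (bt r) (bb r)).
  exists (\sum_r C r) => p; apply: (le_trans (ler_norm_sum _ _ _)).
  by apply: ler_sum => r _; exact: HC.
- move=> x; rewrite convE /tens /=.
  apply: (closed_class_sum (@bsmooth_closed R)) => r.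
  apply: bsmoothM; last exact: bsmooth_cst.
  by apply: bsmoothM => //; exact: bsmooth_cst.
- move=> p; rewrite convE dtS; under [RHS]eq_Rintegral do
    rewrite KE2 (dtS (fun r => tens (a2 r) (b2 r) _)).
  by rewrite lin.
- move=> i p; rewrite convE dxS; under [RHS]eq_Rintegral do
    rewrite KE2 (dxS i (fun r => tens (a2 r) (b2 r) _)).
  by rewrite lin.
Qed.

End convolution.

(** * Integration by parts in time *)

Section spacetime.
Context (R : realType) (d : nat) (T : R).
Hypothesis T0 : 0 < T.

(** Convertible to [spacetime_measure T d], but equipped with the finite-measure structure on which
    the integrability lemmas rely. *)
Definition stm : {finite_measure set (spacetime R d) -> \bar R} :=
  finite_product_measure (time_measure T) (torus_finite R d).

Lemma Lp_field_sq (f : sfield R d) : Lp_field T 2%:E f ->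
  measurable_fun setT f /\ intg stm (fun p => f p ^+ 2).
Proof.
move=> [_ fL]; split; last exact: Lfun2_integrable_sqr fL.
by move: fL; rewrite inE /= => /andP[]; rewrite inE.
Qed.

Lemma L2_torus_sq (g : tpoint R d -> R) : L2_torus g ->
  measurable_fun setT g /\ intg (torus_finite R d) (fun x => g x ^+ 2).
Proof.
move=> [_ fL]; split; last exact: Lfun2_integrable_sqr fL.
by move: fL; rewrite inE /= => /andP[]; rewrite inE.
Qed.

Lemma Lp_field_infty (f : sfield R d) : Lp_field T +oo%E f ->
  measurable_fun setT f /\ exists2 M, 0 <= M & {ae stm, forall p, `|f p| <= M}.
Proof.
move=> [_]; rewrite inE => /andP[]; rewrite !inE /= => mf fL; split => //.
move: fL; rewrite /finite_norm unlock; case: ifPn => mT; last first.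
  (* When the whole space has measure zero, the norm is 0 by convention and any property holds
     almost everywhere. *)
  move=> _; exists 0 => //; exists setT; split => //.
  by apply/eqP; rewrite -measure_le0 leNgt.
move=> fL; have := ess_sup_ge (spacetime_measure T d) (abse \o (EFin \o f)).
move: fL; case: (ess_sup _ _) => [M| |] //= _ H.
  exists (Num.max 0 M); first by rewrite le_max lexx.
  apply: (ae_imp (m := stm) H) => p /=; rewrite lee_fin => fp.
  by rewrite le_max fp orbT.
by exists 0 => //; apply: (ae_imp (m := stm) H) => p.
Qed.

(** Vanishes up to [t = n.+1%:R^-1] and tends to 1 at every positive time; [rcut] does the same at
    [T]. Both are written as an affine substitution so that [bsmooth_affine] applies. *)
Definition lcut n (t : R) : R := flat_exp (n.+1%:R * t + -1).
Definition rcut n (t : R) : R := flat_exp (- n.+1%:R * t + (n.+1%:R * T - 1)).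

Lemma bsmooth_lcut n : bsmooth (lcut n).
Proof. exact: bsmooth_affine (bsmooth_flat_exp R). Qed.

Lemma bsmooth_rcut n : bsmooth (rcut n).
Proof. exact: bsmooth_affine (bsmooth_flat_exp R). Qed.

Lemma flat_exp_near1 (u e : R) : 0 < e -> e^-1 <= u -> `|1 - flat_exp u| <= e.
Proof.
move=> e0 eu; have u0 : 0 < u by apply: lt_le_trans eu; rewrite invr_gt0.
rewrite ger0_norm ?subr_ge0 ?flat_exp_le1// /flat_exp u0.
have := expR_ge1Dx (- u^-1).
have : u^-1 <= e by rewrite -[e]invrK lef_pV2 ?posrE ?invr_gt0.
lra.
Qed.

Lemma cut_cvg (c : R) : 0 < c -> flat_exp (n.+1%:R * c + -1) @[n --> \oo] --> (1 : R).
Proof.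
move=> c0; apply/cvgrPdist_le => e e0.
have [n _ Hn] := nbhs_infty_ger ((e^-1 + 1) / c).
exists n => // k /Hn /= kc; apply: flat_exp_near1 => //.
rewrite -lerBlDr opprK -ler_pdivrMr//; apply: le_trans kc _.
by rewrite ler_nat.
Qed.

Lemma rcutE n t : rcut n t = flat_exp (n.+1%:R * (T - t) + -1).
Proof. by rewrite /rcut; congr flat_exp; ring. Qed.

Lemma lcut_cvg t : 0 < t -> lcut n t @[n --> \oo] --> (1 : R).
Proof. exact: cut_cvg. Qed.

Lemma rcut_cvg t : t < T -> rcut n t @[n --> \oo] --> (1 : R).
Proof.
by move=> tT; under eq_fun do rewrite rcutE; apply: cut_cvg; rewrite subr_gt0.
Qed.

Lemma cut_eq0 (n : nat) (c : R) : c <= n.+1%:R^-1 -> flat_exp (n.+1%:R * c + -1) = 0.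
Proof.
move=> cn; rewrite /flat_exp ifF//; apply/negbTE.
by rewrite -leNgt subr_le0 mulrC -ler_pdivlMr// mul1r.
Qed.

Lemma cut_bound n t : `|lcut n t| <= 1 /\ `|rcut n t| <= 1.
Proof. by rewrite !ger0_norm ?flat_exp_ge0 ?flat_exp_le1. Qed.

Lemma test_tens (a : R -> R) (b : 'I_d -> R -> R) n k : bsmooth a -> (forall i, pbsmooth (b i)) ->
  test_function T (tens (fun t => lcut n t * (rcut k t * a t)) b).
Proof.
move=> ba bb; split.
  apply: smooth_tens; [|by move=> i; case: (bb i)|by move=> i; case: (bb i)].
  apply: bsmoothM; first exact: bsmooth_lcut.
  by apply: bsmoothM => //; exact: bsmooth_rcut.
exists n.+1%:R^-1, (T - k.+1%:R^-1); split.
- by rewrite invr_gt0.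
- by rewrite ltrBlDr ltrDl invr_gt0.
move=> t x; rewrite negb_and -!ltNge => /orP[tn|tk]; rewrite /tens /=.
  by rewrite [lcut n t]cut_eq0 ?mul0r// ltW.
by rewrite rcutE cut_eq0 ?(mul0r, mulr0)// lerBlDl -lerBlDr ltW.
Qed.

(** Removes the cutoffs from identities without time derivative: there they are mere factors bounded
    by 1, and dominated convergence applies. *)
Lemma cut_limit (h : sfield R d) : intg stm h ->
  (forall n, \int[stm]_p (lcut n p.1 * rcut n p.1 * h p) = 0) -> \int[stm]_p h p = 0.
Proof.
move=> Ih H.
have mh := intg_measurable Ih.
have : \int[stm]_p (lcut n p.1 * rcut n p.1 * h p) @[n --> \oo] --> \int[stm]_p h p.
  apply: (Rint_dct _ mh (intg_abs Ih)).
  - move=> n; apply: measurable_funM => //; apply: measurable_funM.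
      apply: (measurableT_comp (bsmooth_measurable (bsmooth_lcut n))).
      exact: measurable_fst.
    apply: (measurableT_comp (bsmooth_measurable (bsmooth_rcut n))).
    exact: measurable_fst.
  - apply: (ae_imp (ae_fst (torus_finite R d) (ae_time T))) => p /andP[p0 pT].
    suff : lcut n p.1 * rcut n p.1 * h p @[n --> \oo] --> 1 * 1 * h p.
      by rewrite mulr1 mul1r.
    apply: cvgMl; exact: cvgM (lcut_cvg p0) (rcut_cvg pT).
  - move=> n; apply: aeW => p; rewrite !normrM ler_piMl//.
    by have [l r] := cut_bound n p.1; rewrite mulr_ile1.
rewrite (_ : (fun n => _) = fun=> 0); last by apply/funext.
by move=> /(cvg_unique _ (cvg_cst _)) <-.
Qed.

(** The function [w] is merely integrable away from [t0], so the masses [D n] must become uniformly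
    small there; near [t0] their total mass times the oscillation of [w] is enough. *)
Lemma approx_delta (D : nat -> R -> R) (t0 w0 : R) (w : R -> R) :
  (forall n, bsmooth (D n)) -> (forall n t, 0 <= D n t) ->
  \int[time_measure T]_t D n t @[n --> \oo] --> (1 : R) ->
  (forall de e, 0 < de -> 0 < e -> \forall n \near \oo,
     forall t, 0 < t < T -> de <= `|t - t0| -> D n t <= e) ->
  intg (time_measure T) w ->
  (forall e, 0 < e -> exists2 de, 0 < de &
     forall t, 0 < t < T -> `|t - t0| < de -> `|w t - w0| <= e) ->
  \int[time_measure T]_t (D n t * w t) @[n --> \oo] --> w0.
Proof.
move=> bD D0 D1 Dsmall Iw ww0.
have mD n := bsmooth_measurable (bD n).
have ID n (h : R -> R) : intg (time_measure T) h -> intg (time_measure T) (fun t => D n t * h t).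
  move=> Ih; have [M HM] := bsmooth_bounded (bD n).
  by apply: (intg_bounded_mull (M := M)) => //; exact: aeW.
have ID1 n : intg (time_measure T) (D n).
  have := ID n _ (intg_cst (time_measure T) 1).
  by apply: eq_integrable => // t _; rewrite /= mulr1.
have Iww : intg (time_measure T) (fun t => w t - w0).
  by apply: intgB => //; exact: intg_cst.
have Z : \int[time_measure T]_t (D n t * (w t - w0)) @[n --> \oo] --> (0 : R).
  apply/cvgrPdist_le => e e0.
  have e4 : 0 < e / 4 by rewrite divr_gt0.
  have [de de0 Hde] := ww0 _ e4.
  pose J := \int[time_measure T]_t `|w t - w0|.
  have J0 : 0 <= J by exact: Rintegral_ge0.
  have J1 : 0 < J + 1 by rewrite ltr_wpDl.
  (* Near [t0] the error is at most [e / 4] times a mass that is eventually at most 2; away from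
     [t0] it is at most [e / 2 / (J + 1)] times [J]. *)
  have := Dsmall de (e / 2 / (J + 1)) de0.
  rewrite !divr_gt0// => /(_ isT) S.
  move/cvgrPdist_le : D1 => /(_ 1 ltr01).
  apply: filterS2 S => n S /= Dn.
  have Dn2 : \int[time_measure T]_t D n t <= 2.
    move: Dn; rewrite ler_norml => /andP[]; lra.
  rewrite sub0r normrN; apply: (le_trans (le_normr_Rintegral measurableT (ID n _ Iww))).
  have Ir : intg (time_measure T) (fun t => e / 4 * D n t + e / 2 / (J + 1) * `|w t - w0|).
    by apply: intgD; apply: intgZ => //; exact: intg_abs.
  apply: (@le_trans _ _ (\int[time_measure T]_t (e / 4 * D n t + e / 2 / (J + 1) * `|w t - w0|))).
    apply: Rint_le_ae => //; first exact/intg_abs/ID.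
    apply: (ae_imp (ae_time T)) => t tT; rewrite normrM ger0_norm//.
    have [tde|tde] := ltP `|t - t0| de.
      rewrite -[leLHS]addr0 lerD//; last by rewrite mulr_ge0// !divr_ge0// ltW.
      by rewrite mulrC ler_wpM2r//; exact: Hde.
    rewrite -[leLHS]add0r lerD//; first by rewrite mulr_ge0// ltW.
    by rewrite ler_wpM2r//; exact: S.
  rewrite RintegralD//; [|exact: intgZ|by apply/intgZ/intg_abs].
  rewrite RintegralZl// RintegralZl; [|by []|exact: intg_abs]; rewrite -/J.
  have : e / 2 / (J + 1) * J <= e / 2.
    by rewrite mulrAC ler_pdivrMr// ler_wpM2l ?lerDl// divr_ge0// ltW.
  have : e / 4 * \int[time_measure T]_t D n t <= e / 4 * 2.
    by rewrite ler_pM2l.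
  lra.
have Dw : \int[time_measure T]_t D n t * w0 @[n --> \oo] --> 1 * w0.
  by apply: cvgMl; exact: D1.
have -> : (fun n => \int[time_measure T]_t (D n t * w t)) =
    (fun n => \int[time_measure T]_t (D n t * (w t - w0)) +
      \int[time_measure T]_t D n t * w0).
  apply/funext => n; rewrite -RintegralZr// -RintegralD//.
  - by apply: eq_Rintegral => t _; rewrite mulrBr subrK.
  - exact: ID.
  - by apply: ID; exact: intg_cst.
have := cvgD Z Dw; rewrite add0r mul1r; exact.
Qed.

End spacetime.

(** * Derivatives of the cutoffs as Dirac masses *)

Section cutoff_derivatives.
Context (R : realType) (T : R).
Hypothesis T0 : 0 < T.

Definition spike (n : nat) (c : R) : R :=
  n.+1%:R * derive1 (@flat_exp R) (n.+1%:R * c + -1).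

Lemma spike_ge0 n c : 0 <= spike n c.
Proof.
rewrite mulr_ge0// flat_exp_derive; case: ifP => // _.
by rewrite mulr_ge0 ?expR_ge0// invr_ge0 sqr_ge0.
Qed.

Lemma spike_small (de e : R) : 0 < de -> 0 < e ->
  \forall n \near \oo, forall c, de <= c -> spike n c <= e.
Proof.
move=> de0 e0.
(* The first summand ensures [u = N * c - 1 >= N * de / 2]. Then the spike is at most
   [N / u ^+ 2 <= 4 / (N * de ^+ 2)], which the second summand makes at most [e]. *)
have [n _ Hn] := nbhs_infty_ger (2 / de + 4 / (de ^+ 2 * e)).
exists n => // k /Hn /= kc c dc.
set N : R := k.+1%:R; have N0 : 0 < N by rewrite ltr0n.
have kN : 2 / de + 4 / (de ^+ 2 * e) <= N.
  by apply: le_trans kc _; rewrite ler_nat.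
have p1 : 0 < 2 / de by rewrite divr_gt0.
have p2 : 0 < 4 / (de ^+ 2 * e) by rewrite divr_gt0// mulr_gt0// exprn_gt0.
have N1 : 2 <= N * de by rewrite -ler_pdivrMr//; lra.
have N2 : 4 <= N * (de ^+ 2 * e).
  by rewrite -ler_pdivrMr; [lra|rewrite mulr_gt0// exprn_gt0].
have u1 : N * de / 2 <= N * c + -1.
  have H1 : N * de <= N * c by rewrite ler_pM2l.
  by lra.
have u0 : 0 < N * c + -1 by lra.
rewrite /spike flat_exp_derive u0 -/N.
set u := N * c + -1 in u0 u1 *.
have E1 : expR (- u^-1) <= 1 by rewrite -expR0 ler_expR oppr_le0 invr_ge0 ltW.
have u2 : 0 < u ^+ 2 by rewrite exprn_gt0.
apply: (@le_trans _ _ (N * (u ^- 2 * 1))).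
  by rewrite ler_pM2l// ler_pM2l// invr_gt0.
rewrite mulr1 ler_pdivrMr//.
apply: (@le_trans _ _ (e * (N * de / 2) ^+ 2)); last first.
  rewrite ler_pM2l//; apply: lerXn2r; rewrite ?nnegrE; [lra|exact: ltW|exact: u1].
have -> : e * (N * de / 2) ^+ 2 = N * (N * (de ^+ 2 * e)) / 4 by field.
by rewrite ler_pdivlMr// ler_pM2l.
Qed.

Lemma derive1_affine (f : R -> R) (c e x : R) : bsmooth f ->
  derive1 (fun x => f (c * x + e)) x = c * derive1 f (c * x + e).
Proof.
move=> bf.
have H := @is_derive1_comp _ f (fun x => c * x + e) x _ _
  (bsmooth_is_derive (c * x + e) bf) (is_derive_affine c e x).
by rewrite mulrC derive1E; exact: (@derive_val _ _ _ _ _ _ _ H).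
Qed.

Lemma derive1_lcut n t : derive1 (@lcut R n) t = spike n t.
Proof. by rewrite /lcut derive1_affine//; exact: bsmooth_flat_exp. Qed.

Lemma derive1_rcut n t : derive1 (rcut T n) t = - spike n (T - t).
Proof.
rewrite /rcut derive1_affine; last exact: bsmooth_flat_exp.
rewrite /spike mulNr; congr (- (_ * _)).
by have -> : - n.+1%:R * t + (n.+1%:R * T - 1) = n.+1%:R * (T - t) + -1 by ring.
Qed.

Lemma Rint_time_FTC (F : R -> R) : bsmooth F ->
  \int[time_measure T]_t (derive1 F t) = F T - F 0.
Proof.
move=> bF.
have cF := bsmooth_continuous (bsmooth_derive bF).
have dF := fun t => bsmooth_is_derive t bF.
rewrite -(Rint_time_itv cF dF (lexx 0) (ltW T0) (lexx T)).
apply: Rint_ae_eq; apply: (ae_imp (ae_time T)) => t tT.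
by rewrite indicE mem_set ?mulr1//= in_itv.
Qed.

Lemma lcut_delta (w : R -> R) w0 : intg (time_measure T) w ->
  (forall e, 0 < e -> exists2 de, 0 < de &
     forall t, 0 < t < T -> `|t - 0| < de -> `|w t - w0| <= e) ->
  \int[time_measure T]_t (derive1 (@lcut R n) t * w t) @[n --> \oo] --> w0.
Proof.
move=> Iw ww0; apply: (approx_delta (t0 := 0)) => //.
- by move=> n; exact/bsmooth_derive/bsmooth_lcut.
- by move=> n t; rewrite derive1_lcut spike_ge0.
- under eq_fun do rewrite (Rint_time_FTC (bsmooth_lcut R _)).
  have l0 n : lcut n (0 : R) = 0 by rewrite /lcut cut_eq0// invr_ge0.
  by under eq_fun do rewrite l0 subr0; exact: lcut_cvg.
move=> de e de0 e0; apply: filterS (spike_small de0 e0) => n H t /andP[t0 _].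
by rewrite subr0 gtr0_norm// derive1_lcut; exact: H.
Qed.

Lemma rcut_delta (w : R -> R) w0 : intg (time_measure T) w ->
  (forall e, 0 < e -> exists2 de, 0 < de &
     forall t, 0 < t < T -> `|t - T| < de -> `|w t - w0| <= e) ->
  \int[time_measure T]_t (derive1 (rcut T n) t * w t) @[n --> \oo] --> - w0.
Proof.
move=> Iw ww0.
have Ib n : bsmooth (fun t => - derive1 (rcut T n) t).
  have := bsmoothM (bsmooth_cst (-1)) (bsmooth_derive (bsmooth_rcut T n)).
  by under eq_fun do rewrite mulN1r.
have H : \int[time_measure T]_t (- derive1 (rcut T n) t * w t) @[n --> \oo] --> w0.
  apply: (approx_delta (t0 := T)) => //.
  - by move=> n t; rewrite derive1_rcut opprK spike_ge0.
  - have E n : \int[time_measure T]_t - derive1 (rcut T n) t = rcut T n 0.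
      under eq_Rintegral do rewrite -mulN1r.
      rewrite RintegralZl//; last first.
        have [M HM] := bsmooth_bounded (bsmooth_derive (bsmooth_rcut T n)).
        apply: (@intg_bounded _ _ _ _ M); last exact: aeW.
        exact: bsmooth_measurable (bsmooth_derive (bsmooth_rcut T n)).
      rewrite Rint_time_FTC; last exact: bsmooth_rcut.
      by rewrite [rcut T n T]rcutE subrr cut_eq0 ?invr_ge0// sub0r mulN1r opprK.
    by under eq_fun do rewrite E; exact: rcut_cvg.
  move=> de e de0 e0; apply: filterS (spike_small de0 e0) => n H t /andP[_ tT].
  rewrite distrC ger0_norm; last by rewrite subr_ge0 ltW.
  by rewrite derive1_rcut opprK; exact: H.
have -> : (fun n => \int[time_measure T]_t (derive1 (rcut T n) t * w t)) =
    (fun n => - \int[time_measure T]_t (- derive1 (rcut T n) t * w t)).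
  apply/funext => n; rewrite -mulN1r -RintegralZl//.
    by apply: eq_Rintegral => t _; rewrite mulN1r mulNr opprK.
  have [M HM] := bsmooth_bounded (Ib n).
  apply: (intg_bounded_mull (M := M)) => //; last exact: aeW.
  exact: bsmooth_measurable.
exact: cvgN H.
Qed.

End cutoff_derivatives.

Section time_by_parts.
Context (R : realType) (d : nat) (T : R).
Hypothesis T0 : 0 < T.
Variables (f g : sfield R d).
Hypotheses (If : intg (stm d T) f) (Ig : intg (stm d T) g).
Hypothesis fg : is_weak_dt T f g.
Hypothesis fC : continuous_L2 T f.
Hypothesis fT : {ae torus_finite R d, forall x, f (T, x) = 0}.
Variables (a : R -> R) (b : 'I_d -> R -> R).
Hypotheses (ba : bsmooth a) (bb : forall i, pbsmooth (b i)).

Let B (x : tpoint R d) : R := \prod_i b i (tnth x i).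

Let bbs i : bsmooth (b i). Proof. by case: (bb i). Qed.

Let mB : measurable_fun setT B.
Proof.
apply: measurable_prod => i _.
apply: (measurableT_comp (bsmooth_measurable (bbs i))).
exact: measurable_tnth.
Qed.

Let B_bounded : exists2 M, 0 <= M & forall x, `|B x| <= M.
Proof.
have [M HM] := bounded_tens (bsmooth_cst 1) bbs.
exists M; first exact: le_trans (HM (0, [tuple 0 | i < d])).
by move=> x; have := HM (0, x); rewrite /tens /= mul1r.
Qed.

Let tensE (c : R -> R) p : tens c b p = c p.1 * B p.2. Proof. by []. Qed.

Let IfB : intg (stm d T) (fun p => f p * B p.2).
Proof.
have [M M0 HM] := B_bounded.
have := intg_bounded_mull (M := M) (measurableT_comp mB measurable_snd) If.
move=> /(_ (aeW _ (fun p => HM p.2))).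
by apply: eq_integrable => // p _; rewrite /= mulrC.
Qed.

Let mom t : R := \int[torus_finite R d]_x (f (t, x) * B x).

Let Imom : intg (time_measure T) mom.
Proof. exact: intg_Rint1 IfB. Qed.

Let IcM (c h : R -> R) : bsmooth c -> intg (time_measure T) h ->
  intg (time_measure T) (fun t => c t * h t).
Proof.
move=> bc Ih; have [M HM] := bsmooth_bounded bc.
apply: (intg_bounded_mull (M := M)) => //; last exact: aeW.
exact: bsmooth_measurable.
Qed.

Let IcS (c : R -> R) (h : sfield R d) : bsmooth c -> intg (stm d T) h ->
  intg (stm d T) (fun p => c p.1 * h p).
Proof.
move=> bc Ih; have [M HM] := bsmooth_bounded bc.
apply: (intg_bounded_mull (M := M)) => //; last exact: aeW.
exact: (measurableT_comp (bsmooth_measurable bc) measurable_fst).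
Qed.

Let mom_near s : 0 <= s <= T -> forall e, 0 < e -> exists2 de, 0 < de &
  forall t, 0 < t < T -> `|t - s| < de -> `|mom t - mom s| <= e.
Proof.
move=> sT e e0; have [M M0 HM] := B_bounded.
(* Weight of Young's inequality: [r * (M ^+ 2 + 1) = e / 2] pays for the integral of [B ^+ 2] over
   the torus of mass 1, and the increment of [f] is then taken with squared norm at most
   [r * (e / 2)]. *)
pose r := e / 2 / (M ^+ 2 + 1).
have M1 : 0 < M ^+ 2 + 1 by rewrite ltr_wpDl// sqr_ge0.
have r0 : 0 < r by rewrite !divr_gt0.
have [L2s /(_ _ sT)] := fC.
move=> /cvgrPdist_le /(_ (r * (e / 2))); rewrite mulr_gt0 ?divr_gt0// => /(_ isT).
rewrite near_withinE => /nbhs_ballP[de /= de0 Hde].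
exists de => // t /andP[t0 tT] tsde.
have tT' : 0 <= t <= T by rewrite !ltW.
have := Hde t; rewrite /ball /= distrC => /(_ tsde).
rewrite in_itv /= tT' => /(_ isT).
rewrite sub0r normrN ger0_norm; last by apply: Rintegral_ge0 => x _; exact: sqr_ge0.
move=> Hint.
have [mt It] := L2_torus_sq (L2s _ tT').
have [ms Is] := L2_torus_sq (L2s _ sT).
have IB : intg (torus_finite R d) (fun x => B x ^+ 2).
  apply: (@intg_bounded _ _ _ _ (M ^+ 2)); first exact: measurable_funX.
  apply: aeW => x; rewrite normrX lerXn2r ?nnegrE//.
have Idsq : intg (torus_finite R d) (fun x => (f (t, x) - f (s, x)) ^+ 2).
  apply: (intg_le _ (intgZ 2 (intgD It Is))).
    by apply: measurable_funX; exact: measurable_funB.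
  apply: aeW => x; rewrite ger0_norm ?sqr_ge0//.
  have : 0 <= (f (t, x) + f (s, x)) ^+ 2 by exact: sqr_ge0.
  by nra.
have md : measurable_fun setT (fun x => f (t, x) - f (s, x)) by exact: measurable_funB.
have ItB := intg_mul mt mB It IB; have IsB := intg_mul ms mB Is IB.
have IdB := intg_mul md mB Idsq IB.
have -> : mom t - mom s = \int[torus_finite R d]_x ((f (t, x) - f (s, x)) * B x).
  rewrite /mom -RintegralB//.
  by apply: eq_Rintegral => x _; rewrite mulrBl.
apply: (le_trans (le_normr_Rintegral measurableT IdB)).
have Ir : intg (torus_finite R d) (fun x => r^-1 * (f (t, x) - f (s, x)) ^+ 2 + r * B x ^+ 2).
  by apply: intgD; exact: intgZ.
apply: (@le_trans _ _ (\int[torus_finite R d]_x (r^-1 * (f (t, x) - f (s, x)) ^+ 2 + r * B x ^+ 2))).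
  apply: le_Rintegral => //; first exact: intg_abs.
  move=> x _; rewrite normrM -(real_normK (num_real (f (t, x) - f (s, x)))).
  rewrite -(real_normK (num_real (B x))).
  set u := `|_ - _|; set v := `|B x|.
  have -> : r^-1 * u ^+ 2 + r * v ^+ 2 = (u * v) * 2 + r^-1 * (r * v - u) ^+ 2.
    by field; rewrite gt_eqF.
  have uv : 0 <= u * v by rewrite /u /v mulr_ge0.
  have : 0 <= r^-1 * (r * v - u) ^+ 2 by rewrite mulr_ge0 ?sqr_ge0// invr_ge0 ltW.
  by lra.
rewrite RintegralD//; [|exact: intgZ|exact: intgZ].
rewrite (RintegralZl r^-1 measurableT Idsq) (RintegralZl r measurableT IB).
have b1 : r^-1 * \int[torus_finite R d]_x (f (t, x) - f (s, x)) ^+ 2 <= e / 2.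
  by rewrite mulrC ler_pdivrMr// mulrC.
have b2 : \int[torus_finite R d]_x (B x ^+ 2) <= M ^+ 2.
  have T1 : torus_finite R d setT = 1%E := probability_setT (torus_measure R d).
  have -> : M ^+ 2 = \int[torus_finite R d]_x (M ^+ 2).
    by rewrite Rintegral_cst// [X in fine X]T1 mulr1.
  apply: le_Rintegral => //; first exact: intg_cst.
  by move=> x _; rewrite -(real_normK (num_real (B x))) lerXn2r// nnegrE.
have b3 : r * (M ^+ 2 + 1) = e / 2 by rewrite /r divfK// gt_eqF.
have : r * \int[torus_finite R d]_x (B x ^+ 2) <= r * (M ^+ 2 + 1).
  by rewrite ler_pM2l//; lra.
lra.
Qed.

Let h p : R := f p * tens (derive1 a) b p + g p * tens a b p.

Let Ih : intg (stm d T) h.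
Proof.
have It (u : sfield R d) (c : R -> R) : intg (stm d T) u -> bsmooth c ->
    intg (stm d T) (fun p => u p * tens c b p).
  move=> Iu bc; have [M HM] := bounded_tens bc bbs.
  have := intg_bounded_mull (M := M) (measurable_tens bc bbs) Iu (aeW _ HM).
  by apply: eq_integrable => // p _; rewrite /= mulrC.
by apply: intgD; apply: It => //; exact: bsmooth_derive.
Qed.

(** The test function is cut off at both ends with independent indices, and the cutoffs are released
    one after the other. At [T] the boundary term disappears because [f (T, _)] does; at 0 the
    derivative of [lcut] converges to a Dirac mass, which leaves [a 0 * mom 0]. *)
Lemma weak_dt_by_parts : \int[stm d T]_p h p = - (a 0 * mom 0).
Proof.
have bl n := bsmooth_lcut R n; have br k := bsmooth_rcut T k.
(* The product rule for [lcut n * (rcut k * a)]: one regular term and one boundary layer at each end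
   of the interval. *)
have id n k : \int[stm d T]_p (rcut T k p.1 * (lcut n p.1 * h p)) +
   \int[time_measure T]_t (rcut T k t * (derive1 (lcut n) t * (a t * mom t))) +
   \int[time_measure T]_t (derive1 (rcut T k) t * (lcut n t * (a t * mom t))) = 0.
  have := fg (test_tens T n k ba bb).
  pose c t := lcut n t * (rcut T k t * a t).
  have bc : bsmooth c by apply: bsmoothM => //; exact: bsmoothM.
  have cE t : derive1 c t = rcut T k t * (lcut n t * derive1 a t) +
     rcut T k t * (derive1 (lcut n) t * a t) + derive1 (rcut T k) t * (lcut n t * a t).
    have H := is_deriveM (bsmooth_is_derive t (bl n))
      (is_deriveM (bsmooth_is_derive t (br k)) (bsmooth_is_derive t ba)).
    rewrite derive1E (@derive_val _ _ _ _ _ _ _ H) /GRing.scale /= !fctE; ring.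
  rewrite -/c dt_tens// => /eqP; rewrite -subr_eq0 opprK => /eqP.
  have bounded_int (u : sfield R d) (e : R -> R) : intg (stm d T) u -> bsmooth e ->
      intg (stm d T) (fun p => u p * tens e b p).
    move=> Iu be; have [M HM] := bounded_tens be bbs.
    have := intg_bounded_mull (M := M) (measurable_tens be bbs) Iu (aeW _ HM).
    by apply: eq_integrable => // p _; rewrite /= mulrC.
  rewrite -RintegralD//; [|exact/bounded_int/bsmooth_derive|exact: bounded_int].
  (* The section of [f] at time [t] is known to be integrable only for almost every [t], so the
     factor [e t] leaves the inner integral almost everywhere. *)
  have fub (e : R -> R) : bsmooth e ->
      \int[time_measure T]_t (e t * mom t) = \int[stm d T]_p (e p.1 * (f p * B p.2)) .
    move=> be; rewrite [RHS](Rint_fubini (m1 := time_measure T) (m2 := torus_finite R d)); last exact: IcS.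
    apply: Rint_ae_eq; apply: (ae_imp (m := time_measure T)
      (ae_integrable1 (m1 := time_measure T) (m2 := torus_finite R d) IfB)) => t It /=.
    by rewrite -RintegralZl.
  have I1 : intg (time_measure T) (fun t => rcut T k t * (derive1 (lcut n) t * (a t * mom t))).
    exact: IcM (br k) (IcM (bsmooth_derive (bl n)) (IcM ba Imom)).
  have I2 : intg (time_measure T) (fun t => derive1 (rcut T k) t * (lcut n t * (a t * mom t))).
    exact: IcM (bsmooth_derive (br k)) (IcM (bl n) (IcM ba Imom)).
  have b1 : bsmooth (fun t => rcut T k t * (derive1 (lcut n) t * a t)).
    exact: bsmoothM (br k) (bsmoothM (bsmooth_derive (bl n)) ba).
  have b2 : bsmooth (fun t => derive1 (rcut T k) t * (lcut n t * a t)).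
    exact: bsmoothM (bsmooth_derive (br k)) (bsmoothM (bl n) ba).
  move=> <-.
  have -> : \int[time_measure T]_t (rcut T k t * (derive1 (lcut n) t * (a t * mom t))) =
      \int[stm d T]_p (rcut T k p.1 * (derive1 (lcut n) p.1 * a p.1) * (f p * B p.2)).
    by rewrite -(fub _ b1); apply: eq_Rintegral => t _; rewrite !mulrA.
  have -> : \int[time_measure T]_t (derive1 (rcut T k) t * (lcut n t * (a t * mom t))) =
      \int[stm d T]_p (derive1 (rcut T k) p.1 * (lcut n p.1 * a p.1) * (f p * B p.2)).
    by rewrite -(fub _ b2); apply: eq_Rintegral => t _; rewrite !mulrA.
  have J1 : intg (stm d T) (fun p => rcut T k p.1 * (lcut n p.1 * h p)) by exact: IcS (br k) (IcS (bl n) Ih).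
  rewrite -RintegralD//; last exact: IcS b1 IfB.
  rewrite -RintegralD//; [|by apply: intgD => //; exact: IcS b1 IfB|exact: IcS b2 IfB].
  by apply: eq_Rintegral => p _; rewrite /h !tensE cE /c; ring.
have step1 n : \int[stm d T]_p (lcut n p.1 * h p) +
   \int[time_measure T]_t (derive1 (lcut n) t * (a t * mom t)) = 0.
  have c1 : \int[stm d T]_p (rcut T k p.1 * (lcut n p.1 * h p)) @[k --> \oo] -->
      \int[stm d T]_p (lcut n p.1 * h p).
    have J : intg (stm d T) (fun p => lcut n p.1 * h p) by exact: IcS.
    apply: (Rint_dct _ (intg_measurable J) (intg_abs J)).
    + by move=> k; exact: intg_measurable (IcS (br k) J).
    + apply: (ae_imp (ae_fst (torus_finite R d) (ae_time T))) => p /andP[_ pT].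
      rewrite -[X in _ --> X]mul1r; apply: cvgMl; exact: rcut_cvg.
    + move=> k; apply: aeW => p; rewrite normrM ler_piMl//.
      by have [] := cut_bound T k p.1.
  have c2 : \int[time_measure T]_t (rcut T k t * (derive1 (lcut n) t * (a t * mom t))) @[k --> \oo] -->
      \int[time_measure T]_t (derive1 (lcut n) t * (a t * mom t)).
    have J : intg (time_measure T) (fun t => derive1 (lcut n) t * (a t * mom t)).
      exact: IcM (bsmooth_derive (bl n)) (IcM ba Imom).
    apply: (Rint_dct _ (intg_measurable J) (intg_abs J)).
    + by move=> k; exact: intg_measurable (IcM (br k) J).
    + apply: (ae_imp (ae_time T)) => p /andP[_ pT].
      rewrite -[X in _ --> X]mul1r; apply: cvgMl; exact: rcut_cvg.
    + move=> k; apply: aeW => p; rewrite normrM ler_piMl//.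
      by have [] := cut_bound T k p.
  (* The layer at [T] sees the limit of [lcut n t * (a t * mom t)] at [T]. It is 0 because [mom] is
     continuous there with [mom T = 0] and the other factors are bounded. *)
  have c3 : \int[time_measure T]_t (derive1 (rcut T k) t * (lcut n t * (a t * mom t))) @[k --> \oo] --> - (0 : R).
    apply: rcut_delta => //; first exact: IcM (bl n) (IcM ba Imom).
    move=> e e0; have [M HM] := bsmooth_bounded ba.
    have M1 : 0 < `|M| + 1 by rewrite ltr_wpDl.
    have sT : 0 <= T <= T by rewrite lexx ltW.
    have eM : 0 < e / (`|M| + 1) by rewrite divr_gt0.
    have [de de0 Hde] := mom_near sT eM.
    exists de => // t tT tde; rewrite subr0 !normrM.
    have momT : mom T = 0.
      rewrite /mom -[RHS](_ : \int[torus_finite R d]_x 0 = 0); last by rewrite Rintegral_cst// mul0r.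
      by apply: Rint_ae_eq; apply: (ae_imp fT) => x ->; rewrite mul0r.
    have := Hde t tT tde; rewrite momT subr0 => Hm.
    have [l1 _] := cut_bound T n t.
    apply: (@le_trans _ _ (1 * ((`|M| + 1) * (e / (`|M| + 1))))).
      apply: ler_pM => //; apply: ler_pM => //.
      by rewrite (le_trans (HM t))// (le_trans (ler_norm _))// lerDl.
    by rewrite mul1r mulrC divfK// gt_eqF.
  have := cvgD (cvgD c1 c2) c3.
  rewrite (_ : (_ + _ : nat -> R) = fun=> 0).
    by rewrite subr0 => H; have := cvg_unique _ (cvg_cst _) (H _ _) => <-.
  by apply/funext => k; rewrite !fctE id.
have c1 : \int[stm d T]_p (lcut n p.1 * h p) @[n --> \oo] --> \int[stm d T]_p h p.
  apply: (Rint_dct _ (intg_measurable Ih) (intg_abs Ih)).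
  + by move=> k; exact: intg_measurable (IcS (bl k) Ih).
  + apply: (ae_imp (ae_fst (torus_finite R d) (ae_time T))) => p /andP[p0 _].
    rewrite -[X in _ --> X]mul1r; apply: cvgMl; exact: lcut_cvg.
  + move=> k; apply: aeW => p; rewrite normrM ler_piMl//.
    by have [] := cut_bound T k p.1.
have c2 : \int[time_measure T]_t (derive1 (@lcut R n) t * (a t * mom t)) @[n --> \oo] --> a 0 * mom 0.
  apply: lcut_delta => //; first exact: IcM.
  move=> e e0; have [M HM] := bsmooth_bounded ba.
  have M1 : 0 < `|M| + 1 by rewrite ltr_wpDl.
  have m1 : 0 < `|mom 0| + 1 by rewrite ltr_wpDl.
  have s0 : 0 <= (0 : R) <= T by rewrite lexx ltW.
  have eM : 0 < e / 2 / (`|M| + 1) by rewrite !divr_gt0.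
  have [de de0 Hde] := mom_near s0 eM.
  have /cvgrPdist_le /(_ (e / 2 / (`|mom 0| + 1))) := @bsmooth_continuous _ _ ba (0 : R).
  rewrite !divr_gt0// => /(_ isT) /nbhs_ballP[ee /= ee0 Hee].
  exists (Num.min de ee); first by rewrite lt_min de0.
  move=> t tT; rewrite lt_min => /andP[tde tee].
  have Hm := Hde t tT tde.
  have Ha : `|a 0 - a t| <= e / 2 / (`|mom 0| + 1).
    by apply: Hee; rewrite /ball /= distrC.
  have -> : a t * mom t - a 0 * mom 0 = a t * (mom t - mom 0) - (a 0 - a t) * mom 0 by ring.
  apply: (le_trans (ler_normB _ _)); rewrite !normrM.
  have e1 : (`|M| + 1) * (e / 2 / (`|M| + 1)) = e / 2.
    by rewrite mulrC divfK// gt_eqF.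
  have e2 : e / 2 / (`|mom 0| + 1) * (`|mom 0| + 1) = e / 2.
    by rewrite divfK// gt_eqF.
  have B1 : `|a t| * `|mom t - mom 0| <= e / 2.
    rewrite -e1.
    apply: ler_pM => //.
    by rewrite (le_trans (HM t))// (le_trans (ler_norm _))// lerDl.
  have B2 : `|a 0 - a t| * `|mom 0| <= e / 2.
    by rewrite -e2; apply: ler_pM => //; rewrite lerDl.
  by lra.
have c12 : \int[stm d T]_p (lcut n p.1 * h p) +
    \int[time_measure T]_t (derive1 (@lcut R n) t * (a t * mom t)) @[n --> \oo] -->
    \int[stm d T]_p h p + a 0 * mom 0 by exact: cvgD c1 c2.
have H : (0 : R) @[n --> \oo] --> \int[stm d T]_p h p + a 0 * mom 0.
  by move: c12; under eq_fun do rewrite step1.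
by apply/eqP; rewrite -addr_eq0 -(cvg_unique _ (cvg_cst _) H).
Qed.

End time_by_parts.

(** * Mollification of weak derivatives *)

Section kernel_derivatives.
Context (R : realType).
Implicit Types (w sgn : R).

(* Moving the derivative to the other variable flips the parity. *)
Lemma derive1_ekernel w sgn M (t s : R) :
  derive1 (fun t => ekernel w sgn M t s) t =
  - derive1 (fun s => ekernel w (- sgn) M t s) s.
Proof.
have bc : bsmooth (ckernel w M).
  have := separable_slice2 (@bsmooth_closed R) 0 (separable_ckernelB w M).
  by under eq_fun do rewrite subr0.
have D1 := is_derive_shift (- s) t (fun t => bsmooth_is_derive t bc).
have D2 := is_derive_shift s t (fun t => bsmooth_is_derive t bc).
have E1 : derive1 (fun t => ekernel w sgn M t s) t =
    derive1 (ckernel w M) (t - s) + sgn * derive1 (ckernel w M) (t + s).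
  have H := is_deriveD D1 (is_deriveZ sgn D2).
  by rewrite derive1E; exact: (@derive_val _ _ _ _ _ _ _ H).
have D3 : is_derive s 1 (fun s => ckernel w M (t - s)) (- derive1 (ckernel w M) (t - s)).
  have H := @is_derive1_comp _ (ckernel w M) (fun s => -1 * s + t) s _ _
    (bsmooth_is_derive (-1 * s + t) bc) (is_derive_affine (-1) t s).
  have -> : (fun s => ckernel w M (t - s)) = ckernel w M \o (fun s => -1 * s + t).
    by apply/funext => v /=; congr ckernel; ring.
  by apply: is_derive_eq H _; rewrite mulrN1 mulN1r addrC.
have D4 := is_derive_shift t s (fun t => bsmooth_is_derive t bc).
have E2 : derive1 (fun s => ekernel w (- sgn) M t s) s =
    - derive1 (ckernel w M) (t - s) + (- sgn) * derive1 (ckernel w M) (s + t).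
  have H := is_deriveD D3 (is_deriveZ (- sgn) D4).
  have -> : (fun s => ekernel w (- sgn) M t s) =
     (fun s => ckernel w M (t - s)) + (- sgn) \*: (fun s => ckernel w M (s + t)).
    by apply/funext => v; rewrite /ekernel !fctE (addrC t v).
  by rewrite derive1E; exact: (@derive_val _ _ _ _ _ _ _ H).
by rewrite E1 E2 (addrC s t); ring.
Qed.

End kernel_derivatives.

Section spacetime_kernel.
Context (R : realType) (d : nat) (T : R).
Hypothesis T0 : 0 < T.
Implicit Types (f g h : sfield R d) (sgn : R) (p q : spacetime R d).

Definition time_kernel sgn N : R -> R -> R := ekernel (pi / (2 * T)) sgn N.*2.+1.

Definition stk sgn N : spacetime R d -> spacetime R d -> R :=
  tensk (time_kernel sgn N) (@circle_kernel R N).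

Let w0 : 0 < pi / (2 * T) :> R.
Proof. by rewrite divr_gt0 ?pi_gt0// mulr_gt0. Qed.

Let quarterE : quarter (pi / (2 * T)) = T.
Proof.
have H (c : R) : 0 < c -> c / 2 / (c / (2 * T)) = T.
  by move=> c0; field; rewrite !gt_eqF.
exact: H (pi_gt0 R).
Qed.

Lemma time_kernelT s N : time_kernel 1 N T s = 0.
Proof.
rewrite /time_kernel /ekernel mul1r.
have := ckernel_refl w0 N.*2.+1 (T - s); rewrite quarterE.
have -> : 2 * T - (T - s) = T + s by ring.
by move=> ->; rewrite exprS mulN1r -signr_odd odd_double expr0 mulN1r subrr.
Qed.

Lemma time_kernel0 t N : time_kernel (-1) N t 0 = 0.
Proof. by rewrite /time_kernel /ekernel subr0 addr0 mulN1r subrr. Qed.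

Definition st_boxes : set (set (spacetime R d)) := rectangles (@rays R) (@boxes R d).

Lemma st_boxes_setI : setI_closed st_boxes.
Proof. by apply: rectangles_setI; [exact: rays_setI|exact: boxes_setI]. Qed.

Lemma st_boxes_setT : st_boxes setT.
Proof. by apply: rectangles_setT; [left|exact: boxes_setT]. Qed.

Lemma st_boxes_generate : @measurable _ (spacetime R d) = <<s st_boxes >>.
Proof.
apply: rectangles_generate; [by left|exact: boxes_setT|exact: rays_generate|].
exact: boxes_generate.
Qed.

Lemma approx_id_st sgn : `|sgn| <= 1 ->
  approx_id (stm d T) st_boxes (stk sgn) (4 * 4 ^+ d).
Proof.
move=> s1.
have E : approx_id (time_measure T) (@rays R) (time_kernel sgn) 4.
  have Ms N : (N <= N.*2.+1)%N by rewrite -addnn leqW// leq_addr.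
  apply: (approx_id_ekernel T0 w0 s1 Ms).
  by right; split=> [|N]; rewrite ?quarterE//= odd_double.
exact: approx_id_prod (@rays_measurable R) (@boxes_measurable R d) E (@approx_id_torus R d).
Qed.

Let sT sgn N := separable_ekernel (pi / (2 * T)) sgn N.*2.+1.
Let sC N := separable_circle_kernel R N.

Lemma bsmooth_time_kernel sgn N t : bsmooth (time_kernel sgn N t).
Proof. exact: (separable_slice1 (@bsmooth_closed R) t (sT sgn N)). Qed.

Lemma bsmooth_time_kernel2 sgn N s : bsmooth (time_kernel sgn N ^~ s).
Proof. exact: (separable_slice2 (@bsmooth_closed R) s (sT sgn N)). Qed.

Lemma pbsmooth_circle_kernel N x : pbsmooth (@circle_kernel R N x).
Proof. exact: (separable_slice1 (@pbsmooth_closed R) x (sC N)). Qed.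

Lemma pbsmooth_circle_kernel2 N y : pbsmooth (@circle_kernel R N ^~ y).
Proof. exact: (separable_slice2 (@pbsmooth_closed R) y (sC N)). Qed.

Let bT := bsmooth_time_kernel.
Let bT2 := bsmooth_time_kernel2.
Let bC := pbsmooth_circle_kernel.
Let bC2 := pbsmooth_circle_kernel2.

Lemma stk_slice sgn N p : stk sgn N p =
  tens (time_kernel sgn N p.1) (fun i => circle_kernel N (tnth p.2 i)).
Proof. by []. Qed.

Lemma stk_slice2 sgn N q : (stk sgn N ^~ q) =
  tens (time_kernel sgn N ^~ q.1) (fun i => circle_kernel N ^~ (tnth q.2 i)).
Proof. by []. Qed.

Lemma dt_stk sgn N p q :
  dt (stk sgn N ^~ q) p = - dt (stk (- sgn) N p) q.
Proof.
rewrite stk_slice2 stk_slice !dt_tens// /tens -mulNr; congr (_ * _).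
exact: derive1_ekernel.
Qed.

(** Unlike [dt_stk] this keeps the kernel: circle kernels have [sgn = 0], which is its own
    opposite. *)
Lemma dx_stk sgn N i p q :
  dx i (stk sgn N ^~ q) p = - dx i (stk sgn N p) q.
Proof.
rewrite stk_slice2 stk_slice !dx_tens; [|by case: (bC N (tnth p.2 i))|by case: (bC2 N (tnth q.2 i))].
rewrite /tens -mulrN; congr (_ * _).
rewrite (bigD1 i)//= [in RHS](bigD1 i)//= -mulNr /dupd eqxx; congr (_ * _).
  by rewrite /circle_kernel derive1_ekernel oppr0.
by apply: eq_bigr => j /negbTE ->.
Qed.

Definition mollify sgn N f p : R := conv (stm d T) (time_kernel sgn N) (@circle_kernel R N) f p.

Lemma mollifyE sgn N f p : mollify sgn N f p = \int[stm d T]_q (stk sgn N p q * f q).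
Proof. by []. Qed.

Lemma mollify_smooth sgn N f : intg (stm d T) f -> [/\ smooth (mollify sgn N f),
  measurable_fun setT (mollify sgn N f) /\ (exists M, forall p, `|mollify sgn N f p| <= M),
  forall x, bsmooth (fun t => mollify sgn N f (t, x)),
  forall p, dt (mollify sgn N f) p = \int[stm d T]_q (- dt (stk (- sgn) N p) q * f q) &
  forall i p, dx i (mollify sgn N f) p = \int[stm d T]_q (- dx i (stk sgn N p) q * f q)].
Proof.
move=> If; have [H1 H2 H3 H4 H5] := conv_smooth (sT sgn N) (sC N) If.
split => // [p|i p].
  by rewrite /mollify H4; apply: eq_Rintegral => q _; rewrite -dt_stk.
by rewrite /mollify H5; apply: eq_Rintegral => q _; rewrite -dx_stk.
Qed.

Lemma mollifyT N f x : mollify 1 N f (T, x) = 0.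
Proof.
rewrite mollifyE; under eq_Rintegral do rewrite /stk /tensk time_kernelT !mul0r.
by rewrite Rintegral_cst// mul0r.
Qed.

Lemma mollify_pairing sgn N h f : `|sgn| <= 1 -> intg (stm d T) h -> intg (stm d T) f ->
  \int[stm d T]_p (h p * mollify sgn N f p) = pairing (stm d T) (stk sgn N) h f.
Proof.
move=> s1 Ih If; rewrite (pairing1 _ _ Ih If)//.
  exact: approx_id_meas (approx_id_st s1) N.
exact: approx_id_bnd (approx_id_st s1) N.
Qed.

Lemma mollify_cvg_sq sgn h f : `|sgn| <= 1 ->
  measurable_fun setT h -> measurable_fun setT f ->
  intg (stm d T) (fun p => h p ^+ 2) -> intg (stm d T) (fun p => f p ^+ 2) ->
  \int[stm d T]_p (h p * mollify sgn N f p) @[N --> \oo] --> \int[stm d T]_p (h p * f p).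
Proof.
move=> s1 mh mf Ih If.
under eq_fun do rewrite (mollify_pairing _ s1 (intg_of_sq mh Ih) (intg_of_sq mf If)).
exact: (pairing_cvg_sq st_boxes_setI st_boxes_setT st_boxes_generate (approx_id_st s1)).
Qed.

Lemma mollify_cvg_bounded sgn h f M : `|sgn| <= 1 ->
  intg (stm d T) h -> measurable_fun setT f -> 0 <= M ->
  {ae stm d T, forall p, `|f p| <= M} ->
  \int[stm d T]_p (h p * mollify sgn N f p) @[N --> \oo] --> \int[stm d T]_p (h p * f p).
Proof.
move=> s1 Ih mf M0 fM.
under eq_fun do rewrite (mollify_pairing _ s1 Ih (intg_bounded mf fM)).
exact: (pairing_cvg_bounded st_boxes_setI st_boxes_setT st_boxes_generate (approx_id_st s1) mf fM M0).
Qed.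

End spacetime_kernel.

(** * Weak identities tested with kernel sections *)

Section tested_identities.
Context (R : realType) (d : nat) (T : R).
Hypothesis T0 : 0 < T.
Implicit Types (f g h : sfield R d) (a : R -> R) (b : 'I_d -> R -> R).

Lemma intg_tens f a b : intg (stm d T) f -> bsmooth a -> (forall i, bsmooth (b i)) ->
  intg (stm d T) (fun p => f p * tens a b p).
Proof.
move=> If ba bb; have [M HM] := bounded_tens ba bb.
have := intg_bounded_mull (M := M) (measurable_tens ba bb) If (aeW _ HM).
by apply: eq_integrable => // p _; rewrite /= mulrC.
Qed.

Lemma intg_dx_tens f a b i : intg (stm d T) f -> bsmooth a ->
  (forall j, bsmooth (b j)) -> intg (stm d T) (fun p => f p * dx i (tens a b) p).
Proof.
by move=> If ba bb; rewrite dx_tens//; apply: intg_tens => //; exact: bsmooth_dupd.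
Qed.

Definition cut a n : R -> R := fun t => lcut n t * (rcut T n t * a t).

Lemma cut_tens a b n p : tens (cut a n) b p = lcut n p.1 * rcut T n p.1 * tens a b p.
Proof. by rewrite /tens /cut !mulrA. Qed.

Lemma dx_cut_tens a b n i p : bsmooth (b i) ->
  dx i (tens (cut a n) b) p = lcut n p.1 * rcut T n p.1 * dx i (tens a b) p.
Proof. by move=> bb; rewrite !dx_tens// cut_tens. Qed.

Section tested.
Variables (a : R -> R) (b : 'I_d -> R -> R).
Hypotheses (ba : bsmooth a) (bb : forall i, pbsmooth (b i)).

Let bbs i : bsmooth (b i). Proof. by case: (bb i). Qed.

Lemma weak_dx_tens i f g : intg (stm d T) f -> intg (stm d T) g ->
  is_weak_dx T i f g ->
  \int[stm d T]_p (f p * dx i (tens a b) p) = - \int[stm d T]_p (g p * tens a b p).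
Proof.
move=> If Ig fg; apply/eqP; rewrite -addr_eq0 -RintegralD//; last 2 first.
- exact: intg_dx_tens.
- exact: intg_tens.
apply/eqP/cut_limit => //.
  by apply: intgD; [exact: intg_dx_tens|exact: intg_tens].
move=> n; have bc : bsmooth (cut a n).
  by apply: bsmoothM (bsmooth_lcut R n) (bsmoothM (bsmooth_rcut T n) ba).
have := fg _ (test_tens T n n ba bb); rewrite -/(cut a n) => /eqP.
rewrite -addr_eq0 -RintegralD//; [|exact: intg_dx_tens|exact: intg_tens].
move=> /eqP <-; apply: eq_Rintegral => p _.
by rewrite dx_cut_tens// cut_tens; ring.
Qed.

Lemma weak_symgrad_tens i j (lam : vfield R d) g :
  (forall i, intg (stm d T) (lam i)) -> intg (stm d T) g ->
  is_weak_symgrad T lam i j g ->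
  \int[stm d T]_p (2^-1 * (lam j p * dx i (tens a b) p + lam i p * dx j (tens a b) p)) =
  - \int[stm d T]_p (g p * tens a b p).
Proof.
move=> Il Ig lg; have Is a' : bsmooth a' -> intg (stm d T) (fun p =>
    2^-1 * (lam j p * dx i (tens a' b) p + lam i p * dx j (tens a' b) p)).
  by move=> ba'; apply: intgZ; apply: intgD; exact: intg_dx_tens.
apply/eqP; rewrite -addr_eq0 -RintegralD//; [|exact: Is|exact: intg_tens].
apply/eqP/cut_limit => //.
  by apply: intgD; [exact: Is|exact: intg_tens].
move=> n; have bc : bsmooth (cut a n).
  by apply: bsmoothM (bsmooth_lcut R n) (bsmoothM (bsmooth_rcut T n) ba).
have := lg _ (test_tens T n n ba bb); rewrite -/(cut a n) => /eqP.
rewrite -addr_eq0 -RintegralD//; [|exact: Is|exact: intg_tens].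
move=> /eqP <-; apply: eq_Rintegral => p _.
by rewrite !dx_cut_tens// cut_tens; ring.
Qed.

Lemma weak_divfree_tens (lam : vfield R d) : (forall i, intg (stm d T) (lam i)) ->
  weak_divfree T lam -> \int[stm d T]_p (\sum_i lam i p * dx i (tens a b) p) = 0.
Proof.
move=> Il lg; apply: cut_limit => //.
  by apply: intg_sum => i; exact: intg_dx_tens.
move=> n; rewrite -[RHS](lg _ (test_tens T n n ba bb)) -/(cut a n).
apply: eq_Rintegral => p _; rewrite mulr_sumr; apply: eq_bigr => i _.
by rewrite dx_cut_tens//; ring.
Qed.

Lemma weak_zero_tens h : intg (stm d T) h ->
  (forall phi, test_function T phi -> \int[stm d T]_p (h p * phi p) = 0) ->
  \int[stm d T]_p (h p * tens a b p) = 0.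
Proof.
move=> Ih h0; apply: cut_limit => //; first exact: intg_tens.
move=> n; rewrite -[RHS](h0 _ (test_tens T n n ba bb)) -/(cut a n).
by apply: eq_Rintegral => p _; rewrite cut_tens; ring.
Qed.

End tested.

Let bT sgn N t := @bsmooth_time_kernel R T sgn N t.
Let bC (N : nat) (p : spacetime R d) (i : 'I_d) := pbsmooth_circle_kernel N (tnth p.2 i).

Let intg_dx_stk sgn N p i f : intg (stm d T) f ->
  intg (stm d T) (fun q => f q * dx i (stk T sgn N p) q).
Proof.
by move=> If; exact: (intg_dx_tens i If (bT sgn N p.1) (fun j => (bC N p j).1)).
Qed.

(** The fundamental lemma of the calculus of variations: kernel sections are limits of test
    functions through the cutoffs, so every average of [h] vanishes and [approx_id_eq0] applies. *)
Lemma weak_zero h : measurable_fun setT h -> intg (stm d T) (fun p => h p ^+ 2) ->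
  (forall phi, test_function T phi -> \int[stm d T]_p (h p * phi p) = 0) ->
  {ae stm d T, forall p, h p = 0}.
Proof.
move=> mh Ih h0; have s1 : `|1 : R| <= 1 by rewrite normr1.
have KP := @approx_id_st R d T T0 1 s1.
apply: (@approx_id_eq0 _ _ _ (stm d T) _ _ _ (@st_boxes_setI R d)
  (@st_boxes_setT R d) (@st_boxes_generate R d) KP h mh Ih) => N p.
rewrite -[RHS](weak_zero_tens (bT 1 N p.1) (bC N p) (intg_of_sq mh Ih) h0).
by apply: eq_Rintegral => q _; rewrite mulrC.
Qed.

Lemma dx_mollify sgn N i f g p : intg (stm d T) f -> intg (stm d T) g ->
  is_weak_dx T i f g -> dx i (mollify T sgn N f) p = mollify T sgn N g p.
Proof.
move=> If Ig fg; have [_ _ _ _ ->] := mollify_smooth sgn N If.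
rewrite (_ : (fun _ => _) = fun q => -1 * (f q * dx i (stk T sgn N p) q)); last first.
  by apply/funext => q; ring.
rewrite RintegralZl//; last exact: intg_dx_stk.
rewrite (weak_dx_tens (bT sgn N p.1) (bC N p) If Ig fg) mulN1r opprK.
by apply: eq_Rintegral => q _; rewrite mulrC.
Qed.

(** Only the symmetric combination of derivatives is known to be a function, so the two integrals
    are merged before the weak identity is used. The factor [- 2] below collects the sign from
    moving the derivative and the [2^-1] of the symmetric gradient. *)
Lemma symgrad_mollify sgn N i j (lam : vfield R d) g p :
  (forall i, intg (stm d T) (lam i)) -> intg (stm d T) g ->
  is_weak_symgrad T lam i j g ->
  dx i (mollify T sgn N (lam j)) p + dx j (mollify T sgn N (lam i)) p =
  2 * mollify T sgn N g p.
Proof.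
move=> Il Ig lg.
have [_ _ _ _ ->] := mollify_smooth sgn N (Il i).
have [_ _ _ _ ->] := mollify_smooth sgn N (Il j).
have Id k l : intg (stm d T) (fun q => - dx l (stk T sgn N p) q * lam k q).
  have : intg (stm d T) (fun q => lam k q * dx l (stk T sgn N p) q).
    exact: intg_dx_stk.
  move/intgN; apply: eq_integrable => // q _ /=; congr EFin.
  by rewrite mulrC mulNr.
rewrite -RintegralD//.
rewrite (_ : (fun _ => _) = fun q => - 2 * (2^-1 * (lam j q * dx i (stk T sgn N p) q +
   lam i q * dx j (stk T sgn N p) q))); last first.
  by apply/funext => q; field.
rewrite RintegralZl//; last first.
  by apply/intgZ/intgD; exact: intg_dx_stk.
rewrite (weak_symgrad_tens (bT sgn N p.1) (bC N p) Il Ig lg) mulrNN; congr (_ * _).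
by apply: eq_Rintegral => q _; rewrite mulrC.
Qed.

Lemma div_mollify sgn N (lam : vfield R d) p :
  (forall i, intg (stm d T) (lam i)) -> weak_divfree T lam ->
  \sum_i dx i (mollify T sgn N (lam i)) p = 0.
Proof.
move=> Il lg.
rewrite (eq_bigr (fun i => \int[stm d T]_q (- (lam i q * dx i (stk T sgn N p) q)))); last first.
  move=> i _; have [_ _ _ _ ->] := mollify_smooth sgn N (Il i).
  by apply: eq_Rintegral => q _; ring.
rewrite -Rint_sum; last first.
  by move=> i; apply: intgN; exact: intg_dx_stk.
rewrite (_ : (fun _ => _) = fun q => -1 * \sum_i lam i q * dx i (stk T sgn N p) q); last first.
  by apply/funext => q; rewrite sumrN mulN1r.
rewrite RintegralZl//; last first.
  by apply: intg_sum => i; exact: intg_dx_stk.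
by rewrite (weak_divfree_tens (bT sgn N p.1) (bC N p) Il lg) mulr0.
Qed.

End tested_identities.

(** * Initial traces *)

Section traces.
Context (R : realType) (d : nat) (T : R).
Hypothesis T0 : 0 < T.
Implicit Types (f g h : sfield R d) (W : tpoint R d -> R).

Lemma time_total : fine (time_measure T setT) = T.
Proof.
rewrite /time_measure /= /mfrestr /mrestr setTI.
by rewrite lebesgue_measure_itv /= lte_fin T0 -EFinB subr0.
Qed.

(** Cauchy-Schwarz against the constant 1, read off from the nonnegative integral of
    [(T * u t - A) ^+ 2]. *)
Lemma sq_Rint_le (u : measurableTypeR R -> R) : measurable_fun setT u ->
  intg (time_measure T) (fun t => u t ^+ 2) ->
  (\int[time_measure T]_t u t) ^+ 2 <= T * \int[time_measure T]_t (u t ^+ 2).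
Proof.
move=> mu Iu; have Iu1 := intg_of_sq mu Iu.
set A := \int[time_measure T]_t u t; set B := \int[time_measure T]_t (u t ^+ 2).
have H : 0 <= \int[time_measure T]_t ((T * u t - A) ^+ 2).
  by apply: Rintegral_ge0 => t _; exact: sqr_ge0.
have E : \int[time_measure T]_t ((T * u t - A) ^+ 2) =
   T ^+ 2 * B - 2 * T * A * A + A ^+ 2 * T.
  rewrite (_ : (fun _ => _) = fun t => (T ^+ 2 * u t ^+ 2 - 2 * T * A * u t) + A ^+ 2); last first.
    by apply/funext => t; ring.
  rewrite RintegralD//; [|by apply: intgB; exact: intgZ|exact: intg_cst].
  rewrite RintegralB//; [|exact: intgZ|exact: intgZ].
  rewrite (RintegralZl (T ^+ 2) measurableT Iu) (RintegralZl (2 * T * A) measurableT Iu1).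
  by rewrite Rintegral_cst// time_total.
have : 0 <= T * (T * B - A ^+ 2) by move: H; rewrite E; lra.
by rewrite pmulr_rge0// subr_ge0.
Qed.

Section primitive.
Variables (f g : sfield R d).
Hypotheses (mf : measurable_fun setT f) (mg : measurable_fun setT g).
Hypotheses (If : intg (stm d T) (fun p => f p ^+ 2)) (Ig : intg (stm d T) (fun p => g p ^+ 2)).
Hypothesis fg : is_weak_dt T f g.
Hypothesis fC : continuous_L2 T f.
Hypothesis fT : {ae torus_finite R d, forall x, f (T, x) = 0}.

Let If1 := intg_of_sq mf If.
Let Ig1 := intg_of_sq mg Ig.

Lemma dt_mollify N p : dt (mollify T 1 N f) p = mollify T (-1) N g p.
Proof.
have [_ _ _ -> _] := mollify_smooth 1 N If1.
have bT := bsmooth_time_kernel T (-1) N p.1.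
have bC (i : 'I_d) := pbsmooth_circle_kernel N (tnth p.2 i).
have := weak_dt_by_parts T0 If1 Ig1 fg fC fT bT bC.
rewrite /= time_kernel0 mul0r oppr0 -dt_tens//.
rewrite RintegralD//; last 2 first.
- rewrite dt_tens//; apply: intg_tens => //; first exact: bsmooth_derive.
  by move=> i; case: (bC i).
- by apply: intg_tens => // i; case: (bC i).
move=> /eqP; rewrite addrC addr_eq0 => /eqP H.
rewrite mollifyE -[RHS](_ : \int[stm d T]_q (g q * stk T (-1) N p q) = _); last first.
  by apply: eq_Rintegral => q _; rewrite mulrC.
rewrite [RHS]H -[RHS]mulN1r -RintegralZl//; last first.
  rewrite dt_tens//; apply: intg_tens => //; first exact: bsmooth_derive.
  by move=> i; case: (bC i).
by apply: eq_Rintegral => q _; rewrite mulN1r mulNr mulrC.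
Qed.

(** Since [f (T, _)] vanishes, [f (0, _)] is minus the time integral of its derivative. Integration
    by parts with time factor 1 and a torus kernel section in space shows that all averages of the
    left-hand side vanish; [sq_Rint_le] supplies the square integrability that [approx_id_eq0] asks
    for. *)
Lemma trace_ae : {ae torus_finite R d, forall x,
  f (0, x) + \int[time_measure T]_t g (t, x) = 0}.
Proof.
have sT : 0 <= (0 : R) <= T by rewrite lexx ltW.
have [m0 I0] := L2_torus_sq (fC.1 _ sT).
pose G x := \int[time_measure T]_t g (t, x).
have IG1 : intg (torus_finite R d) G := intg_Rint2 Ig1.
have mG : measurable_fun setT G := intg_measurable IG1.
have IG : intg (torus_finite R d) (fun x => G x ^+ 2).
  apply: (intg_le (measurable_funX _ mG) (intgZ T (intg_Rint2 Ig))).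
  apply: (ae_imp (m := torus_finite R d)
    (ae_integrable2 (m1 := time_measure T) (m2 := torus_finite R d) Ig)) => x Ix.
  rewrite ger0_norm ?sqr_ge0//; apply: sq_Rint_le; last exact: Ix.
  exact: (measurableT_comp mg (pair2_measurable x)).
apply: (@approx_id_eq0 _ _ _ (torus_finite R d) _ _ _ (@boxes_setI R d)
  (@boxes_setT R d) (@boxes_generate R d) (@approx_id_torus R d)
  (fun x => f (0, x) + G x)).
- exact: measurable_funD.
- apply: (intg_le _ (intgZ 2 (intgD I0 IG))).
    by apply: measurable_funX; exact: measurable_funD.
  apply: aeW => x; rewrite ger0_norm ?sqr_ge0//.
  have : 0 <= (f (0, x) - G x) ^+ 2 by exact: sqr_ge0.
  by nra.
move=> N y; have bC (i : 'I_d) := pbsmooth_circle_kernel N (tnth y i).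
have b1 := bsmooth_cst (1 : R).
have bts i : bsmooth (circle_kernel N (tnth y i)) by case: (bC i).
have := weak_dt_by_parts T0 If1 Ig1 fg fC fT b1 bC.
rewrite mul1r (_ : (fun _ => _) = fun p => g p * tens (cst 1) (fun i => circle_kernel N (tnth y i)) p); last first.
  have d1 : derive1 (fun _ : R => 1 : R) = fun=> 0 by apply/funext => t; exact: derive1_cst.
  by apply/funext => p; rewrite d1 /tens /= mul0r mulr0 add0r.
rewrite (Rint_fubini2 (m1 := time_measure T) (m2 := torus_finite R d)); last exact: intg_tens.
move=> /eqP; rewrite -addr_eq0 => /eqP H; rewrite -[RHS]H {H}.
have [K HK] := approx_id_bnd (@approx_id_torus R d) N.
have mK := kernel_section1 y (approx_id_meas (@approx_id_torus R d) N).
have IK (u : tpoint R d -> R) : intg (torus_finite R d) u ->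
    intg (torus_finite R d) (fun x => torus_kernel N y x * u x).
  by move=> Iu; apply: (intg_bounded_mull (M := K)) => //; exact: aeW.
have If0 := intg_of_sq m0 I0.
under eq_Rintegral do rewrite mulrDr.
rewrite RintegralD//; [|exact: IK If0|exact: IK IG1].
rewrite addrC; congr (_ + _); last by apply: eq_Rintegral => x _; rewrite mulrC.
apply: Rint_ae_eq; apply: (ae_imp (m := torus_finite R d)
  (ae_integrable2 (m1 := time_measure T) (m2 := torus_finite R d) Ig1)) => x Ix.
rewrite -RintegralZl//; apply: eq_Rintegral => t _.
by rewrite mulrC /tens /= mul1r.
Qed.

Lemma trace_pairing W : measurable_fun setT W ->
  intg (torus_finite R d) (fun x => W x ^+ 2) ->
  \int[stm d T]_p (W p.2 * g p) = - \int[torus_finite R d]_x (f (0, x) * W x).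
Proof.
move=> mW IW; have IW2 := intg_snd (time_measure T) IW.
have mW2 : measurable_fun setT (fun p : spacetime R d => W p.2).
  exact: measurableT_comp mW measurable_snd.
rewrite (Rint_fubini2 (m1 := time_measure T) (m2 := torus_finite R d)); last first.
  exact: (intg_mul (m := stm d T) mW2 mg IW2 Ig).
rewrite -[RHS]mulN1r -RintegralZl//; last first.
  have sT : 0 <= (0 : R) <= T by rewrite lexx ltW.
  have [m0 I0] := L2_torus_sq (fC.1 _ sT).
  exact: intg_mul.
apply: Rint_ae_eq; apply: (ae_imp2 (m := torus_finite R d) trace_ae
  (ae_integrable2 (m1 := time_measure T) (m2 := torus_finite R d) Ig1)) => x E Ix /=.
rewrite RintegralZl//; move/eqP: E; rewrite addrC addr_eq0 => /eqP ->.
by rewrite mulN1r mulrN mulrC.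
Qed.

Lemma initial_mollify N W : intg (torus_finite R d) W ->
  \int[torus_finite R d]_x (mollify T 1 N f (0, x) * W x) =
  - \int[stm d T]_p (W p.2 * mollify T (-1) N g p).
Proof.
move=> IW; have [_ _ bt _ _] := mollify_smooth 1 N If1.
have [_ [mM [M HM]] _ _ _] := mollify_smooth (-1) N Ig1.
have I2 : intg (stm d T) (fun p => W p.2 * mollify T (-1) N g p).
  have := intg_bounded_mull (M := M) mM (intg_snd (time_measure T) IW) (aeW _ HM).
  by apply: eq_integrable => // p _; rewrite /= mulrC.
rewrite (Rint_fubini2 (m1 := time_measure T) (m2 := torus_finite R d))//.
rewrite -[RHS]mulN1r -RintegralZl//; last exact: intg_Rint2 I2.
apply: eq_Rintegral => x _; rewrite /= RintegralZl//; last first.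
  apply: (@intg_bounded _ _ _ _ M); last by apply: aeW => t; exact: HM.
  exact: (measurableT_comp mM (pair2_measurable x)).
have -> : \int[time_measure T]_t mollify T (-1) N g (t, x) =
    \int[time_measure T]_t derive1 (fun t => mollify T 1 N f (t, x)) t.
  by apply: eq_Rintegral => t _; rewrite -dt_mollify.
by rewrite (Rint_time_FTC T0 (bt x)) mollifyT//; ring.
Qed.

(** The time slice [t = 0] is a null set of space-time, so convergence of space-time pairings does
    not see the trace directly. Both traces are first rewritten as minus a space-time pairing of
    [W], constant in time, with [g] or its mollification. *)
Lemma initial_mollify_cvg W : measurable_fun setT W ->
  intg (torus_finite R d) (fun x => W x ^+ 2) ->
  \int[torus_finite R d]_x (mollify T 1 N f (0, x) * W x) @[N --> \oo] -->
  \int[torus_finite R d]_x (f (0, x) * W x).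
Proof.
move=> mW IW.
under eq_fun do rewrite (initial_mollify _ (intg_of_sq mW IW)).
have -> : \int[torus_finite R d]_x (f (0, x) * W x) = - \int[stm d T]_p (W p.2 * g p).
  by rewrite trace_pairing// opprK.
apply: cvgN.
have s1 : `|-1 : R| <= 1 by rewrite normrN1.
apply: (mollify_cvg_sq T0 s1 _ mg _ Ig); last exact: intg_snd IW.
exact: measurableT_comp mW measurable_snd.
Qed.

End primitive.
End traces.

(** * The weak formulation tested with dual variables *)

Section splitting.
Context (R : realType) (d : nat) (T : R).

Lemma Rint_split (A C D : 'I_d -> sfield R d) (B : 'I_d -> 'I_d -> sfield R d) :
  (forall i, intg (stm d T) (A i)) -> (forall i j, intg (stm d T) (B i j)) ->
  (forall i, intg (stm d T) (C i)) -> (forall i, intg (stm d T) (D i)) ->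
  \int[stm d T]_p (\sum_i A i p + \sum_i \sum_j B i j p + \sum_i C i p + \sum_i D i p) =
  \sum_i \int[stm d T]_p A i p + \sum_i \sum_j \int[stm d T]_p B i j p +
  \sum_i \int[stm d T]_p C i p + \sum_i \int[stm d T]_p D i p.
Proof.
move=> IA IB IC ID.
have sA := @intg_sum _ _ _ (stm d T) _ (index_enum 'I_d) A IA.
have sB := @intg_sum _ _ _ (stm d T) _ (index_enum 'I_d) _
  (fun i => @intg_sum _ _ _ (stm d T) _ (index_enum 'I_d) (B i) (IB i)).
have sC := @intg_sum _ _ _ (stm d T) _ (index_enum 'I_d) C IC.
have sD := @intg_sum _ _ _ (stm d T) _ (index_enum 'I_d) D ID.
have sAB := intgD sA sB.
rewrite (RintegralD measurableT (intgD sAB sC) sD).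
rewrite (RintegralD measurableT sAB sC) (RintegralD measurableT sA sB).
rewrite !Rint_sum//; last by move=> i; exact: intg_sum.
by congr (_ + _ + _ + _); apply: eq_bigr => i _; rewrite Rint_sum.
Qed.

End splitting.

Section dual_identity.
Context (R : realType) (d : nat) (T : R).
Hypothesis T0 : 0 < T.
Variables (F V : vfield R d) (W : 'I_d -> tpoint R d -> R).
Hypotheses (F2 : L2_vfield T F) (W2 : forall i, L2_torus (W i)).
Hypothesis solV : weak_solution T F W V.

Variables (lam g H : vfield R d) (gam : sfield R d) (E : 'I_d -> 'I_d -> sfield R d).
Hypothesis lamH1 : forall i, H1_L2 T (lam i).
Hypothesis lamT : forall i, {ae torus_finite R d, forall x, lam i (T, x) = 0}.
Hypothesis lam_div : weak_divfree T lam.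
Hypothesis gam2 : Lp_field T 2%:E gam.
Hypothesis g2 : forall i, Lp_field T 2%:E (g i).
Hypothesis H2 : forall i, Lp_field T 2%:E (H i).
Hypothesis EI : forall i j, Lp_field T +oo%E (E i j).
Hypothesis lamg : forall i, is_weak_dt T (lam i) (g i).
Hypothesis lamE : forall i j, is_weak_symgrad T lam i j (E i j).
Hypothesis gamH : forall i, is_weak_dx T i gam (H i).

Let lam2 i : Lp_field T 2%:E (lam i). Proof. by case: (lamH1 i). Qed.
Let V2 i : Lp_field T 2%:E (V i). Proof. by case: solV. Qed.

Let intg_L2 f : Lp_field T 2%:E f -> intg (stm d T) f.
Proof. by move=> /Lp_field_sq[mf]; exact: intg_of_sq. Qed.

Let intg_E i j : intg (stm d T) (E i j).
Proof. by have [mE [M _ EM]] := Lp_field_infty (EI i j); exact: intg_bounded mE EM. Qed.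

Let intg_mollify sgn N h f : intg (stm d T) h -> intg (stm d T) f ->
  intg (stm d T) (fun p => h p * mollify T sgn N f p).
Proof.
move=> Ih If; have [_ [mM [M HM]] _ _ _] := mollify_smooth sgn N If.
have := intg_bounded_mull (M := M) mM Ih (aeW _ HM).
by apply: eq_integrable => // p _; rewrite /= mulrC.
Qed.

Let intg_VV i j : intg (stm d T) (fun p => V i p * V j p).
Proof.
have [mi Ii] := Lp_field_sq (V2 i); have [mj Ij] := Lp_field_sq (V2 j).
exact: intg_mul.
Qed.

(** The weak formulation at the mollified fields, which are admissible: smooth, divergence free and
    zero at [T]. Their derivatives are replaced by mollified weak derivatives, the time derivative
    with the odd kernel. *)
Let identity N :
  \sum_i \int[stm d T]_p (V i p * mollify T (-1) N (g i) p) +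
  \sum_i \sum_j \int[stm d T]_p (V i p * V j p * mollify T 1 N (E i j) p) +
  \sum_i \int[stm d T]_p (V i p * mollify T 1 N (H i) p) +
  \sum_i \int[stm d T]_p (F i p * mollify T 1 N (lam i) p) +
  \sum_i \int[torus_finite R d]_x (mollify T 1 N (lam i) (0, x) * W i x) = 0.
Proof.
have Il i := intg_L2 (lam2 i); have Ig i := intg_L2 (g2 i).
have IH i := intg_L2 (H2 i); have IV i := intg_L2 (V2 i).
have IF i := intg_L2 (F2 i); have Igam := intg_L2 gam2.
have [_ /(_ (fun i => mollify T 1 N (lam i)) (mollify T 1 N gam))] := solV.
have sm i : smooth (mollify T 1 N (lam i)) by case: (mollify_smooth 1 N (Il i)).
have smg : smooth (mollify T 1 N gam) by case: (mollify_smooth 1 N Igam).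
move=> /(_ sm smg (fun t x _ => div_mollify 1 N (t, x) Il lam_div)).
move=> /(_ (fun i x => mollifyT T0 N (lam i) x)) H0; rewrite -[RHS]H0 {H0}.
rewrite -Rint_split; last 4 first.
- by move=> i; exact: intg_mollify.
- by move=> i j; exact: intg_mollify.
- by move=> i; exact: intg_mollify.
- by move=> i; exact: intg_mollify.
congr (_ + _).
  apply: eq_Rintegral => p _; congr (_ + _ + _ + _).
  - apply: eq_bigr => i _; have [ml Il2] := Lp_field_sq (lam2 i).
    have [mg Ig2] := Lp_field_sq (g2 i); have [_ _ cl] := lamH1 i.
    by rewrite (dt_mollify T0 ml mg Il2 Ig2 (lamg i) cl (lamT i)).
  - rewrite mulr_sumr; apply: eq_bigr => i _; rewrite mulr_sumr; apply: eq_bigr => j _.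
    rewrite [X in _ * (_ * X)]addrC (symgrad_mollify 1 N p Il (intg_E i j) (lamE i j)).
    by field.
  - by apply: eq_bigr => i _; rewrite (dx_mollify 1 N p Igam (IH i) (gamH i)).
rewrite -Rint_sum// => i; have [mW IW] := L2_torus_sq (W2 i).
have [_ [mM [M HM]] _ _ _] := mollify_smooth 1 N (Il i).
apply: (intg_bounded_mull (M := M)); [|exact: intg_of_sq|exact: aeW].
exact: (measurableT_comp mM (pair1_measurable (0 : measurableTypeR R))).
Qed.

Lemma dual_identity :
  \sum_i \int[stm d T]_p (V i p * g i p) +
  \sum_i \sum_j \int[stm d T]_p (V i p * V j p * E i j p) +
  \sum_i \int[stm d T]_p (V i p * H i p) +
  \sum_i \int[stm d T]_p (F i p * lam i p) +
  \sum_i \int[torus_finite R d]_x (lam i (0, x) * W i x) = 0.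
Proof.
have s1 : `|1 : R| <= 1 by rewrite normr1.
have s2 : `|-1 : R| <= 1 by rewrite normrN1.
have cs (I : finType) (u : nat -> I -> R) (v : I -> R) :
   (forall i, u N i @[N --> \oo] --> v i) -> \sum_i u N i @[N --> \oo] --> \sum_i v i.
  by move=> uv; apply: cvg_big => //; exact: add_continuous.
have L2c sgn (h f : sfield R d) : `|sgn| <= 1 -> Lp_field T 2%:E h -> Lp_field T 2%:E f ->
    \int[stm d T]_p (h p * mollify T sgn N f p) @[N --> \oo] --> \int[stm d T]_p (h p * f p).
  move=> s /Lp_field_sq[mh Ih] /Lp_field_sq[mf If].
  exact: (mollify_cvg_sq T0 s mh mf Ih If).
set L := (X in X = 0); suff H0 : (0 : R) @[N --> \oo] --> L.
  by rewrite -(cvg_unique _ (cvg_cst _) H0).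
rewrite -(funext identity) /L {L}.
apply: cvgD; [apply: cvgD; [apply: cvgD; [apply: cvgD|]|]|].
- by apply: cs => i; exact: L2c.
(* The products of velocities are only integrable, so this term uses the boundedness of the
   symmetric gradient instead of the L^2 pairing. *)
- apply: (cs) => i; apply: (cs _ _ _) => j; have [mE [M M0 EM]] := Lp_field_infty (EI i j).
  exact: (mollify_cvg_bounded T0 s1 (intg_VV i j) mE M0 EM).
- by apply: cs => i; exact: L2c.
- by apply: cs => i; exact: L2c.
apply: cs => i; have [ml Il2] := Lp_field_sq (lam2 i).
have [mg Ig2] := Lp_field_sq (g2 i); have [_ _ cl] := lamH1 i.
have [mW IW] := L2_torus_sq (W2 i).
exact: (initial_mollify_cvg T0 ml mg Il2 Ig2 (lamg i) cl (lamT i) mW IW).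
Qed.

End dual_identity.

(** * The base point and the dual problem *)

Section matrix_measurability.
Context dd (X : measurableType dd) (R : realType).

Lemma measurable_fun_inv (f : X -> R) : measurable_fun setT f ->
  measurable_fun setT (fun x => (f x)^-1).
Proof.
(* The library has no measurability lemma for inversion, only for powers. *)
move=> mf; rewrite (_ : (fun _ => _) = fun x => f x * (f x ^+ 2) `^ (-1)).
  apply: measurable_funM => //.
  apply: (measurableT_comp (measurable_powR _)).
  exact: measurable_funX.
apply/funext => x; rewrite powR_inv1 ?sqr_ge0//.
have [->|fx] := eqVneq (f x) 0; first by rewrite invr0 mul0r.
by field.
Qed.

Lemma measurable_det n (A : X -> 'M[R]_n) :
  (forall i j, measurable_fun setT (fun x => A x i j)) ->
  measurable_fun setT (fun x => \det (A x)).
Proof.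
move=> mA; apply: measurable_sum => s.
apply: measurable_funM => //; apply: measurable_prod => i _; exact: mA.
Qed.

Lemma measurable_invmx n (A : X -> 'M[R]_n) :
  (forall i j, measurable_fun setT (fun x => A x i j)) ->
  forall i j, measurable_fun setT (fun x => invmx (A x) i j).
Proof.
move=> mA i j; have mdet := measurable_det mA.
(* By convention [invmx] returns the matrix itself when it is singular; elsewhere it is given by
   cofactors. *)
rewrite (_ : (fun _ => _) = fun x => if \det (A x) == 0 then A x i j
    else (\det (A x))^-1 * cofactor (A x) j i); last first.
  apply/funext => x; rewrite /invmx unitmxE unitfE.
  by case: eqP => // _; rewrite !mxE.
apply: measurable_fun_ifT; [exact: measurable_fun_eqr|exact: mA|].
apply: measurable_funM; first exact: measurable_fun_inv.
apply: measurable_funM => //; apply: measurable_det => k l.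
by under eq_fun do rewrite !mxE; exact: mA.
Qed.

End matrix_measurability.

Section Lp_fields.
Context (R : realType) (d : nat) (T : R).
Implicit Types (f g : sfield R d).

Lemma Lp_field0 p : (1 <= p)%E -> Lp_field T p (fun _ : spacetime R d => 0).
Proof.
move=> p1; split; first by [].
have [+ _] := @Lfun_addr_closed _ _ _ (spacetime_measure T d) p p1.
by [].
Qed.

(** Periodicity is a condition at every point, so it does not pass through almost everywhere
    equality and is assumed for [g] separately. *)
Lemma Lp_field_ae_eq f g : Lp_field T 2%:E f -> Defs.periodic g ->
  measurable_fun setT g -> {ae stm d T, forall p, g p = f p} -> Lp_field T 2%:E g.
Proof.
move=> fL pg mg gf; have [mf _] := Lp_field_sq fL; split => //.
have [_] := fL; rewrite !inE => /andP[_]; rewrite inE /= => Nf.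
apply/andP; split; rewrite inE //=.
move: Nf; rewrite /finite_norm unlock.
have mp (h : sfield R d) : measurable_fun setT h ->
    measurable_fun setT (fun p => (`|(EFin \o h) p| `^ 2)%E).
  move=> mh; apply: (measurableT_comp (measurable_poweR _)).
  by apply: measurableT_comp => //; exact/measurable_EFinP.
rewrite (ae_eq_integral (fun p => (`|(EFin \o g) p| `^ 2)%E))//; [exact: mp|exact: mp|].
by apply: (ae_imp (m := stm d T) gf) => p /= ->.
Qed.

Lemma weak_dtP f : (exists g, Lp_field T 2%:E g /\ is_weak_dt T f g) ->
  Lp_field T 2%:E (weak_dt T f) /\ is_weak_dt T f (weak_dt T f).
Proof. by move=> H; exact: (xgetPex (cst 0) H). Qed.

Lemma weak_dxP i f : (exists g, Lp_field T 2%:E g /\ is_weak_dx T i f g) ->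
  Lp_field T 2%:E (weak_dx T i f) /\ is_weak_dx T i f (weak_dx T i f).
Proof. by move=> H; exact: (xgetPex (cst 0) H). Qed.

Lemma weak_symgradP (lam : vfield R d) i j :
  (exists g, Lp_field T +oo%E g /\ is_weak_symgrad T lam i j g) ->
  Lp_field T +oo%E (weak_symgrad T lam i j) /\
  is_weak_symgrad T lam i j (weak_symgrad T lam i j).
Proof. by move=> H; exact: (xgetPex (cst 0) H). Qed.

Let Rint0 : \int[stm d T]_p (0 : R) = 0.
Proof. by rewrite Rintegral_cst// mul0r. Qed.

Lemma is_weak_dt0 : is_weak_dt T (fun _ : spacetime R d => 0) (fun=> 0).
Proof.
move=> phi _; under eq_Rintegral do rewrite mul0r.
by under [in RHS]eq_Rintegral do rewrite mul0r; rewrite Rint0 oppr0.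
Qed.

Lemma is_weak_dx0 i : is_weak_dx T i (fun _ : spacetime R d => 0) (fun=> 0).
Proof.
move=> phi _; under eq_Rintegral do rewrite mul0r.
by under [in RHS]eq_Rintegral do rewrite mul0r; rewrite Rint0 oppr0.
Qed.

Lemma is_weak_symgrad0 i j : is_weak_symgrad T (fun _ (_ : spacetime R d) => 0) i j (fun=> 0).
Proof.
move=> phi _; under eq_Rintegral do rewrite !mul0r addr0 mulr0.
by under [in RHS]eq_Rintegral do rewrite mul0r; rewrite Rint0 oppr0.
Qed.

Hypothesis T0 : 0 < T.

(** The choice made by [weak_dt] may return any representative, so even for the zero field the
    derivative is known only almost everywhere, by [weak_zero]. The same holds for the two
    companions below. *)
Lemma weak_dt0_ae : {ae stm d T, forall p, weak_dt T (fun _ : spacetime R d => 0) p = 0}.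
Proof.
have [] : Lp_field T 2%:E (weak_dt T (fun _ : spacetime R d => 0)) /\
    is_weak_dt T (fun _ : spacetime R d => 0) (weak_dt T (fun _ : spacetime R d => 0)).
  by apply: weak_dtP; exists (fun=> 0); split; [apply: Lp_field0; rewrite lee_fin ler1n|exact: is_weak_dt0].
move=> /Lp_field_sq[mg Ig] H; apply: weak_zero => // phi Hphi.
apply: oppr_inj; rewrite oppr0 -(H _ Hphi).
by under eq_Rintegral do rewrite mul0r; exact: Rint0.
Qed.

Lemma weak_dx0_ae i : {ae stm d T, forall p, weak_dx T i (fun _ : spacetime R d => 0) p = 0}.
Proof.
have [] : Lp_field T 2%:E (weak_dx T i (fun _ : spacetime R d => 0)) /\
    is_weak_dx T i (fun _ : spacetime R d => 0) (weak_dx T i (fun _ : spacetime R d => 0)).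
  by apply: weak_dxP; exists (fun=> 0); split; [apply: Lp_field0; rewrite lee_fin ler1n|exact: is_weak_dx0].
move=> /Lp_field_sq[mg Ig] H; apply: weak_zero => // phi Hphi.
apply: oppr_inj; rewrite oppr0 -(H _ Hphi).
by under eq_Rintegral do rewrite mul0r; exact: Rint0.
Qed.

Lemma weak_symgrad0_ae i j :
  {ae stm d T, forall p, weak_symgrad T (fun _ (_ : spacetime R d) => 0) i j p = 0}.
Proof.
set g := weak_symgrad _ _ _ _.
have [] : Lp_field T +oo%E g /\ is_weak_symgrad T (fun _ (_ : spacetime R d) => 0) i j g.
  by apply: weak_symgradP; exists (fun=> 0); split; [apply: Lp_field0; rewrite leey|exact: is_weak_symgrad0].
move=> /Lp_field_infty[mg [M M0 gM]] H; apply: weak_zero => //.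
  apply: (@intg_bounded _ _ _ _ (M ^+ 2)); first exact: measurable_funX.
  by apply: (ae_imp (m := stm d T) gM) => p gp; rewrite normrX lerXn2r ?nnegrE.
move=> phi Hphi; apply: oppr_inj; rewrite oppr0 -(H _ Hphi).
by under eq_Rintegral do rewrite !mul0r addr0 mulr0; exact: Rint0.
Qed.

Lemma Nmx0_ae (aV : R) : {ae stm d T, forall p,
  Nmx T aV (fun _ (_ : spacetime R d) => 0) p = aV%:M}.
Proof.
have H : {ae stm d T, forall p, forall ij : 'I_d * 'I_d,
    weak_symgrad T (fun _ (_ : spacetime R d) => 0) ij.1 ij.2 p = 0}.
  apply: filter_forall => ij; exact: weak_symgrad0_ae.
apply: (ae_imp (m := stm d T) H) => p Hp.
by apply/matrixP => i j; rewrite !mxE (Hp (i, j)) mulr0 addr0.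
Qed.

End Lp_fields.

(** * Optimality of the zero dual pair and its primal field *)

Section duality.
Context (R : realType) (d : nat) (T aV : R).
Variables (F : vfield R d) (W : 'I_d -> tpoint R d -> R) (Vt : vfield R d).
Hypotheses (T0 : 0 < T) (aV0 : 0 < aV).
Hypotheses (F2 : L2_vfield T F) (W2 : forall i, L2_torus (W i)).
Hypothesis solV : weak_solution T F W Vt.

Local Notation zero := ((fun _ _ => 0, fun _ => 0) : vfield R d * sfield R d).

Let Vt2 : L2_vfield T Vt. Proof. by case: solV. Qed.

Let L20 : Lp_field T 2%:E (fun _ : spacetime R d => 0).
Proof. by apply: Lp_field0; rewrite lee_fin ler1n. Qed.

Lemma dual_class0 : dual_class T zero.
Proof.
split; [split => /=|split => /=].
- move=> i; split => //.
    by exists (fun=> 0); split => //; exact: is_weak_dt0.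
  split=> [t _|s _].
    split; first by [].
    have p1 : (1 <= 2%:E :> \bar R)%E by rewrite lee_fin ler1n.
    by have [+ _] := @Lfun_addr_closed _ _ _ (torus_measure R d) 2%:E p1.
  under eq_fun do under eq_Rintegral do rewrite subrr expr0n.
  by under eq_fun do rewrite Rintegral_cst// mul0r; exact: cvg_cst.
- move=> i j; exists (fun=> 0); split; last exact: is_weak_symgrad0.
  by apply: Lp_field0; rewrite leey.
- move=> phi _; under eq_Rintegral do under eq_bigr do rewrite mul0r.
  by under eq_Rintegral do rewrite big1_eq; rewrite Rintegral_cst// mul0r.
- by move=> i; exact: aeW.
- split => // i; exists (fun=> 0); split => //; exact: is_weak_dx0.
- by apply: aeW => t; rewrite Rintegral_cst// mul0r.
Qed.

Lemma quadratic_form (v : 'I_d -> R) (e : 'I_d -> 'I_d -> R) :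
  2^-1 * (\sum_i \sum_j v i * v j * (aV *+ (i == j) + 2 * e i j)) =
  2^-1 * aV * (\sum_i v i * v i) + \sum_i \sum_j v i * v j * e i j.
Proof.
rewrite mulr_sumr mulr_sumr -big_split; apply: eq_bigr => i _ /=.
under eq_bigr do rewrite mulrDr.
rewrite big_split mulrDr (bigD1 i)//= eqxx mulr1n big1 ?addr0; last first.
  by move=> j; rewrite eq_sym => /negbTE ->; rewrite mulr0n mulr0.
congr (_ + _); first by ring.
by rewrite mulr_sumr; apply: eq_bigr => j _; field.
Qed.

Section fixed_dual.
Variable lg : vfield R d * sfield R d.
Hypothesis lgD : dual_class T lg.

Local Notation g i := (weak_dt T (lg.1 i)).
Local Notation H i := (weak_dx T i lg.2).
Local Notation E i j := (weak_symgrad T lg.1 i j).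

Let gP i : Lp_field T 2%:E (g i) /\ is_weak_dt T (lg.1 i) (g i).
Proof. by case: lgD => [[+ _ _ _] _] => /(_ i)[_ + _]; exact: weak_dtP. Qed.

Let HP i : Lp_field T 2%:E (H i) /\ is_weak_dx T i lg.2 (H i).
Proof. by case: lgD => [_ [[_ +] _]] => /(_ i); exact: weak_dxP. Qed.

Let EP i j : Lp_field T +oo%E (E i j) /\ is_weak_symgrad T lg.1 i j (E i j).
Proof. by case: lgD => [[_ + _ _] _] => /(_ i j); exact: weak_symgradP. Qed.

Let lamH1 i : H1_L2 T (lg.1 i).
Proof. by case: lgD => [[+ _ _ _] _]. Qed.

Let lam2 i : Lp_field T 2%:E (lg.1 i). Proof. by case: (lamH1 i). Qed.

Let intg_LL f h : Lp_field T 2%:E f -> Lp_field T 2%:E h ->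
  intg (stm d T) (fun p => f p * h p).
Proof. by move=> /Lp_field_sq[mf If] /Lp_field_sq[mh Ih]; exact: intg_mul. Qed.

Let intg_trace i : intg (torus_finite R d) (fun x => lg.1 i (0, x) * W i x).
Proof.
have sT : 0 <= (0 : R) <= T by rewrite lexx ltW.
have [_ _ [/(_ _ sT) L0 _]] := lamH1 i.
have [m0 I0] := L2_torus_sq L0; have [mW IW] := L2_torus_sq (W2 i).
exact: intg_mul.
Qed.

Let intg_VVE V i j : L2_vfield T V -> intg (stm d T) (fun p => V i p * V j p * E i j p).
Proof.
move=> V2; have [EL _] := EP i j; have [mE [M _ EM]] := Lp_field_infty EL.
have := intg_bounded_mull mE (intg_LL (V2 i) (V2 j)) EM.
by apply: eq_integrable => // p _; rewrite /= mulrC.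
Qed.

(** Completing the square in the terms with [aV]: because the base state is [Vt] itself, they
    combine into a multiple of the squared distance to [Vt], and what remains is the weak
    formulation. *)
Lemma functionalE V : L2_vfield T V -> functional T aV F W Vt lg V =
  \int[stm d T]_p (\sum_i V i p * g i p + \sum_i \sum_j V i p * V j p * E i j p +
    \sum_i V i p * H i p + \sum_i F i p * lg.1 i p +
    (2^-1 * aV * \sum_i (V i p - Vt i p) ^+ 2)) +
  \sum_i \int[torus_finite R d]_x (lg.1 i (0, x) * W i x).
Proof.
move=> V2.
have E1 : (fun p => 2^-1 * (\sum_i \sum_j V i p * V j p * Nmx T aV lg.1 p i j)
     + \sum_i V i p * (g i p + H i p - aV * Vt i p)) =
  (fun p => 2^-1 * aV * (\sum_i V i p * V i p) + \sum_i \sum_j V i p * V j p * E i j p +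
     (\sum_i V i p * g i p + \sum_i V i p * H i p - aV * \sum_i V i p * Vt i p)).
  apply/funext => p; congr (_ + _).
    rewrite -quadratic_form; congr (_ * _).
    by apply: eq_bigr => i _; apply: eq_bigr => j _; rewrite mxE.
  rewrite mulr_sumr -sumrN -!big_split; apply: eq_bigr => i _ /=; ring.
have I1 : intg (stm d T) (fun p => 2^-1 * (\sum_i \sum_j V i p * V j p * Nmx T aV lg.1 p i j)
     + \sum_i V i p * (g i p + H i p - aV * Vt i p)).
  rewrite E1; apply: intgD; [apply: intgD|apply: intgB; [apply: intgD|apply: intgZ]].
  - by apply: intgZ; apply: intg_sum => i; exact: intg_LL.
  - by apply: intg_sum => i; apply: intg_sum => j; exact: intg_VVE.
  - by apply: intg_sum => i; apply: intg_LL => //; case: (gP i).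
  - by apply: intg_sum => i; apply: intg_LL => //; case: (HP i).
  - by apply: intg_sum => i; exact: intg_LL.
have I2 : intg (stm d T) (fun p => 2^-1 * aV * (\sum_i Vt i p * Vt i p)
     + \sum_i F i p * lg.1 i p).
  apply: intgD; first by apply: intgZ; apply: intg_sum => i; exact: intg_LL.
  by apply: intg_sum => i; exact: intg_LL.
have I3 : intg (stm d T) (fun p => T^-1 * (\sum_i lg.1 i (0, p.2) * W i p.2)).
  apply: intgZ; apply: intg_sum => i.
  exact: (intg_snd (time_measure T) (intg_trace i)).
rewrite /functional -[X in _ + X](_ : \int[stm d T]_p (2^-1 * aV * (\sum_i Vt i p * Vt i p)
     + \sum_i F i p * lg.1 i p + T^-1 * (\sum_i lg.1 i (0, p.2) * W i p.2)) = _)//.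
rewrite (RintegralD measurableT I2 I3) addrA.
rewrite -[X in X + _](RintegralD measurableT I1 I2); congr (_ + _).
  apply: eq_Rintegral => p _.
  have /= -> := congr1 (@^~ p) E1.
  have -> : \sum_i (V i p - Vt i p) ^+ 2 =
      \sum_i V i p * V i p - 2 * (\sum_i V i p * Vt i p) + \sum_i Vt i p * Vt i p.
    by rewrite mulr_sumr -sumrN -!big_split; apply: eq_bigr => i _ /=; ring.
  have alg (x y u v w z l : R) : 2^-1 * aV * x + y + (u + v - aV * w) +
    (2^-1 * aV * z + l) = u + y + v + l + 2^-1 * aV * (x - 2 * w + z) by field.
  exact: alg.
have I4 : intg (torus_finite R d) (fun x => \sum_i lg.1 i (0, x) * W i x).
  by apply: intg_sum => i; exact: intg_trace.
(* The initial term does not depend on time, so its factor [T^-1] cancels the length of the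
   interval. *)
rewrite (Rint_prod (m1 := time_measure T) (m2 := torus_finite R d)
  (intg_cst (time_measure T) T^-1) I4).
by rewrite Rintegral_cst// time_total// mulVf ?gt_eqF// mul1r Rint_sum.
Qed.

Lemma functional_base : functional T aV F W Vt lg Vt = 0.
Proof.
rewrite functionalE//.
have -> : (fun p => \sum_i Vt i p * g i p + \sum_i \sum_j Vt i p * Vt j p * E i j p +
    \sum_i Vt i p * H i p + \sum_i F i p * lg.1 i p +
    (2^-1 * aV * \sum_i (Vt i p - Vt i p) ^+ 2)) =
    fun p => \sum_i Vt i p * g i p + \sum_i \sum_j Vt i p * Vt j p * E i j p +
    \sum_i Vt i p * H i p + \sum_i F i p * lg.1 i p.
  apply/funext => p; rewrite [X in _ * X]big1 ?mulr0 ?addr0// => i _.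
  by rewrite subrr expr0n.
rewrite Rint_split; last 4 first.
- by move=> i; apply: intg_LL => //; case: (gP i).
- by move=> i j; exact: intg_VVE.
- by move=> i; apply: intg_LL => //; case: (HP i).
- by move=> i; exact: intg_LL.
have [[_ _ ld lT] [[gam2 _] _]] := lgD.
exact: (dual_identity T0 F2 W2 solV lamH1 lT ld gam2 (fun i => (gP i).1)
  (fun i => (HP i).1) (fun i j => (EP i j).1) (fun i => (gP i).2)
  (fun i j => (EP i j).2) (fun i => (HP i).2)).
Qed.

End fixed_dual.

Lemma functional0_ge0 V : L2_vfield T V -> 0 <= functional T aV F W Vt zero V.
Proof.
move=> V2; rewrite (functionalE dual_class0 V2).
rewrite [X in _ + X]big1 ?addr0; last first.
  by move=> i _; under eq_Rintegral do rewrite mul0r; rewrite Rintegral_cst// mul0r.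
have Hdx : {ae stm d T, forall p, forall i, weak_dx T i zero.2 p = 0}.
  by apply: filter_forall => i; exact: weak_dx0_ae.
have Hdt : {ae stm d T, forall p, forall i, weak_dt T (zero.1 i) p = 0}.
  by apply: filter_forall => i; exact: weak_dt0_ae.
have HE : {ae stm d T, forall p, forall ij, weak_symgrad T zero.1 ij.1 ij.2 p = 0}.
  by apply: filter_forall => ij; exact: weak_symgrad0_ae.
rewrite (Rint_ae_eq (g := fun p => 2^-1 * aV * \sum_i (V i p - Vt i p) ^+ 2)).
  apply: Rintegral_ge0 => p _; rewrite !mulr_ge0 ?invr_ge0 ?(ltW aV0)//.
  by apply: sumr_ge0 => i _; exact: sqr_ge0.
apply: (ae_imp3 (m := stm d T) Hdx Hdt HE) => p dx0 dt0 E0.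
have drop4 (a b u v w : R) : a = 0 -> b = 0 -> u = 0 -> v = 0 -> a + b + u + v + w = w.
  by move=> -> -> -> ->; rewrite !add0r.
apply: drop4; apply: big1 => i _.
- by rewrite dt0 mulr0.
- by apply: big1 => j _; rewrite (E0 (i, j)) mulr0.
- by rewrite dx0 mulr0.
- by rewrite /= mulr0.
Qed.

Lemma inner_inf0 : inner_inf T aV F W Vt zero = 0%E.
Proof.
apply/eqP; rewrite eq_le; apply/andP; split.
  apply: ereal_inf_lbound; exists Vt => //=.
  by rewrite functional_base//; exact: dual_class0.
apply: le_ereal_inf_tmp => _ [V V2 <-]; rewrite lee_fin; exact: functional0_ge0.
Qed.

Lemma variational_dual_solution0 : variational_dual_solution T aV F W Vt zero.
Proof.
split; first exact: dual_class0.
rewrite inner_inf0; apply/eqP; rewrite eq_le; apply/andP; split.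
  apply: ereal_sup_ubound; exists zero; [exact: dual_class0|exact: inner_inf0].
apply: ge_ereal_sup => _ [lg lgD <-].
apply: ereal_inf_lbound; exists Vt => //=; by rewrite functional_base.
Qed.

Lemma dual_to_primal0_ae : {ae stm d T, forall p i,
  dual_to_primal T aV Vt zero i p = Vt i p}.
Proof.
have Hdx : {ae stm d T, forall p, forall i, weak_dx T i zero.2 p = 0}.
  by apply: filter_forall => i; exact: weak_dx0_ae.
have Hdt : {ae stm d T, forall p, forall i, weak_dt T (zero.1 i) p = 0}.
  by apply: filter_forall => i; exact: weak_dt0_ae.
have HN := Nmx0_ae d T0 aV.
apply: (ae_imp3 (m := stm d T) Hdx Hdt HN) => p dx0 dt0 N0 i.
rewrite /dual_to_primal N0 invmx_scalar (bigD1 i)//= big1 ?addr0; last first.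
  by move=> j /negbTE ji; rewrite mxE eq_sym ji mulr0n mul0r.
by rewrite mxE eqxx mulr1n dx0 (dt0 i) !oppr0 !add0r mulKf// gt_eqF.
Qed.

(** The integral identity only sees [VH] up to null sets and is inherited from [Vt]. Membership in
    L^2 also involves pointwise periodicity and measurability, which are checked on the formula
    itself. *)
Lemma weak_solution_primal0 : weak_solution T F W (dual_to_primal T aV Vt zero).
Proof.
have VHae := dual_to_primal0_ae.
have [_ sol] := solV; split=> [i|lam gam sl sg dl lT]; last first.
  rewrite -[RHS](sol lam gam sl sg dl lT); congr (_ + _).
  apply: Rint_ae_eq; apply: (ae_imp (m := stm d T) VHae) => p VHp.
  by congr (_ + _ * _ + _ + _); apply: eq_bigr => i _; rewrite ?VHp//;
     apply: eq_bigr => j _; rewrite !VHp.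
have [[H1 H2 _ _] [[_ H3] _]] := dual_class0.
have dtL j : Lp_field T 2%:E (weak_dt T (zero.1 j)).
  by case: (H1 j) => _ /weak_dtP[].
have dxL j := (weak_dxP (H3 j)).1; have EL k j := (weak_symgradP (H2 k j)).1.
apply: (Lp_field_ae_eq (Vt2 i)).
(* The chosen weak derivatives are periodic at every point, as members of [Lp_field], so each
   ingredient of the formula is unchanged by the shift. *)
- move=> t x k; rewrite /dual_to_primal.
  have -> : Nmx T aV zero.1 (t, upd x k (tnth x k + 1)) = Nmx T aV zero.1 (t, x).
    by apply/matrixP => a b; rewrite !mxE; congr (_ + 2 * _); exact: (EL a b).1.
  apply: eq_bigr => j _; congr (_ * (- _ - _ + _ * _)).
  + exact: (dxL j).1.
  + exact: (dtL j).1.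
  + exact: (Vt2 j).1.
- apply: measurable_sum => j; apply: measurable_funM.
    apply: measurable_invmx => k l; under eq_fun do rewrite mxE.
    apply: measurable_funD => //; apply: measurable_funM => //.
    by case: (Lp_field_infty (EL k l)).
  apply: measurable_funD; last first.
    by apply: measurable_funM => //; case: (Lp_field_sq (Vt2 j)).
  apply: measurable_funB; last by case: (Lp_field_sq (dtL j)).
  by apply: measurable_funN; case: (Lp_field_sq (dxL j)).
- by apply: (ae_imp (m := stm d T) VHae) => p.
Qed.

End duality.

Theorem theorem3p7 (R : realType) (d : nat) (T aV : R)
    (F : vfield R d) (V0 : 'I_d -> tpoint R d -> R) (Vt : vfield R d)
    (hd : d = 2%N \/ d = 3%N) (hT : 0 < T) (haV : 0 < aV)
    (hF : L2_vfield T F)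
    (hV0 : forall i, L2_torus (V0 i))
    (hmean : forall i, \int[torus_measure R d]_x V0 i x = 0)
    (hdiv : weak_divfree0 V0)
    (hVt : weak_solution T F V0 Vt) :
  let zero : vfield R d * sfield R d := (fun _ _ => 0, fun _ => 0) in
  let VH := dual_to_primal T aV Vt zero in
  [/\ variational_dual_solution T aV F V0 Vt zero,
      {ae spacetime_measure T d, forall p, Nmx T aV zero.1 p \in unitmx},
      {ae spacetime_measure T d, forall p i, VH i p = Vt i p}
    & weak_solution T F V0 VH].
Proof.
move=> zero VH; split.
- exact: variational_dual_solution0.
- apply: (ae_imp (m := stm d T) (Nmx0_ae d hT aV)) => p.
  by rewrite /zero /= => ->; rewrite unitmxE det_scalar unitfE expf_neq0// gt_eqF.
- exact: dual_to_primal0_ae.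
- exact: weak_solution_primal0.
Qed.
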